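(* Assume the following. (i) For all $t\in\Theta$, $\varphi_t$ is invertible and increasing from $I_1$ to $I_2$, where $I_1\subset\mathbb{R}$ is an interval and $I_2\subset\mathbb{R}$. (ii) For all $x\in I_2$, the map $t\mapsto\varphi_t^{-1}(x)$ is continuously differentiable on $\Theta$, with derivative denoted $\partial\varphi_t^{-1}(x)$. (iii) For all $t\in\Theta$, $\mathbb{E}\big[|\varphi_t^{-1}(\varphi_\theta(\varepsilon))|^2\big]<+\infty$. (iv) For every compact $B\subset\Theta$, $\mathbb{E}\big[\sup_{t\in B}|\partial\varphi_t^{-1}(\varphi_\theta(\varepsilon))|^4\big]<+\infty$. (v) $a<b$ are such that $[a,b]\subset\Theta$, $\theta\in\,]a,b[$, and $(t-\theta)M'(t)>0$ for all $t\in[a,b]$ with $t\neq\theta$. Suppose moreover that $\varepsilon$ has a density $f$ and that, writing $d$ for differentiation with respect to $x$: (vi) $f$ is bounded and twice continuously differentiable on $I_1$, with bounded derivatives. (vii) For all $t\in\Theta$, $\varphi_t$ is three times continuously differentiable on $I_1$. (viii) $\varphi_\theta^{-1}$ is three times continuously differentiable on $I_2$, with bounded derivatives. (ix) $d\varphi$, $d^2\varphi$, $d^3\varphi$, i.e. the functions $(t,x)\mapsto d^k\varphi_t(x)$ for $k=1,2,3$, are bounded on $\Theta\times I_1$. Let $\widehat f_n$ be the recursive kernel estimator defined in the context. Then, for all $x\in I_1$, $$\widehat f_n(x)\xrightarrow[n\to\infty]{}f(x)\quad\text{almost surely}.$$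
   Context: $\Theta\subset\mathbb{R}$ is an interval, $\theta\in\Theta$ is an (unknown) parameter, and $(\varphi_t)_{t\in\Theta}$ is a (known) family of real functions. $(\varepsilon_n)_{n\ge0}$ is a sequence of independent identically distributed real random variables with values in $I_1$, and $X_n=\varphi_\theta(\varepsilon_n)$ for all $n\ge0$. $\varepsilon$ and $X$ denote random variables with the same distribution as $\varepsilon_n$ and $X_n$, with $X=\varphi_\theta(\varepsilon)$. Put $Z_n(t)=\varphi_t^{-1}(X_n)$ and $$M(t)=\mathbb{E}\big[|\varphi_t^{-1}(\varphi_\theta(\varepsilon))-\varepsilon|^2\big],\quad t\in\Theta;$$ under (i)--(iv), $M$ is continuously differentiable with $M'(t)=-2\,\mathbb{E}\big[\partial\varphi_t^{-1}(X)(\varepsilon-\varphi_t^{-1}(X))\big]$. Let $\pi_{[a;b]}$ be the projection of $\mathbb{R}$ onto $[a,b]$: $\pi_{[a;b]}(x)=x$ if $a\le x\le b$, $=a$ if $x\le a$, $=b$ if $x\ge b$. Let $(\gamma_n)_{n\ge1}$ be a decreasing sequence of positive real numbers with $\sum_n\gamma_n=+\infty$ and $\sum_n\gamma_n^2<+\infty$. The sequence $(\widehat\theta_n)_{n\ge0}$ is defined by a deterministic $\widehat\theta_0\in[a,b]$ and, for $n\ge0$, $$\widehat\theta_{n+1}=\pi_{[a;b]}\big(\widehat\theta_n-\gamma_{n+1}T_{n+1}\big),\qquad T_{n+1}=-2\,\partial\varphi_{\widehat\theta_n}^{-1}(X_{n+1})\big(\varepsilon_{n+1}-\varphi_{\widehat\theta_n}^{-1}(X_{n+1})\big).$$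 $K:\mathbb{R}\to\mathbb{R}$ is a positive, symmetric, integrable and bounded function with $\int_{\mathbb{R}}K(u)\,du=1$, $\lim_{|x|\to+\infty}|x|K(x)=0$ and $\int_{\mathbb{R}}u^2K(u)\,du<+\infty$. The bandwidth is $h_n=n^{-\alpha}$ with $0<\alpha<1$. The estimator is $$\widehat f_n(x)=\frac1n\sum_{i=1}^n\frac1{h_i}K\!\left(\frac{x-Z_i(\widehat\theta_{i-1})}{h_i}\right).$$
   Formalization: At an endpoint x of I_1 that belongs to I_1, the density f, as a function on ℝ, is additionally required to be continuous at x; otherwise the claim fails (for ε uniform on [0,1], the symmetric kernel gives limit 1/2 instead of f(0)=1). Interior points are unrestricted. *)

(* Defs.v *)
From HB Require Import structures.
From mathcomp Require Import all_boot all_order all_algebra.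
From mathcomp Require Import all_classical all_reals all_analysis.

Set Implicit Arguments.
Unset Strict Implicit.
Unset Printing Implicit Defensive.

Import Order.TTheory GRing.Theory Num.Theory.
Import numFieldNormedType.Exports.

Local Open Scope classical_set_scope.
Local Open Scope ring_scope.

Section relative_calculus.
Context {R : realType}.
Implicit Types (A : set R) (f : R -> R) (x : R) (k : nat).

(* The difference quotient of derive1, restricted to increments that stay in A:
   an endpoint of an interval A gets a one-sided derivative, and the values of
   f off A are irrelevant. On the interior of A this is the library's notion
   (derivable_within_interior, derive_within_interior below). *)
Definition derivable_within A f x : Prop :=
  cvg (h^-1 *: (f (h + x) - f x) @[h --> within [set h | A (h + x)] 0^']).

Definition derive_within A f x : R :=
  lim (h^-1 *: (f (h + x) - f x) @[h --> within [set h | A (h + x)] 0^']).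

Definition deriven_within A k f : R -> R := iter k (derive_within A) f.

Definition Ck_on A k f : Prop :=
  (forall j, (j < k)%N -> forall x, A x ->
     derivable_within A (deriven_within A j f) x) /\
  {within A, continuous (deriven_within A k f)}.

Definition bounded_on A f : Prop := exists C, forall x, A x -> `|f x| <= C.

Let within_interior A x :
  A° x -> within [set h | A (h + x)] 0^' = (0 : R)^'.
Proof.
move=> Ax; have Ax' : \forall h \near (0 : R)^', A (h + x).
  apply: nbhs_dnbhs.
  have c : h + x @[h --> (0 : R)] --> 0 + x.
    by apply: cvgD; [exact: cvg_id|exact: cvg_cst].
  by apply: c; rewrite add0r.
rewrite predeqE => B; split; rewrite /within /=.
  by move=> AB; apply: filterS2 Ax' AB => y Ay; exact.
by apply: filterS.
Qed.

Lemma derivable_within_interior A f x :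
  A° x -> derivable_within A f x = derivable f x 1.
Proof.
move=> Ax; rewrite /derivable_within (within_interior Ax) /derivable.
by under [in RHS]eq_fun do rewrite /= [_%:A]mulr1.
Qed.

Lemma derive_within_interior A f x : A° x -> derive_within A f x = derive1 f x.
Proof. by move=> Ax; rewrite /derive_within (within_interior Ax). Qed.

End relative_calculus.

Section probability.
Context d (T : measurableType d) (R : realType) (P : probability T R).
Local Open Scope ereal_scope.

Definition mutually_independent (X : nat -> {RV P >-> R}) : Prop :=
  forall (J : seq nat) (A : nat -> set R),
    uniq J -> (forall i, measurable (A i)) ->
    P (\bigcap_(i in [set` J]) (X i @^-1` A i)) =
    \prod_(i <- J) P (X i @^-1` A i).

Definition identically_distributed (X : nat -> {RV P >-> R}) : Prop :=
  forall n A, measurable A -> distribution P (X n) A = distribution P (X 0%N) A.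

Definition has_density (X : {RV P >-> R}) (f : R -> R) : Prop :=
  [/\ measurable_fun setT f, (forall u, (0 <= f u)%R) &
      forall A, measurable A ->
        distribution P X A = \int[lebesgue_measure]_(u in A) (f u)%:E].

End probability.

Section model.
Context {R : realType}.
Variables (Theta I1 : set R) (phi : R -> R -> R).

(* phi t x stands for $\varphi_t(x)$. When phi t is injective on I1, inv_phi t
   is its inverse, defined on the image of I1; the default value 0 taken
   elsewhere plays no role. *)
Definition inv_phi (t : R) : R -> R := 'pinv_(fun=> 0) I1 (phi t).

Definition dinv_phi (t x : R) : R := derive_within Theta (inv_phi ^~ x) t.

(* $M(t)$; finite under the second moment assumption on inv_phi *)
Definition mean_square d (T : measurableType d) (P : probability T R)
    (theta : R) (e : {RV P >-> R}) (t : R) : R :=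
  fine 'E_P[fun w => `|inv_phi t (phi theta (e w)) - e w| ^+ 2].

End model.

Definition proj_itv {R : realType} (a b x : R) : R :=
  if x <= a then a else if b <= x then b else x.

Section estimator.
Context {R : realType}.
Variables (Theta I1 : set R) (phi : R -> R -> R) (theta a b theta0 : R).
Variables (gamma : nat -> R) (K : R -> R) (alpha : R).
(* e is one realisation of the sequence $(\varepsilon_n)_n$ *)
Variable e : nat -> R.

Let X n : R := phi theta (e n).

Definition gradient_step (t : R) (n : nat) : R :=
  - 2 * dinv_phi Theta I1 phi t (X n) * (e n - inv_phi I1 phi t (X n)).

Fixpoint theta_hat (n : nat) : R :=
  if n is m.+1 then
    proj_itv a b (theta_hat m - gamma m.+1 * gradient_step (theta_hat m) m.+1)
  else theta0.

Definition bandwidth (n : nat) : R := n%:R `^ (- alpha).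

Definition f_hat (n : nat) (x : R) : R :=
  n%:R^-1 * \sum_(1 <= i < n.+1)
    (bandwidth i)^-1 *
    K ((x - inv_phi I1 phi (theta_hat i.-1) (X i)) / bandwidth i).

End estimator.

(* Main.v *)
(* Strong consistency of theta_hat: V_n = (theta_hat_n - theta)^2 satisfies
   E V_{n+1} <= E V_n - 2 gamma_{n+1} E[(theta_hat_n - theta) M'(theta_hat_n)] + c gamma_{n+1}^2,
   because the innovation eps_{n+1} is independent of the past and may be
   integrated out by Tonelli. Since sum gamma_n = +oo, E V_n is small infinitely
   often, and the maximal inequality for V stopped on leaving [0, r[ shows that
   from such a time on V stays below r outside a small event; no martingale
   convergence theorem is needed.

   Consistency of the estimator: the centred summands are orthogonal with second
   moment at most c n^alpha, so Chebyshev along n = k^p with p (1 - alpha) >= 2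
   and Etemadi's interpolation (the summands are nonnegative) reduce the claim to
   the convergence of the conditional means
   E[h^-1 K((Z(t) - x) / h)] = int K(u) f(psi_t(x + h u)) psi_t'(x + h u) du,
   psi_t = phi_theta^-1 o phi_t, to f(x) when t -> theta and h -> 0. As the second
   derivatives of psi_t are bounded uniformly in t, psi_t -> id pointwise forces
   psi_t' -> 1, and dominated convergence applies. *)

Require Import Defs.
From HB Require Import structures.
From mathcomp Require Import all_boot all_order all_algebra.
From mathcomp Require Import all_classical all_reals all_analysis.
From mathcomp Require Import measurable_realfun.
From mathcomp Require Import ring lra.

Set Implicit Arguments.
Unset Strict Implicit.
Unset Printing Implicit Defensive.

Import Order.TTheory GRing.Theory Num.Theory.
Import numFieldNormedType.Exports.

Local Open Scope classical_set_scope.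
Local Open Scope ring_scope.

(** * Independence of the past *)

(** Tonelli needs functions that are nonnegative and jointly measurable on a whole product, whereas
    the gradient and the inverse maps make sense only for t in [Theta] and noise in [I1]. Hence the
    Caratheodory fields, obtained by projecting t on [a, b] and extending by 0 off [I1], and the
    abstract recursions with a generic [H] or [k]. The fourth moment of the t-derivatives enters
    because the gradient is a product of two factors, each at most a multiple of one envelope A of
    these derivatives, so that its second moment is of order E A^4. Boundaries are the other
    obstacle. Derivatives in t are relative to [Theta], so at a and b increments may leave [a, b]:
    moments are controlled on a possibly larger interval. In x, the chain rule and the substitution
    live on the interior of [I1]; the at most two other points of [I1] have probability 0 because
    the noise has a density. At such a point, continuity of f on the line forces f to vanish. *)

Section past.
Context d (T : measurableType d) (R : realType) (P : probability T R).
Variable eps : nat -> {RV P >-> R}.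

Definition past_gen (n : nat) : set (set T) :=
  [set E | exists2 A : nat -> set R, (forall i, measurable (A i)) &
    E = \bigcap_(i in `I_n.+1) (eps i @^-1` A i)].

(** An alias of [T] carrying the sigma-algebra of eps_0, ..., eps_n, so that adaptedness is plain
    measurability out of [past_type n]. The generators are rectangles, hence a pi-system, as
    uniqueness of measures asks. *)
Definition past_type (n : nat) := g_sigma_algebraType (past_gen n).

Lemma past_gen_measurable n : past_gen n `<=` @measurable _ T.
Proof.
move=> _ [A mA ->]; rewrite bigcap_mkord; apply: bigsetI_measurable => i _.
by rewrite -[X in measurable X]setTI; exact: measurable_funP.
Qed.

Lemma past_measurable n A : @measurable _ (past_type n) A -> @measurable _ T A.
Proof.
apply: smallest_sub; last exact: past_gen_measurable.
exact: sigma_algebra_measurable.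
Qed.

Lemma past_genI n : setI_closed (past_gen n).
Proof.
move=> _ _ [A mA ->] [B mB ->]; exists (fun i => A i `&` B i).
  by move=> i; exact: measurableI.
by rewrite -bigcapI; apply: eq_bigcapr => i _; rewrite preimage_setI.
Qed.

Lemma past_genT n : past_gen n setT.
Proof.
exists (fun=> setT) => //.
by apply/esym; rewrite -subTset => x _ i _.
Qed.

Lemma past_le m n : (m <= n)%N ->
  @measurable _ (past_type m) `<=` @measurable _ (past_type n).
Proof.
move=> mn; apply: smallest_sub; first exact: (sigma_algebra_measurable (past_type n)).
move=> _ [A mA ->]; apply: sub_sigma_algebra.
exists (fun i => if (i <= m)%N then A i else setT).
  by move=> i; case: ifP.
apply/seteqP; split => x xA i /= ilt; first by case: ifPn => // im; exact: xA.
have im : (i <= m)%N by [].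
by have := xA i; rewrite /= im ltnS (leq_trans im mn); exact.
Qed.

Lemma past_eps m n : (m <= n)%N ->
  measurable_fun [set: past_type n] (eps m : past_type n -> R).
Proof.
move=> mn _ Y mY; rewrite setTI; apply: sub_sigma_algebra.
exists (fun i => if i == m then Y else setT); first by move=> i; case: ifP.
apply/seteqP; split => x xA.
  by move=> i /= _; case: eqP => [->|].
by have := xA m; rewrite /= ltnS mn eqxx; exact.
Qed.

Lemma past_measurable_fun_le d' (S : measurableType d') m n (s : T -> S) :
  (m <= n)%N ->
  measurable_fun [set: past_type m] (s : past_type m -> S) ->
  measurable_fun [set: past_type n] (s : past_type n -> S).
Proof.
move=> mn ms _ Y mY; apply: (past_le mn); exact: (ms measurableT).
Qed.

Lemma past_measurable_fun d' (S : measurableType d') n (s : T -> S) :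
  measurable_fun [set: past_type n] (s : past_type n -> S) ->
  measurable_fun [set: T] s.
Proof.
move=> ms _ Y mY; apply: (@past_measurable n); exact: (ms measurableT).
Qed.

Hypothesis eps_indep : mutually_independent eps.
Hypothesis eps_id : identically_distributed eps.
Local Open Scope ereal_scope.

(** For fixed [B] both sides are finite measures in [E]: a restriction and a multiple of P. They
    agree on rectangles by mutual independence, hence on the whole past. Identical distribution
    brings everything back to the law of [eps 0]. *)
Lemma past_indep n E B : @measurable _ (past_type n) E -> measurable B ->
  P (E `&` eps n.+1 @^-1` B) = P E * distribution P (eps 0%N) B.
Proof.
move=> pE mB.
have mEB k C : measurable C -> d.-measurable (eps k @^-1` C).
  by move=> mC; rewrite -[X in measurable X]setTI; exact: measurable_funP.
rewrite -(eps_id n.+1 mB) /distribution /pushforward.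
have pBfin : P (eps n.+1 @^-1` B) \is a fin_num
  by apply: fin_num_measure; exact: mEB.
have pB0 : (0 <= fine (P (eps n.+1 @^-1` B)))%R by exact: fine_ge0.
pose m1 := mrestr P (mEB n.+1 _ mB).
pose m2 := mscale (NngNum pB0) P.
suff : m1 E = m2 E.
  by rewrite /m1 /m2 /mrestr /mscale/= fineK// muleC.
apply: (@g_sigma_algebra_measure_unique _ _ _ (past_gen n)
  (@past_gen_measurable n) (fun=> setT)) => //.
- by move=> i; exact: past_genT.
- by apply/seteqP; split => // x _; exists 0%N.
- exact: past_genI.
- move=> _ [A mA ->].
  change (P (\bigcap_(i < n.+1) eps i @^-1` A i `&` eps n.+1 @^-1` B) =
    (fine (P (eps n.+1 @^-1` B)))%:E * P (\bigcap_(i < n.+1) eps i @^-1` A i)).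
  rewrite fineK//.
  (* The rectangle with [B] as one more coordinate: independence is used over n+2 indices for the
     intersection and over n+1 for the past alone. *)
  pose A' i := if (i <= n)%N then A i else B.
  have mA' i : measurable (A' i) by rewrite /A'; case: ifP.
  have iotaE k : [set` iota 0 k] = `I_k.
    by apply/seteqP; split => i /=; rewrite mem_iota.
  have := eps_indep (iota_uniq 0 n.+2) mA'; rewrite iotaE.
  have -> : iota 0 n.+2 = rcons (iota 0 n.+1) n.+1.
    by rewrite -[n.+2]addn1 iotaD cats1.
  rewrite big_rcons; have -> : A' n.+1 = B by rewrite /A' ltnn.
  have -> : \bigcap_(i in `I_n.+2) (eps i @^-1` A' i) =
    \bigcap_(i in `I_n.+1) (eps i @^-1` A i) `&` eps n.+1 @^-1` B.
    apply/seteqP; split => x /=.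
      move=> xA; split.
        by move=> i /= iin; have := xA i; rewrite /= ltnW// /A' -ltnS iin; exact.
      by have := xA n.+1; rewrite /= /A' !ltnn ltnS leqnn; exact.
    move=> [xA xB] i /=; rewrite ltnS leq_eqVlt => /predU1P[->|iin].
      by rewrite /A' ltnn.
    by rewrite /A' -ltnS iin; exact: xA.
  move=> ->; rewrite muleC; congr (_ * _).
  have := eps_indep (iota_uniq 0 n.+1) mA; rewrite iotaE => ->.
  rewrite !big_seq; apply: eq_bigr => i.
  by rewrite mem_iota /= add0n ltnS /A' => ->.
- move=> _; change (P (setT `&` eps n.+1 @^-1` B) < +oo).
  by rewrite setTI ltey_eq pBfin.
Qed.

(* The innovation at time n.+1 is independent of the past, so it can be
   integrated out first, the past being frozen. *)
Lemma integral_past d' (S : measurableType d') n (s : T -> S)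
    (Phi : S * R -> \bar R) :
  measurable_fun [set: past_type n] (s : past_type n -> S) ->
  measurable_fun [set: (S * R)%type] Phi -> (forall z, 0 <= Phi z) ->
  \int[P]_w Phi (s w, eps n.+1 w) = \int[P]_w \int[P]_v Phi (s w, eps 0%N v).
Proof.
move=> ps mPhi Phi0.
have ms := past_measurable_fun ps.
pose s' : {mfun T >-> S} := mfun_Sub (mem_set ms).
have mse : measurable_fun setT (fun w => (s w, eps n.+1 w)).
  by apply: measurable_fun_pair => //; exact: measurable_funP.
pose se : {mfun T >-> (S * R)%type} := mfun_Sub (mem_set mse).
transitivity (\int[distribution P se]_z Phi z).
  by rewrite (@ge0_integral_distribution _ _ _ _ _ P se Phi mPhi Phi0).
transitivity (\int[distribution P s' \x distribution P (eps 0%N)]_z Phi z).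
  (* The joint law is the product of the marginals, since the two agree on rectangles by
     [past_indep]. *)
  apply: eq_measure_integral => A mA _.
  apply/esym; apply: (@product_measure_unique _ _ _ _ _ (distribution P s')
    (distribution P (eps 0%N)) (distribution P se)) => // X Y mX mY.
  rewrite /distribution /pushforward.
  transitivity (P (s @^-1` X `&` eps n.+1 @^-1` Y)); first by congr (P _).
  apply: past_indep => //.
  by rewrite -[X in measurable X]setTI; exact: ps.
rewrite (fubini_tonelli1 Phi mPhi Phi0).
rewrite (@ge0_integral_distribution _ _ _ _ _ P s')//; last 2 first.
- exact: measurable_fun_fubini_tonelli_F.
- by move=> y; apply: integral_ge0 => z _; exact: Phi0.
apply: eq_integral => w _ /=; rewrite /fubini_F.
rewrite (@ge0_integral_distribution _ _ _ _ _ P (eps 0%N))//.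
by apply: measurableT_comp => //; exact: measurable_pair1.
Qed.

(** Plays the role of a conditional expectation bound: an estimate obtained with the past frozen at
    [s w] and a fresh innovation averaged passes to the integral. *)
Lemma le_integral_past d' (S : measurableType d') n (s : T -> S)
    (Phi : S * R -> \bar R) (g : T -> \bar R) :
  measurable_fun [set: past_type n] (s : past_type n -> S) ->
  measurable_fun [set: (S * R)%type] Phi -> (forall z, 0 <= Phi z) ->
  measurable_fun setT g ->
  (forall w, \int[P]_v Phi (s w, eps 0%N v) <= g w) ->
  \int[P]_w Phi (s w, eps n.+1 w) <= \int[P]_w g w.
Proof.
move=> ps mPhi Phi0 mg le_g; rewrite (integral_past ps mPhi Phi0).
apply: ge0_le_integral => //.
  by move=> w _; apply: integral_ge0 => v _; exact: Phi0.
rewrite [X in measurable_fun _ X](_ : _ =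
    fubini_F (distribution P (eps 0%N)) Phi \o s); last first.
  apply/funext => w /=; rewrite /fubini_F.
  rewrite (@ge0_integral_distribution _ _ _ _ _ P (eps 0%N))//.
  by apply: measurableT_comp => //; exact: measurable_pair1.
apply: measurableT_comp; first exact: measurable_fun_fubini_tonelli_F.
exact: past_measurable_fun ps.
Qed.

End past.

(** * Tails of the step size series *)

Section series_tails.
Context {R : realType}.
Implicit Types g : nat -> R.

Lemma nneseries_infinite_tail g : (forall n, (1 <= n)%N -> 0 < g n) ->
  (\sum_(1 <= n <oo) (g n)%:E = +oo)%E ->
  forall (N : nat) (C : R), exists n, C <= \sum_(N <= i < n) g i.+1.
Proof.
move=> g0 gdiv N C.
have [n hn] : exists n, C + \sum_(0 <= i < N) g i.+1 <= \sum_(0 <= i < n) g i.+1.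
  apply: contrapT => /forallNP hn.
  suff : (\sum_(1 <= n <oo) (g n)%:E <= (C + \sum_(0 <= i < N) g i.+1)%:E)%E.
    by rewrite gdiv leye_eq.
  apply: lime_le.
    by apply: is_cvg_nneseries => n n1 _; rewrite lee_fin ltW// g0.
  exists 1%N => //= n n1; rewrite sumEFin lee_fin.
  by rewrite big_add1/=; have /negP := hn n.-1; rewrite -ltNge => /ltW.
exists n; have [Nn|nN] := leqP N n.
  by move: hn; rewrite (big_cat_nat (leq0n N) Nn)/= [C + _]addrC lerD2l.
have sN : \sum_(0 <= i < n) g i.+1 <= \sum_(0 <= i < N) g i.+1.
  rewrite (big_cat_nat (leq0n n) (ltnW nN))/= lerDl sumr_ge0// => i _.
  by rewrite ltW// g0.
by rewrite big_geq 1?ltnW//; lra.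
Qed.

Lemma nneseries_finite_tail g : (forall n, 0 <= g n) ->
  (\sum_(1 <= n <oo) (g n)%:E < +oo)%E ->
  forall e, 0 < e -> exists N, forall m n, (N <= m)%N ->
    \sum_(m <= i < n) g i.+1 <= e.
Proof.
move=> g0 gfin e e0.
have g0' n : (0 <= (g n.+1)%:E)%E by rewrite lee_fin.
have gfin' : (\sum_(0 <= n <oo) (g n.+1)%:E < +oo)%E.
  apply: le_lt_trans gfin; apply: lime_le.
    by apply: is_cvg_nneseries => n _ _.
  near=> n; apply: le_trans (nneseries_lim_ge n.+1 _); last first.
    by move=> k _ _; rewrite lee_fin.
  by rewrite big_add1.
have /fine_cvgP[_ /cvgrPdist_lt/(_ e e0)[N _ hN]] :=
  nneseries_tail_cvg gfin' (fun k _ => g0' k).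
exists N => m n Nm; have := hN m Nm; rewrite /= sub0r normrN.
have fin : (\sum_(m <= k <oo) (g k.+1)%:E)%E \is a fin_num.
  rewrite ge0_fin_numE; last by apply: nneseries_ge0 => *.
  apply: le_lt_trans gfin'; rewrite (nneseries_split 0 m)//= add0n leeDr//.
  by apply: sume_ge0 => *.
rewrite ger0_norm; last by apply: fine_ge0; apply: nneseries_ge0.
move=> /ltW; apply: le_trans.
rewrite -lee_fin fineK// -sumEFin.
by apply: nneseries_lim_ge => k _ _.
Unshelve. all: by end_near. Qed.

(** Sum the recursion from a late time L: the squared steps cost at most c in total, while the drift
    subtracts k times a divergent sum, which would push [v] below 0. *)
Lemma drift_contra (v g : nat -> R) (k c : R) (N : nat) :
  (forall n, 0 <= v n) -> 0 < k -> 0 <= c ->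
  (forall n, (N <= n)%N -> v n.+1 <= v n - k * g n.+1 + c * g n.+1 ^+ 2) ->
  (forall (M : nat) (C : R), exists n, C <= \sum_(M <= i < n) g i.+1) ->
  (forall e, 0 < e -> exists M, forall m n, (M <= m)%N ->
    \sum_(m <= i < n) g i.+1 ^+ 2 <= e) -> False.
Proof.
move=> v0 k0 c0 hv gdiv gsq.
have [M hM] := gsq 1 ltr01.
set L := maxn M N.
have vL n : v (L + n)%N <= v L - k * \sum_(L <= i < L + n) g i.+1 +
    c * \sum_(L <= i < L + n) g i.+1 ^+ 2.
  elim: n => [|n IH]; first by rewrite addn0 !big_geq// !mulr0 subr0 addr0.
  rewrite addnS !big_nat_recr/= ?leq_addr//.
  have NL : (N <= L + n)%N by rewrite (leq_trans (leq_maxr M N))// leq_addr.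
  by apply: le_trans (hv _ NL) _; lra.
(* With this target the accumulated drift is at least v_L + c + 1, more than the other terms can
   compensate. *)
have [n hn] := gdiv L ((v L + c + 1) / k).
have [Ln|nL] := leqP L n; last first.
  move: hn; rewrite big_geq 1?ltnW// leNgt divr_gt0//.
  by rewrite ltr_wpDl// addr_ge0.
have := vL (n - L)%N; rewrite subnKC// leNgt; apply/negP/negPn.
have : c * \sum_(L <= i < n) g i.+1 ^+ 2 <= c.
  by rewrite -[leRHS]mulr1 ler_wpM2l// hM// leq_maxl.
move: hn; rewrite ler_pdivrMr// mulrC.
by have := v0 n; lra.
Qed.

End series_tails.

(** * Integrability of bounded and of square integrable variables *)

Section bounded_random_variables.
Context d (T : measurableType d) (R : realType) (P : probability T R).

Lemma bounded_integrable (f : T -> R) (C : R) :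
  measurable_fun setT f -> (forall w, `|f w| <= C) ->
  P.-integrable setT (EFin \o f).
Proof.
move=> mf fC; apply: measurable_bounded_integrable => //.
  by rewrite ltey_eq fin_num_measure.
exists C; split; [exact: num_real|].
by move=> M CM w _ /=; exact: le_trans (fC w) (ltW CM).
Qed.

Lemma EFin_Rintegral (f : T -> R) : P.-integrable setT (EFin \o f) ->
  (\int[P]_w f w)%:E = (\int[P]_w (f w)%:E)%E.
Proof. by move=> fi; rewrite /Rintegral fineK// integrable_fin_num. Qed.

Lemma Rintegral_prob_cst (r : R) : \int[P]_w r = r.
Proof. by rewrite Rintegral_cst//= probability_setT mulr1. Qed.

Lemma square_integrable_integrable (f : T -> R) (c : R) :
  measurable_fun setT f -> (\int[P]_w (f w ^+ 2)%:E <= c%:E)%E ->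
  P.-integrable setT (EFin \o f) /\ P.-integrable setT (EFin \o (fun w => f w ^+ 2)).
Proof.
move=> mf fc.
have f2i : P.-integrable setT (EFin \o (fun w => f w ^+ 2)).
  apply/integrableP; split.
    by apply/measurable_EFinP; exact: measurable_funX.
  apply: le_lt_trans (ltry c); apply: le_trans fc.
  by under eq_integral do rewrite /= ger0_norm ?sqr_ge0//.
split => //.
have : P.-integrable setT (EFin \o (fun w => 1 + f w ^+ 2)).
  rewrite [X in _.-integrable _ X](_ : _ =
    (EFin \o cst 1%R) \+ (EFin \o (fun w => f w ^+ 2)%R))%E//.
  by apply: integrableD => //; exact: finite_measure_integrable_cst.
apply: le_integrable => //; first exact/measurable_EFinP.
move=> w _ /=; rewrite lee_fin [leRHS]ger0_norm ?addr_ge0 ?sqr_ge0//.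
have [->|f0] := eqVneq (f w) 0; first by rewrite normr0 expr0n addr0.
(* Expanding this square gives 2 |f| <= 1 + f^2. *)
have := sqr_ge0 (`|f w| - 1); rewrite sqrrB1 -normrX ger0_norm ?sqr_ge0//.
have := normr_ge0 (f w); lra.
Qed.

End bounded_random_variables.

(** * The projection on [a, b] *)

Section projection.
Context {R : realType}.
Variables (a b : R) (ab : a <= b).

Lemma proj_itv_maxmin x : proj_itv a b x = Num.max a (Num.min b x).
Proof.
rewrite /proj_itv; case: (leP b x) => bx.
  by case: (leP a b) ab => // _ _; case: ifPn => //; move: ab bx; lra.
by case: (leP x a) => // xa; lra.
Qed.

Lemma proj_itv_bounds x : a <= proj_itv a b x <= b.
Proof.
rewrite /proj_itv; case: (leP x a) => [_|]; first by rewrite lexx ab.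
by case: (leP b x) => [_ _|/ltW -> /ltW ->//]; rewrite lexx ab.
Qed.

Lemma proj_itv_id x : a <= x <= b -> proj_itv a b x = x.
Proof.
move=> /andP[ax xb]; rewrite /proj_itv.
by case: (leP x a) => [?|_]; [lra|case: (leP b x) => // ?; lra].
Qed.

Lemma proj_itv_contraction x t : a <= t <= b ->
  (proj_itv a b x - t) ^+ 2 <= (x - t) ^+ 2.
Proof.
move=> /andP[at_ tb]; rewrite /proj_itv; case: (leP x a) => [xa|ax].
  by rewrite -[leRHS]sqrrN -[leLHS]sqrrN !opprB ler_sqr ?nnegrE; lra.
by case: (leP b x) => // bx; rewrite ler_sqr ?nnegrE; lra.
Qed.

Lemma measurable_proj_itv : measurable_fun setT (proj_itv a b).
Proof.
rewrite (_ : proj_itv a b = cst a \max (cst b \min id)); last first.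
  by apply/funext => x; rewrite proj_itv_maxmin.
by apply: measurable_maxr => //; exact: measurable_minr.
Qed.

End projection.

(** * The projected Robbins-Monro algorithm *)

Section robbins_monro_convergence.
Context d (T : measurableType d) (R : realType) (P : probability T R).
Variable eps : nat -> {RV P >-> R}.
Hypothesis eps_indep : mutually_independent eps.
Hypothesis eps_id : identically_distributed eps.
Variables (a b theta theta0 c : R) (gamma : nat -> R) (H : R -> R -> R).
Hypothesis theta_ab : a <= theta <= b.
Hypothesis theta0_ab : a <= theta0 <= b.
Hypothesis gamma_gt0 : forall n, (1 <= n)%N -> 0 < gamma n.
Hypothesis gamma_sum : (\sum_(1 <= n <oo) (gamma n)%:E = +oo)%E.
Hypothesis gamma_sum2 : (\sum_(1 <= n <oo) (gamma n ^+ 2)%:E < +oo)%E.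
Hypothesis mH : measurable_fun [set: (R * R)%type] (fun z => H z.1 z.2).
Hypothesis H_L2 : forall t, a <= t <= b ->
  (\int[P]_w (H t (eps 0%N w) ^+ 2)%:E <= c%:E)%E.

(** [theta_hat] with its gradient replaced by a field [H] that is measurable on the whole plane;
    [theta_hat_robbins_monro] makes the link. *)
Fixpoint robbins_monro (e : nat -> R) (n : nat) : R :=
  if n is m.+1 then
    proj_itv a b (robbins_monro e m -
      gamma m.+1 * H (robbins_monro e m) (e m.+1))
  else theta0.

Let th n w := robbins_monro (fun k => eps k w) n.
Let V n w := (th n w - theta) ^+ 2.
Let drift t := (t - theta) * \int[P]_v H t (eps 0%N v).

Let ab : a <= b. Proof. by case/andP: theta_ab => /le_trans h /h. Qed.

Lemma robbins_monro_bounds e n : a <= robbins_monro e n <= b.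
Proof. by case: n => //= n; exact: proj_itv_bounds. Qed.

Lemma robbins_monro_past n :
  measurable_fun [set: past_type eps n] (th n : past_type eps n -> R).
Proof.
elim: n => [|n IH]; first exact: measurable_cst.
apply: measurableT_comp; first exact: measurable_proj_itv.
have IH' := past_measurable_fun_le (leqnSn n) IH.
apply: measurable_funB => //; apply: measurable_funM; first exact: measurable_cst.
apply: (@measurableT_comp _ _ _ _ _ _ (fun z : R * R => H z.1 z.2) _
  (fun w : past_type eps n.+1 => (th n w, eps n.+1 w))) => //.
apply: (@measurable_fun_pair _ _ _ (past_type eps n.+1)) => //.
exact: past_eps.
Qed.

Let mth n : measurable_fun setT (th n).
Proof.
exact: (@past_measurable_fun _ _ _ _ eps _ _ n _ (@robbins_monro_past n)).
Qed.

Let mV n : measurable_fun setT (V n).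
Proof. by apply: measurable_funX; apply: measurable_funB => //; exact: mth. Qed.

Let dist_bound t : a <= t <= b -> (t - theta) ^+ 2 <= (b - a) ^+ 2.
Proof.
move=> tab; rewrite -real_normK ?num_real// ler_sqr ?nnegrE ?subr_ge0//.
by move: theta_ab tab; rewrite ler_norml; lra.
Qed.

Let V_bound n w : `|V n w| <= (b - a) ^+ 2.
Proof.
by rewrite ger0_norm ?sqr_ge0//; apply: dist_bound; exact: robbins_monro_bounds.
Qed.

Let mHt t : measurable_fun setT (fun w => H t (eps 0%N w)).
Proof.
apply: (@measurableT_comp _ _ _ _ _ _ (fun z : R * R => H z.1 z.2) _
  (fun w => (t, eps 0%N w))) => //.
by apply: measurable_fun_pair => //; exact: measurable_funP.
Qed.

(** Expand the square with t frozen: the cross term is the drift by definition, and the quadratic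
    term is at most g^2 c. *)
Let one_step t g : a <= t <= b ->
  (\int[P]_v ((t - g * H t (eps 0%N v) - theta) ^+ 2)%:E <=
   ((t - theta) ^+ 2 - 2 * g * drift t + g ^+ 2 * c)%:E)%E.
Proof.
move=> tab; have [Hi H2i] := square_integrable_integrable (mHt t) (H_L2 tab).
under eq_integral => v _.
  rewrite (_ : (t - g * H t (eps 0%N v) - theta) ^+ 2 =
    ((t - theta) ^+ 2 + - (2 * g * (t - theta)) * H t (eps 0%N v)) +
    g ^+ 2 * H t (eps 0%N v) ^+ 2); last by ring.
  over.
have Zi k (f : T -> R) : P.-integrable setT (EFin \o f) ->
    P.-integrable setT (EFin \o (fun v => k * f v)).
  by move=> fi; apply: (integrableZl measurableT k fi).
have ci k : P.-integrable setT (EFin \o (fun=> k : R)).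
  exact: finite_measure_integrable_cst.
have Di (f h : T -> R) : P.-integrable setT (EFin \o f) ->
    P.-integrable setT (EFin \o h) ->
    P.-integrable setT (EFin \o (fun v => f v + h v)).
  by move=> fi hi; apply: (integrableD measurableT fi hi).
have i12 := Di _ _ (ci ((t - theta) ^+ 2)) (Zi (- (2 * g * (t - theta))) _ Hi).
rewrite -(EFin_Rintegral (Di _ _ i12 (Zi (g ^+ 2) _ H2i))).
rewrite lee_fin (RintegralD measurableT i12 (Zi (g ^+ 2) _ H2i)).
rewrite (RintegralD measurableT (ci _) (Zi _ _ Hi)).
rewrite !RintegralZl// Rintegral_prob_cst lerD//; last first.
  rewrite ler_wpM2l ?sqr_ge0// -lee_fin EFin_Rintegral//; exact: H_L2.
by rewrite /drift le_eqVlt; apply/orP; left; apply/eqP; ring.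
Qed.

(* The drift is only used through a lower bound away from [theta], which
   spares the measurability of [drift]. *)
Lemma robbins_monro_step n (A : set T) (r eta : R) :
  @measurable _ (past_type eps n) A ->
  (forall t, a <= t <= b -> 0 <= drift t) ->
  (forall t, a <= t <= b -> r <= (t - theta) ^+ 2 -> eta <= drift t) ->
  \int[P]_w (\1_A w * V n.+1 w) <=
  \int[P]_w (\1_A w * (V n w - 2 * gamma n.+1 * eta * \1_[set v | r <= V n v] w
                       + gamma n.+1 ^+ 2 * c)).
Proof.
move=> pA drift0 drift_eta.
have mA := past_measurable pA.
have m1A : measurable_fun setT (\1_A : T -> R) by exact: measurable_indic.
set g := gamma n.+1; have g0 : 0 <= g by rewrite ltW// gamma_gt0.
have mS : measurable [set v | r <= V n v].
  rewrite -[X in measurable X]setTI.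
  exact: (measurable_fun_ler (measurable_cst r) (mV n) measurableT (Y := [set true])).
have m1S : measurable_fun setT (\1_[set v | r <= V n v] : T -> R).
  exact: measurable_indic.
set rhs := (fun w => \1_A w * (V n w - 2 * g * eta * \1_[set v | r <= V n v] w
  + g ^+ 2 * c)).
have mrhs : measurable_fun setT rhs.
  apply: measurable_funM => //; apply: measurable_funD => //.
  apply: measurable_funB => //; exact: measurable_funM.
have indic01 (B : set T) w : `|\1_B w : R| <= 1.
  by rewrite indicE; case: (_ \in _); rewrite ?normr1// normr0.
have i1 : P.-integrable setT (EFin \o (fun w => \1_A w * V n.+1 w)).
  apply: (@bounded_integrable _ _ _ _ _ ((b - a) ^+ 2)).
    exact: measurable_funM.
  by move=> w; rewrite normrM -[leRHS]mul1r ler_pM.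
have i2 : P.-integrable setT (EFin \o rhs).
  apply: (@bounded_integrable _ _ _ _ _
    ((b - a) ^+ 2 + `|2 * g * eta| + `|g ^+ 2 * c|)) => // w.
  rewrite normrM -[leRHS]mul1r ler_pM// (le_trans (ler_normD _ _))// lerD2r.
  rewrite (le_trans (ler_normB _ _))// lerD// normrM -[leRHS]mulr1.
  by rewrite ler_wpM2l.
rewrite -lee_fin !EFin_Rintegral//.
pose s w := (th n w, \1_A w : R).
(* The absolute value keeps [Phi] nonnegative on the whole space, as Tonelli requires; it does not
   change the indicator carried by [s]. *)
pose Phi (z : R * R * R) :=
  (`|z.1.2| * (z.1.1 - g * H z.1.1 z.2 - theta) ^+ 2)%:E.
have m11 : measurable_fun setT (fun z : R * R * R => z.1.1).
  by apply: measurableT_comp => //; exact: measurable_fst.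
have m12 : measurable_fun setT (fun z : R * R * R => z.1.2).
  by apply: measurableT_comp => //; exact: measurable_snd.
have mHz : measurable_fun setT (fun z : R * R * R => H z.1.1 z.2).
  apply: (@measurableT_comp _ _ _ _ _ _ (fun z : R * R => H z.1 z.2) _
    (fun z : R * R * R => (z.1.1, z.2))) => //.
  by apply: measurable_fun_pair => //; exact: measurable_snd.
have mPhi : measurable_fun setT Phi.
  apply/measurable_EFinP; apply: measurable_funM.
    exact: measurableT_comp.
  apply: measurable_funX; apply: measurable_funB => //.
  by apply: measurable_funB => //; exact: measurable_funM.
have Phi0 z : (0 <= Phi z)%E by rewrite lee_fin mulr_ge0// sqr_ge0.
have ps : measurable_fun [set: past_type eps n] (s : past_type eps n -> R * R).
  apply: (@measurable_fun_pair _ _ _ (past_type eps n)).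
    exact: robbins_monro_past.
  exact: (@measurable_indic _ (past_type eps n)).
have le1 : (\int[P]_w (\1_A w * V n.+1 w)%:E <=
    \int[P]_w Phi (s w, eps n.+1 w))%E.
  apply: ge0_le_integral => //.
  - by move=> w _; rewrite lee_fin mulr_ge0// sqr_ge0.
  - by apply/measurable_EFinP; exact: measurable_funM.
  - apply: measurableT_comp => //; apply: measurable_fun_pair => //.
    exact: past_measurable_fun ps.
  - move=> w _; rewrite lee_fin /= ger0_norm// ler_wpM2l//.
    exact: proj_itv_contraction.
apply: (le_trans le1); apply: (le_integral_past eps_indep eps_id ps mPhi Phi0).
  exact/measurable_EFinP.
move=> w.
have tab := robbins_monro_bounds (fun k => eps k w) n.
rewrite /Phi/= ger0_norm//.
under eq_integral do rewrite EFinM.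
rewrite ge0_integralZl//; last 2 first.
- apply/measurable_EFinP; apply: measurable_funX; apply: measurable_funB => //.
  by apply: measurable_funB => //; exact: measurable_funM.
- by move=> v _; rewrite lee_fin sqr_ge0.
rewrite /rhs EFinM lee_wpmul2l ?lee_fin//.
apply: (le_trans (one_step g tab)); rewrite lee_fin lerD2r lerD2l lerN2.
rewrite -mulrA; apply: ler_wpM2l; first by rewrite mulr_ge0.
(* On {r <= V} the quantitative bound applies; elsewhere only the sign of the drift is used. *)
rewrite indicE; have [|_] := boolP (_ \in _); last by rewrite mulr0 drift0.
by rewrite inE mulr1 => /drift_eta; exact.
Qed.

Hypothesis drift_gt0 : forall r, 0 < r -> exists2 eta, 0 < eta &
  forall t, a <= t <= b -> r <= (t - theta) ^+ 2 -> eta <= drift t.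

Let drift_ge0 t : a <= t <= b -> 0 <= drift t.
Proof.
move=> tab; have [->|tt] := eqVneq t theta; first by rewrite /drift subrr mul0r.
have r0 : 0 < (t - theta) ^+ 2 by rewrite exprn_even_gt0//= subr_eq0.
by have [eta e0 h] := drift_gt0 r0; rewrite (le_trans (ltW e0))// h.
Qed.

Let c_ge0 : 0 <= c.
Proof.
rewrite -lee_fin; apply: le_trans (H_L2 theta0_ab).
by apply: integral_ge0 => w _; rewrite lee_fin sqr_ge0.
Qed.

Let EV n := \int[P]_w V n w.

Let Vi n : P.-integrable setT (EFin \o V n).
Proof. exact: (@bounded_integrable _ _ _ P _ _ (@mV n) (V_bound n)). Qed.

Let Vaff n (k l : R) : P.-integrable setT (EFin \o (fun w => k * V n w + l)) /\
  \int[P]_w (k * V n w + l) = k * EV n + l.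
Proof.
have kVi := integrableZl measurableT k (Vi n).
have li : P.-integrable setT (EFin \o (fun=> l)).
  exact: finite_measure_integrable_cst.
split; first exact: (integrableD measurableT kVi li).
transitivity (\int[P]_w (k * V n w) + \int[P]_w l).
  exact: (RintegralD measurableT kVi li).
by rewrite RintegralZl//; congr (_ + _); exact: (Rintegral_prob_cst P).
Qed.

Let mlev n (A := fun r => [set w | V n w < r]) r :
  @measurable _ (past_type eps n) (A r).
Proof.
have pV : measurable_fun [set: past_type eps n] (V n : past_type eps n -> R).
  apply: measurable_funX; apply: measurable_funB => //.
  exact: robbins_monro_past.
rewrite /A -[X in measurable X]setTI.
exact: (@measurable_fun_ltr _ (past_type eps n) _ _ _ _ pV (measurable_cst r)
  measurableT [set true]).
Qed.

(** If EV_n > e for all n >= N, then since V <= B, Markov's argument gives P(V_n >= e/2) >= (EV_n -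
    e/2) / B >= e / (2 B), and the drift is at least eta on that event. Up to gamma^2 terms each
    step lowers EV by a fixed multiple of gamma, which [drift_contra] excludes. *)
Let EV_small e N : 0 < e -> exists2 n, (N <= n)%N & EV n <= e.
Proof.
move=> e0; apply: contrapT => hN.
have EVe n : (N <= n)%N -> e < EV n.
  by move=> Nn; rewrite ltNge; apply/negP => ?; apply: hN; exists n.
have r0 : 0 < e / 2 by rewrite divr_gt0.
have [eta eta0 heta] := drift_gt0 r0.
pose B := (b - a) ^+ 2 + 1.
have B0 : 0 < B by rewrite ltr_wpDl// sqr_ge0.
(* Twice [eta] times the lower bound e / (2 B) for P(V_n >= e/2). *)
pose k := 2 * eta * (e / 2 / B).
apply: (@drift_contra R EV gamma k c N).
- by move=> n; apply: Rintegral_ge0 => w _; exact: sqr_ge0.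
- by rewrite !mulr_gt0// invr_gt0.
- exact: c_ge0.
- move=> n Nn; set g := gamma n.+1.
  have g0 : 0 < g by exact: gamma_gt0.
  have := robbins_monro_step (measurableT : @measurable _ (past_type eps n) _)
    drift_ge0 heta.
  rewrite (_ : \int[P]_w (\1_setT w * V n.+1 w) = EV n.+1); last first.
    by apply: eq_Rintegral => w _; rewrite indicT mul1r.
  move=> /le_trans; apply.
  (* Replacing the indicator by its affine minorant (V - e/2) / B leaves an affine function of V,
     whose integral is explicit. *)
  have [aff_i aff] := Vaff n (1 - 2 * g * eta / B) (2 * g * eta * (e / 2 / B) + g ^+ 2 * c).
  apply: (@le_trans _ _ ((1 - 2 * g * eta / B) * EV n +
      (2 * g * eta * (e / 2 / B) + g ^+ 2 * c))); last first.
    rewrite /k; have := EVe n Nn.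
    have : 0 < 2 * g * eta / B by rewrite !mulr_gt0// invr_gt0.
    rewrite (_ : 2 * g * eta * (e / 2 / B) = (2 * g * eta / B) * (e / 2)); last by ring.
    rewrite (_ : 2 * eta * (e / 2 / B) * g = (2 * g * eta / B) * (e / 2)); last by ring.
    by set z := 2 * g * eta / B => z0 eE; nra.
  rewrite -aff; apply: le_Rintegral => //.
    apply: (@bounded_integrable _ _ _ _ _
      ((b - a) ^+ 2 + `|2 * g * eta| + `|g ^+ 2 * c|)).
      apply: measurable_funM => //; apply: measurable_funD => //.
      apply: measurable_funB => //; apply: measurable_funM => //.
      apply: measurable_indic; rewrite (_ : [set _ | _] = ~` [set w | V n w < e / 2]).
        by apply: measurableC; exact: (past_measurable (@mlev n _)).
      by apply/seteqP; split => w /=; [rewrite leNgt => /negP|move/negP; rewrite -leNgt].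
    move=> w; rewrite indicT mul1r (le_trans (ler_normD _ _))// lerD2r.
    rewrite (le_trans (ler_normB _ _))// lerD// normrM -[leRHS]mulr1.
    by rewrite ler_wpM2l// indicE; case: (_ \in _); rewrite ?normr1// normr0.
  move=> w _; rewrite indicT mul1r indicE.
  have VB : V n w <= B.
    have := V_bound n w; rewrite ger0_norm ?sqr_ge0// /B => /le_trans; apply.
    by rewrite lerDl.
  have V0 : 0 <= V n w by exact: sqr_ge0.
  suff : (V n w - e / 2) / B <= (w \in [set v | e / 2 <= V n v])%:R.
    have : 0 < 2 * g * eta by rewrite !mulr_gt0.
    set z := 2 * g * eta; set i := _%:R => z0 hi.
    rewrite (_ : (1 - z / B) * V n w + (z * (e / 2 / B) + g ^+ 2 * c) =
      V n w - z * ((V n w - e / 2) / B) + g ^+ 2 * c); last by ring.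
    by rewrite lerD2r lerD2l lerN2 ler_wpM2l// ltW.
  rewrite ler_pdivrMr//; have [/=|] := boolP (_ \in _).
    by move=> _; rewrite mul1r; lra.
  by rewrite notin_setE/= mul0r => /negP; rewrite -ltNge; lra.
- exact: nneseries_infinite_tail.
- exact: (@nneseries_finite_tail _ (fun n => gamma n ^+ 2) (fun n => sqr_ge0 _)).
Qed.

(** * Maximal inequality by stopping *)

Section excursion.
Variables (r : R) (m : nat).
Hypothesis r0 : 0 < r.

Fixpoint below (j : nat) : set T :=
  [set w | V (m + j)%N w < r] `&` (if j is j'.+1 then below j' else setT).

Let past_below j : @measurable _ (past_type eps (m + j)%N) (below j).
Proof.
elim: j => [|j IH] /=.
  by rewrite setIT; exact: (@mlev (m + 0)%N r).
apply: (@measurableI _ (past_type eps (m + j.+1)%N)).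
  exact: (@mlev (m + j.+1)%N r).
by apply: past_le IH; rewrite addnS.
Qed.

Let m_below j : measurable (below j).
Proof. exact: past_measurable (@past_below j). Qed.

Let m1_below j : measurable_fun setT (\1_(below j) : T -> R).
Proof. exact: measurable_indic. Qed.

Let indic01 (B : set T) w : 0 <= (\1_B w : R) <= 1.
Proof. by rewrite indicE; case: (_ \in _); rewrite lexx ler01. Qed.

(* The process stopped (at level [r]) when it leaves [below]. *)
Let q j w := \1_(below j) w * V (m + j)%N w + r * (1 - \1_(below j) w).

Let q'i j n : P.-integrable setT
  (EFin \o (fun w => \1_(below j) w * V n w)) /\
  P.-integrable setT (EFin \o (fun w => r * (1 - \1_(below j) w))).
Proof.
split.
  apply: (@bounded_integrable _ _ _ P _ ((b - a) ^+ 2)).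
    by apply: measurable_funM => //; exact: mV.
  move=> w; rewrite normrM -[leRHS]mul1r ler_pM//.
  by have /andP[? ?] := indic01 (below j) w; rewrite ger0_norm.
apply: (@bounded_integrable _ _ _ P _ r).
  by apply: measurable_funM => //; exact: measurable_funB.
move=> w; have := indic01 (below j) w => /andP[? ?].
rewrite ger0_norm ?mulr_ge0 ?subr_ge0 ?(ltW r0)//.
by rewrite -[leRHS]mulr1 ler_wpM2l ?(ltW r0)// gerBl.
Qed.

Let qi j : P.-integrable setT (EFin \o q j).
Proof.
have [h1 h2] := q'i j (m + j)%N.
exact: (integrableD measurableT h1 h2).
Qed.

(** The stopped process is a supermartingale up to the gamma^2 term. Off [below j] it is frozen at
    r. On [below j] its next value is at most V_{m+j+1}: equal to it if the process stays below r,
    and equal to r <= V_{m+j+1} if it leaves. *)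
Let q_step j : \int[P]_w q j.+1 w <= \int[P]_w q j w + gamma (m + j).+1 ^+ 2 * c.
Proof.
have [h1 h2] := q'i j (m + j)%N.
have [h3 _] := q'i j (m + j).+1.
apply: (@le_trans _ _ (\int[P]_w (\1_(below j) w * V (m + j).+1 w +
    r * (1 - \1_(below j) w)))).
  apply: le_Rintegral => //; first exact: (integrableD measurableT h3 h2).
  move=> w _; rewrite /q !indicE /= addnS in_setI.
  case: (boolP (w \in below j)) => _; rewrite ?andbF ?andbT; last by rewrite !mul0r.
  case: (boolP (w \in _)) => [_|]; first by rewrite !mul1r.
  by rewrite notin_setE/= mul0r mul1r => /negP; rewrite -leNgt; lra.
rewrite (RintegralD measurableT h3 h2) (RintegralD measurableT h1 h2).
rewrite addrAC lerD2r.
(* Threshold 0 and lower bound 0: only the sign of the drift is used. *)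
have h0 t : a <= t <= b -> 0 <= (t - theta) ^+ 2 -> 0 <= drift t.
  by move=> tab _; exact: drift_ge0.
apply: (le_trans (robbins_monro_step (@past_below j) drift_ge0 h0)).
apply: (@le_trans _ _ (\int[P]_w (\1_(below j) w * V (m + j)%N w +
    gamma (m + j).+1 ^+ 2 * c))); last first.
  have ci : P.-integrable setT (EFin \o (fun=> gamma (m + j).+1 ^+ 2 * c)).
    exact: finite_measure_integrable_cst.
  rewrite (RintegralD measurableT h1 ci) lerD2l le_eqVlt; apply/orP; left.
  by apply/eqP; exact: (Rintegral_prob_cst P).
apply: le_Rintegral => //.
- apply: (@bounded_integrable _ _ _ P _
    ((b - a) ^+ 2 + gamma (m + j).+1 ^+ 2 * c)).
    apply: measurable_funM => //; apply: measurable_funD => //.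
    rewrite [X in measurable_fun _ X](_ : _ = V (m + j)%N); first exact: mV.
    by apply/funext => w; rewrite mulr0 mul0r subr0.
  move=> w; rewrite mulr0 mul0r subr0.
  have /andP[? ?] := indic01 (below j) w.
  have V0 : 0 <= V (m + j)%N w by exact: sqr_ge0.
  have k0 : 0 <= gamma (m + j).+1 ^+ 2 * c by rewrite mulr_ge0 ?sqr_ge0.
  rewrite ger0_norm; last by rewrite mulr_ge0// addr_ge0.
  rewrite -[leRHS]mul1r ler_pM// ?addr_ge0// lerD2r.
  by have := V_bound (m + j)%N w; rewrite ger0_norm.
- have ci : P.-integrable setT (EFin \o (fun=> gamma (m + j).+1 ^+ 2 * c)).
    exact: finite_measure_integrable_cst.
  exact: (integrableD measurableT h1 ci).
- move=> w _; rewrite mulr0 mul0r subr0 mulrDr lerD2l.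
  have k0 : 0 <= gamma (m + j).+1 ^+ 2 * c by rewrite mulr_ge0 ?sqr_ge0.
  by rewrite -[leRHS]mul1r ler_wpM2r.
Qed.

Let q_le j : \int[P]_w q j w <=
  EV m + c * \sum_(m <= i < m + j) gamma i.+1 ^+ 2.
Proof.
elim: j => [|j IH].
  rewrite addn0 big_geq// mulr0 addr0; apply: le_Rintegral => //.
  move=> w _; rewrite /q /= addn0 setIT indicE.
  case: (boolP (w \in _)) => [_|]; first by rewrite subrr mulr0 addr0 mul1r.
  by rewrite notin_setE/= mul0r add0r subr0 mulr1 => /negP; rewrite -leNgt.
rewrite addnS big_nat_recr/= ?leq_addr// mulrDr addrA.
by apply: le_trans (@q_step j) _; rewrite [c * gamma _ ^+ 2]mulrC lerD2r.
Qed.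

(** Markov's inequality for the stopped process: q_j >= r once the level has been left. *)
Lemma below_proba j : (P (~` below j) <=
  ((EV m + c * \sum_(m <= i < m + j) gamma i.+1 ^+ 2) / r)%:E)%E.
Proof.
have -> : P (~` below j) = (\int[P]_w (1 - \1_(below j) w))%:E.
  rewrite EFin_Rintegral; last first.
    apply: (@bounded_integrable _ _ _ P _ 1); first exact: measurable_funB.
    move=> w; have /andP[? ?] := indic01 (below j) w.
    by rewrite ger0_norm ?subr_ge0// gerBl.
  rewrite -(setIT (~` below j)) -(@integral_indic _ _ _ P setT)//; last exact: measurableC.
  apply: eq_integral => w _; congr EFin.
  by rewrite !indicE in_setC; case: (_ \in _); rewrite ?subrr ?subr0.
rewrite lee_fin ler_pdivlMr// mulrC; apply: le_trans (q_le j).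
have [_ h2] := q'i j (m + j)%N.
rewrite -RintegralZl//; last first.
  apply: (@bounded_integrable _ _ _ P _ 1); first exact: measurable_funB.
  move=> w; have /andP[? ?] := indic01 (below j) w.
  by rewrite ger0_norm ?subr_ge0// gerBl.
apply: le_Rintegral => //.
by move=> w _; rewrite /q lerDr mulr_ge0 ?sqr_ge0.
Qed.

Lemma belowP w : (forall j, below j w) -> forall n, (m <= n)%N -> V n w < r.
Proof.
move=> h n mn; have := h (n - m)%N; rewrite -[in V n _](subnKC mn).
by case: (n - m)%N => [|k] [].
Qed.

Lemma below_nonincr i j : (i <= j)%N -> below j `<=` below i.
Proof.
elim: j => [|j IH]; first by rewrite leqn0 => /eqP ->.
rewrite leq_eqVlt => /predU1P[->//|]; rewrite ltnS => /IH h.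
by apply: subset_trans h => w [].
Qed.

Lemma leaves_below_proba e : (forall j, EV m + c * \sum_(m <= i < m + j) gamma i.+1 ^+ 2 <= e) ->
  measurable (\bigcup_j ~` below j) /\ (P (\bigcup_j ~` below j) <= (e / r)%:E)%E.
Proof.
move=> he; have mC j : measurable (~` below j) by exact: measurableC.
split; first exact: bigcupT_measurable.
have nd : nondecreasing_seq (fun j => ~` below j).
  by move=> i j ij; apply/subsetPset/subsetC; exact: below_nonincr.
have mU : measurable (\bigcup_j ~` below j) by exact: bigcupT_measurable.
have cv : P (~` below j) @[j --> \oo] --> P (\bigcup_j ~` below j).
  exact: nondecreasing_cvg_mu.
rewrite -(cvg_lim _ cv)//; apply: lime_le; first by apply/cvg_ex; eexists; exact: cv.
apply: nearW => j; apply: le_trans (below_proba j) _.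
by rewrite lee_fin ler_pM2r ?invr_gt0.
Qed.

End excursion.

Theorem robbins_monro_cvg :
  {ae P, forall w, robbins_monro (fun k => eps k w) n @[n --> \oo] --> theta}.
Proof.
have h r : 0 < r -> {ae P, forall w, exists m, forall n, (m <= n)%N -> V n w < r}.
  move=> r0.
  pose B m := \bigcup_j ~` below r m j.
  have mB m : measurable (B m).
    apply: bigcupT_measurable => j; apply: measurableC.
    elim: j => [|j IH] /=; apply: measurableI => //;
      exact: (past_measurable (@mlev _ r)).
  have PB e : 0 < e -> exists m, (P (B m) <= e%:E)%E.
    (* Chosen so that (e' + c e') / r = e: one [e'] for EV_m, and c e' for the tail of the squared
       steps. *)
    move=> e0; pose e' := e * r / (1 + c).
    have c1 : 0 < 1 + c by rewrite ltr_pwDl.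
    have e'0 : 0 < e' by rewrite divr_gt0// mulr_gt0.
    have [M hM] := nneseries_finite_tail (fun n => sqr_ge0 (gamma n)) gamma_sum2 e'0.
    have [m Mm hm] := EV_small M e'0.
    exists m; have [] := @leaves_below_proba r m r0 (e' + c * e') _.
      by move=> j; rewrite lerD// ler_wpM2l// hM.
    move=> _ /le_trans; apply; rewrite lee_fin /e'.
    by rewrite le_eqVlt; apply/orP; left; apply/eqP; field; rewrite ?gt_eqF.
  (* Off this set, some [m] starts a path that stays below the level forever; its probability is at
     most every e > 0. *)
  exists (\bigcap_m B m); split.
  - exact: bigcapT_measurable.
  - apply/eqP; rewrite eq_le measure_ge0 andbT.
    apply/lee_addgt0Pr => e e0; rewrite add0e.
    have [m hm] := PB e e0; apply: le_trans hm.
    apply: le_measure; rewrite ?inE//; first exact: bigcapT_measurable.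
    by move=> w; exact.
  - move=> w /= hw m _; apply: contrapT => hB; apply: hw; exists m => n mn.
    apply: (@belowP r m w) => // j; apply: contrapT => hj; apply: hB.
    by exists j.
have : {ae P, forall w, forall k : nat, exists m, forall n, (m <= n)%N ->
    V n w < k.+1%:R^-1}.
  by apply: ae_foralln => k; apply: h; rewrite invr_gt0.
apply: filterS => w hw; apply/cvgrPdist_lt => e e0.
have e20 : 0 < e ^+ 2 by rewrite exprn_gt0.
have [k hk] : exists k : nat, k.+1%:R^-1 < e ^+ 2.
  have [k] := ltr_add_invr e20; rewrite add0r => hk; by exists k.
have [m hm] := hw k; exists m => // n /= mn.
have := lt_trans (hm n mn) hk.
rewrite /V -real_normK ?num_real// ltr_sqr ?nnegrE ?(ltW e0)//.
by rewrite distrC.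
Qed.

End robbins_monro_convergence.

(** * Averages along a predictable sequence *)

Section etemadi.
Context {R : realType}.

Lemma sum_inv_squares_le (n : nat) :
  \sum_(0 <= k < n) (k.+1%:R ^+ 2 : R)^-1 <= 2.
Proof.
case: n => [|n]; first by rewrite big_geq.
(* Sharpened for the induction, whose step is 1/(n+2)^2 <= 1/(n+1) - 1/(n+2). *)
suff : \sum_(0 <= k < n.+1) (k.+1%:R ^+ 2 : R)^-1 <= 2 - n.+1%:R^-1.
  by move=> /le_trans; apply; rewrite gerBl.
elim: n => [|n IH]; first by rewrite big_nat1 expr1n invr1; lra.
rewrite big_nat_recr//=.
have a0 : (0 : R) < n.+1%:R by [].
have -> : n.+2%:R = n.+1%:R + 1 :> R by rewrite -natr1.
move: a0 IH; set x : R := n.+1%:R; set s := \sum_(_ <= _ < _) _ => x0 IH.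
apply: (@le_trans _ _ (2 - x^-1 + ((x + 1) ^+ 2)^-1)); first by rewrite lerD2r.
rewrite -subr_ge0.
have -> : 2 - (x + 1)^-1 - (2 - x^-1 + ((x + 1) ^+ 2)^-1) =
    (x * (x + 1) ^+ 2)^-1.
  by field; rewrite !gt_eqF//; lra.
by rewrite invr_ge0 mulr_ge0 ?ltW ?exprn_gt0//; lra.
Qed.

Lemma powers_bracket (p n : nat) : (0 < p)%N -> (0 < n)%N ->
  exists2 k, (0 < k)%N & (k ^ p <= n < k.+1 ^ p)%N.
Proof.
move=> p0 n0; have ex : exists k, (k ^ p <= n)%N by exists 0%N; rewrite exp0n.
have ub k : (k ^ p <= n)%N -> (k <= n)%N.
  by move=> h; apply: leq_trans h; case: k => // k; rewrite -{1}(expn1 k.+1) leq_pexp2l.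
have [k kn kmax] := ex_maxnP ex ub; exists k.
  by apply: kmax; rewrite exp1n.
rewrite kn ltnNge /=; apply/negP => /kmax; by rewrite ltnn.
Qed.

(* Etemadi's interpolation: a nondecreasing sequence is squeezed between its
   values at consecutive powers. *)
Lemma cvg_average_powers (F : nat -> R) (p : nat) (l : R) : (0 < p)%N ->
  0 <= F 0%N -> {homo F : m n / (m <= n)%N >-> m <= n} ->
  (k.+1 ^ p)%:R^-1 * F (k.+1 ^ p)%N @[k --> \oo] --> l ->
  n%:R^-1 * F n @[n --> \oo] --> l.
Proof.
move=> p0 F0 Fnd Fl.
have Fge0 n : 0 <= F n by apply: le_trans F0 (Fnd _ _ (leq0n n)).
(* Ratio of consecutive bases: for (k+1)^p <= n < (k+2)^p, replacing 1/n by the reciprocal of either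
   end costs a factor at most x_k^p, which tends to 1. *)
pose x k : R := k.+2%:R / k.+1%:R.
have x1 : x k @[k --> \oo] --> (1 : R).
  have -> : x = (fun k => 1 + k.+1%:R^-1).
    by apply/funext => k; rewrite /x -natr1 mulrDl divff// mul1r.
  rewrite -[X in _ --> X]addr0; apply: cvgD; first exact: cvg_cst.
  exact: cvg_harmonic.
have xp : x k ^+ p @[k --> \oo] --> (1 : R).
  rewrite -[X in _ --> X](expr1n R p).
  exact: (cvg_comp _ _ x1 (@exprn_continuous R p 1)).
have Fl1 : (k.+2 ^ p)%:R^-1 * F (k.+2 ^ p)%N @[k --> \oo] --> l.
  by move: Fl; rewrite -(cvg_shiftS (fun k => (k.+1 ^ p)%:R^-1 * F (k.+1 ^ p)%N)).
have up : x k ^+ p * ((k.+2 ^ p)%:R^-1 * F (k.+2 ^ p)%N) @[k --> \oo] --> l.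
  by rewrite -[X in _ --> X]mul1r; apply: cvgM.
have lo : (x k ^+ p)^-1 * ((k.+1 ^ p)%:R^-1 * F (k.+1 ^ p)%N) @[k --> \oo] --> l.
  rewrite -[X in _ --> X]mul1r; apply: cvgM => //.
  by rewrite -[X in _ --> X]invr1; apply: cvgV.
apply/cvgrPdist_lt => e e0.
have /cvgrPdist_lt/(_ e e0)[N1 _ hup] := up.
have /cvgrPdist_lt/(_ e e0)[N2 _ hlo] := lo.
exists ((maxn N1 N2).+1 ^ p)%N => // n /= Nn.
have n0 : (0 < n)%N by apply: leq_trans Nn; rewrite expn_gt0.
have [[|k]// _ /andP[kn nk]] := powers_bracket p0 n0.
have : ((maxn N1 N2).+1 ^ p < k.+2 ^ p)%N by exact: leq_ltn_trans Nn nk.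
rewrite ltn_exp2r// ltnS => Nk.
have := hup k (leq_trans (leq_maxl _ _) Nk).
have := hlo k (leq_trans (leq_maxr _ _) Nk).
have kp0 (i : nat) : (0 : R) < i.+1%:R ^+ p by rewrite exprn_gt0.
have lo_le : (x k ^+ p)^-1 * ((k.+1 ^ p)%:R^-1 * F (k.+1 ^ p)%N) <= n%:R^-1 * F n.
  rewrite mulrA; apply: ler_pM => //; last exact: Fnd.
    by rewrite mulr_ge0// invr_ge0 exprn_ge0 ?divr_ge0.
  rewrite /x natrX expr_div_n invf_div mulrAC divff ?gt_eqF// mul1r.
  rewrite lef_pV2 ?posrE ?ltr0n//.
  by rewrite -natrX ler_nat ltnW.
have le_up : n%:R^-1 * F n <= x k ^+ p * ((k.+2 ^ p)%:R^-1 * F (k.+2 ^ p)%N).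
  rewrite mulrA; apply: ler_pM => //; last by apply: Fnd; exact: ltnW.
  rewrite /x natrX expr_div_n mulrAC divff ?gt_eqF// mul1r.
  rewrite lef_pV2 ?posrE ?ltr0n//.
  by rewrite -natrX ler_nat.
rewrite /= !ltr_norml => /andP[h1 h2] /andP[h3 h4].
by apply/andP; split; lra.
Qed.

End etemadi.

(** The series of the f_n has integral at most 2c, so it is finite almost everywhere and its terms
    tend to 0. *)
Lemma ae_cvg0_of_summable d (T : measurableType d) (R : realType)
    (P : {measure set T -> \bar R}) (f : nat -> T -> R) (c : R) :
  (forall n, measurable_fun setT (f n)) -> (forall n w, 0 <= f n w) ->
  (forall n, (\int[P]_w (f n w)%:E <= (c * (n.+1%:R ^+ 2)^-1)%:E)%E) ->
  {ae P, forall w, f n w @[n --> \oo] --> 0}.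
Proof.
move=> mf f0 fc.
have c0 : 0 <= c.
  have := fc 0%N; rewrite expr1n invr1 mulr1 -lee_fin; apply: le_trans.
  by apply: integral_ge0 => w _; rewrite lee_fin.
have mfE n : measurable_fun setT (EFin \o f n) by exact/measurable_EFinP.
have fE0 n w : (0 <= (EFin \o f n) w)%E by rewrite lee_fin.
pose S w := (\sum_(0 <= n <oo) (EFin \o f n) w)%E.
have Si : P.-integrable setT S.
  apply/integrableP; split; first exact: ge0_emeasurable_sum.
  under eq_integral do rewrite gee0_abs ?nneseries_ge0//.
  rewrite integral_nneseries//.
  apply: (@le_lt_trans _ _ (c * 2)%:E); last exact: ltry.
  apply: lime_le; first by apply: is_cvg_nneseries => n _ _; exact: integral_ge0.
  apply: nearW => n; apply: (@le_trans _ _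
      (\sum_(0 <= k < n) (c * (k.+1%:R ^+ 2)^-1)%:E)%E).
    by apply: lee_sum => k _; exact: fc.
  rewrite sumEFin lee_fin -mulr_sumr ler_wpM2l//.
  exact: sum_inv_squares_le.
have := integrable_ae measurableT Si; apply: filterS => w /(_ I) Sfin.
have Slt : (S w < +oo)%E by rewrite ltey_eq Sfin.
pose g k := f k.-1 w.
have gfin : (\sum_(1 <= n <oo) (g n)%:E < +oo)%E.
  apply: le_lt_trans Slt; apply: lime_le.
    by apply: is_cvg_nneseries => n _ _; rewrite lee_fin f0.
  apply: nearW => n; rewrite big_add1 /=.
  by apply: (@nneseries_lim_ge _ (fun k => (f k w)%:E)) => k _ _; rewrite lee_fin.
apply/cvgrPdist_le => e e0.
have [N hN] := nneseries_finite_tail (fun n => f0 n.-1 w) gfin e0.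
exists N => // n /= Nn; have := hN n n.+1 Nn; rewrite big_nat1 /g/=.
by rewrite sub0r normrN ger0_norm.
Qed.

Section recursive_averages.
Context d (T : measurableType d) (R : realType) (P : probability T R).
Variable eps : nat -> {RV P >-> R}.
Hypothesis eps_indep : mutually_independent eps.
Hypothesis eps_id : identically_distributed eps.
Variables (a b c alpha l : R) (th : nat -> T -> R) (B : nat -> R).
Variable k : nat -> R -> R -> R.
Hypothesis alpha_01 : 0 < alpha < 1.
Hypothesis th_past : forall n,
  measurable_fun [set: past_type eps n] (th n : past_type eps n -> R).
Hypothesis th_ab : forall n w, a <= th n w <= b.
Hypothesis mk : forall n,
  measurable_fun [set: (R * R)%type] (fun z => k n z.1 z.2).
Hypothesis k_ge0 : forall n t e, 0 <= k n t e.
Hypothesis k_le : forall n t e, k n t e <= B n.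
Hypothesis k_L2 : forall n t, (1 <= n)%N -> a <= t <= b ->
  (\int[P]_w (k n t (eps 0%N w) ^+ 2)%:E <= (c * n%:R `^ alpha)%:E)%E.

Let g n t := \int[P]_v k n t (eps 0%N v).

Let mkt n t : measurable_fun setT (fun w => k n t (eps 0%N w)).
Proof.
apply: (@measurableT_comp _ _ _ _ _ _ (fun z : R * R => k n z.1 z.2) _
  (fun w => (t, eps 0%N w))) => //.
by apply: measurable_fun_pair => //; exact: measurable_funP.
Qed.

Let ki n t : P.-integrable setT (EFin \o (fun w => k n t (eps 0%N w))).
Proof.
apply: (@bounded_integrable _ _ _ P _ (B n)); first exact: (@mkt n t).
by move=> w; rewrite ger0_norm// k_le.
Qed.

Let mg n : measurable_fun setT (g n).
Proof.
rewrite (_ : g n = fine \o fubini_F (distribution P (eps 0%N))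
    (fun z : R * R => (k n z.1 z.2)%:E)); last first.
  apply/funext => t; rewrite /g /Rintegral /fubini_F/=; congr fine.
  rewrite (@ge0_integral_distribution _ _ _ _ _ P (eps 0%N)) => //.
    apply/measurable_EFinP.
    apply: (@measurableT_comp _ _ _ _ _ _ (fun z : R * R => k n z.1 z.2) _
      (fun e : R => (t, e))) => //.
    exact: measurable_pair1.
  by move=> y; rewrite lee_fin.
apply: measurableT_comp => //.
apply: measurable_fun_fubini_tonelli_F => [|z]; last by rewrite lee_fin.
by apply/measurable_EFinP; exact: mk.
Qed.

Let S n w := \sum_(0 <= i < n) (k i.+1 (th i w) (eps i.+1 w) - g i.+1 (th i w)).

Let S_rec n w : S n.+1 w = S n w + k n.+1 (th n w) (eps n.+1 w) - g n.+1 (th n w).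
Proof. by rewrite /S big_nat_recr//= addrA. Qed.

Let pS n : measurable_fun [set: past_type eps n] (S n : past_type eps n -> R).
Proof.
elim: n => [|n IH].
  rewrite (_ : S 0%N = cst 0); first exact: measurable_cst.
  by apply/funext => w; rewrite /S big_geq.
rewrite (_ : S n.+1 = fun w => S n w + k n.+1 (th n w) (eps n.+1 w) -
  g n.+1 (th n w)); last by apply/funext => w; rewrite S_rec.
have th' := past_measurable_fun_le (leqnSn n) (@th_past n).
apply: measurable_funB; last by apply: measurableT_comp => //; exact: mg.
apply: measurable_funD; first exact: past_measurable_fun_le (leqnSn n) IH.
apply: (@measurableT_comp _ _ _ _ _ _ (fun z : R * R => k n.+1 z.1 z.2) _
  (fun w : past_type eps n.+1 => (th n w, eps n.+1 w))) => //.
apply: (@measurable_fun_pair _ _ _ (past_type eps n.+1)) => //.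
exact: past_eps.
Qed.

Let mS n : measurable_fun setT (S n).
Proof. exact: (@past_measurable_fun _ _ _ _ eps _ _ n _ (@pS n)). Qed.

(** [g n.+1 t] is the mean of the new summand X, so the cross term with s integrates to 0 and only
    the variance of X, at most E X^2, is added. The terms without X^2 collapse to s^2 - g^2. *)
Let variance_step n t s : a <= t <= b ->
  (\int[P]_v ((s + k n.+1 t (eps 0%N v) - g n.+1 t) ^+ 2)%:E <=
   (s ^+ 2 + c * n.+1%:R `^ alpha)%:E)%E.
Proof.
move=> tab; set X := fun v => k n.+1 t (eps 0%N v); set gt := g n.+1 t.
have Xi : P.-integrable setT (EFin \o X) := @ki n.+1 t.
have mX : measurable_fun setT X := @mkt n.+1 t.
have X2i : P.-integrable setT (EFin \o (fun v => X v ^+ 2)).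
  apply: (@bounded_integrable _ _ _ P _ (B n.+1 ^+ 2)); first exact: measurable_funX.
  move=> v; rewrite normrX ger0_norm; last exact: k_ge0.
  by rewrite ler_sqr ?nnegrE ?k_le//; [exact: k_ge0|exact: le_trans (k_ge0 _ _ _) (k_le _ t 0)].
have ci r : P.-integrable setT (EFin \o (fun=> r : R)).
  exact: finite_measure_integrable_cst.
have Yi := integrableD measurableT (ci ((s - gt) ^+ 2))
  (integrableZl measurableT (2 * (s - gt)) Xi).
under eq_integral => v _.
  rewrite (_ : (s + k n.+1 t (eps 0%N v) - gt) ^+ 2 =
    ((s - gt) ^+ 2 + (2 * (s - gt)) * X v) + X v ^+ 2); last by rewrite /X; ring.
  over.
rewrite -EFin_Rintegral; last exact: (integrableD measurableT Yi X2i).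
rewrite (RintegralD measurableT Yi X2i).
rewrite (RintegralD measurableT (ci _) (integrableZl measurableT _ Xi)).
have -> : \int[P]_v (s - gt) ^+ 2 = (s - gt) ^+ 2 := Rintegral_prob_cst P _.
rewrite (RintegralZl _ measurableT Xi) -/(g n.+1 t) -/gt.
have : \int[P]_v (X v ^+ 2) <= c * n.+1%:R `^ alpha.
  by rewrite -lee_fin EFin_Rintegral//; exact: k_L2.
set u := \int[P]_v _; set z := c * _ => uz.
rewrite lee_fin; have := sqr_ge0 gt.
rewrite (_ : (s - gt) ^+ 2 + 2 * (s - gt) * gt = s ^+ 2 - gt ^+ 2); last by ring.
by lra.
Qed.

Let variance n : (\int[P]_w (S n w ^+ 2)%:E <=
  (c * \sum_(0 <= i < n) i.+1%:R `^ alpha)%:E)%E.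
Proof.
elim: n => [|n IH].
  rewrite big_geq// mulr0 integral0_eq// => w _.
  by rewrite /S big_geq// expr0n.
rewrite big_nat_recr//= mulrDr.
pose s w := (th n w, S n w).
pose Phi (z : R * R * R) := ((z.1.2 + k n.+1 z.1.1 z.2 - g n.+1 z.1.1) ^+ 2)%:E.
have m11 : measurable_fun setT (fun z : R * R * R => z.1.1).
  by apply: measurableT_comp => //; exact: measurable_fst.
have m12 : measurable_fun setT (fun z : R * R * R => z.1.2).
  by apply: measurableT_comp => //; exact: measurable_snd.
have mkz : measurable_fun setT (fun z : R * R * R => k n.+1 z.1.1 z.2).
  apply: (@measurableT_comp _ _ _ _ _ _ (fun z : R * R => k n.+1 z.1 z.2) _
    (fun z : R * R * R => (z.1.1, z.2))) => //.
  by apply: measurable_fun_pair => //; exact: measurable_snd.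
have mPhi : measurable_fun setT Phi.
  apply/measurable_EFinP; apply: measurable_funX; apply: measurable_funB.
    exact: measurable_funD.
  by apply: measurableT_comp => //; exact: mg.
have Phi0 z : (0 <= Phi z)%E by rewrite lee_fin sqr_ge0.
have ps : measurable_fun [set: past_type eps n] (s : past_type eps n -> R * R).
  by apply: (@measurable_fun_pair _ _ _ (past_type eps n)); [exact: th_past|exact: pS].
have -> : (\int[P]_w (S n.+1 w ^+ 2)%:E = \int[P]_w Phi (s w, eps n.+1 w))%E.
  by apply: eq_integral => w _; rewrite S_rec.
pose h w := (S n w ^+ 2)%:E.
have mh : measurable_fun setT h.
  by apply/measurable_EFinP; apply: measurable_funX; exact: mS.
set z := c * n.+1%:R `^ alpha.
have z0 : 0 <= z.
  rewrite -lee_fin; apply: le_trans (@k_L2 n.+1 (th n point) _ (th_ab _ _)) => //.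
  by apply: integral_ge0 => w _; rewrite lee_fin sqr_ge0.
have mhz : measurable_fun setT (fun w => (h w + z%:E)%E).
  by apply: emeasurable_funD => //; exact: measurable_cst.
apply: (le_trans (@le_integral_past _ _ _ _ _ eps_indep eps_id _ _ _ s Phi _ ps mPhi Phi0 mhz _)).
  by move=> w; rewrite /Phi/=; exact: variance_step.
rewrite ge0_integralD//; last first.
- by move=> w _; rewrite lee_fin sqr_ge0.
by rewrite integral_cst// [X in (_ * X)%E]probability_setT mule1 EFinD leeD2r.
Qed.

Hypothesis g_cvg : {ae P, forall w, g n.+1 (th n w) @[n --> \oo] --> l}.

Theorem recursive_lln : {ae P, forall w,
  n%:R^-1 * \sum_(1 <= i < n.+1) k i (th i.-1 w) (eps i w) @[n --> \oo] --> l}.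
Proof.
have /andP[al0 al1] := alpha_01.
have c0 : 0 <= c.
  have := @k_L2 1 (th 0 point) isT (th_ab _ _); rewrite powR1 mulr1 => h.
  rewrite -lee_fin; apply: le_trans h.
  by apply: integral_ge0 => w _; rewrite lee_fin sqr_ge0.
(* At N = (i+1)^p the centred average has second moment at most c N^(alpha - 1) = c (i+1)^(-p (1 -
   alpha)); this p makes it at most c / (i+1)^2. *)
have [p p0 hp] : exists2 p, (0 < p)%N & 2 <= p%:R * (1 - alpha).
  exists (Num.bound (2 / (1 - alpha))).+1 => //.
  rewrite -ler_pdivrMr ?subr_gt0//.
  apply: le_trans (_ : (Num.bound (2 / (1 - alpha)))%:R <= _); last by rewrite ler_nat.
  by rewrite ltW// archi_boundP// divr_ge0// subr_ge0 ltW.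
pose N i := (i.+1 ^ p)%N.
have N0 i : (0 : R) < (N i)%:R by rewrite ltr0n expn_gt0.
have Scvg : {ae P, forall w, ((N i)%:R^-1 * S (N i) w) ^+ 2 @[i --> \oo] --> 0}.
  apply: (@ae_cvg0_of_summable _ _ _ P _ c).
  - by move=> n; apply: measurable_funX; apply: measurable_funM => //; exact: mS.
  - by move=> n w; exact: sqr_ge0.
  move=> n; under eq_integral do rewrite exprMn EFinM.
  rewrite ge0_integralZl//; last 2 first.
  - by apply/measurable_EFinP; apply: measurable_funX; exact: mS.
  - by move=> w _; rewrite lee_fin sqr_ge0.
  apply: (@le_trans _ _ (((N n)%:R^-1 ^+ 2)%:E *
      (c * \sum_(0 <= i < N n) i.+1%:R `^ alpha)%:E)%E).
    by rewrite lee_wpmul2l ?lee_fin ?sqr_ge0//; exact: variance.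
  rewrite -EFinM lee_fin mulrCA ler_wpM2l//.
  apply: (@le_trans _ _ ((N n)%:R^-1 ^+ 2 * ((N n)%:R * (N n)%:R `^ alpha))).
    rewrite ler_wpM2l ?sqr_ge0//.
    apply: (@le_trans _ _ (\sum_(0 <= i < N n) (N n)%:R `^ alpha)).
      rewrite !big_nat; apply: ler_sum => i /andP[_ iN].
      by rewrite ge0_ler_powR ?nnegrE ?(ltW al0)// ler_nat.
    by rewrite sumr_const_nat subn0 mulr_natl.
  have -> : (N n)%:R^-1 ^+ 2 * ((N n)%:R * (N n)%:R `^ alpha) =
      (N n)%:R `^ (alpha - 1) :> R.
    rewrite powRB ?powRr1 ?(ltW (N0 n))//; last by apply/implyP => _; rewrite gt_eqF.
    by field; rewrite gt_eqF.
  have -> : (N n)%:R = n.+1%:R `^ p%:R :> R by rewrite powR_mulrn// natrX.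
  rewrite -powRrM -powR_mulrn// -powRN ler_powR// ?ler1n//.
  by move: hp; rewrite mulrBr mulr1 mulrBr mulr1; lra.
apply: filterS2 Scvg g_cvg => w hS hg.
pose F n := \sum_(0 <= i < n) k i.+1 (th i w) (eps i.+1 w).
suff : n%:R^-1 * F n @[n --> \oo] --> l.
  by apply: cvg_trans; apply: near_eq_cvg; apply: nearW => n; rewrite /F big_add1.
apply: (@cvg_average_powers _ F p l p0).
- by rewrite /F big_geq.
- move=> m n mn; rewrite /F (big_cat_nat (leq0n m) mn)/= lerDl.
  by apply: sumr_ge0 => i _.
have S0 : (N i)%:R^-1 * S (N i) w @[i --> \oo] --> 0.
  apply/norm_cvg0P; have := cvg_comp _ _ hS (@sqrt_continuous R 0).
  by rewrite sqrtr0; apply: cvg_trans; apply: near_eq_cvg; apply: nearW => i /=; rewrite sqrtr_sqr.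
(* The averages of the conditional means inherit their limit, then also along the subsequence
   N_i. *)
have mean := cesaro hg.
have NK : N i @[i --> \oo] --> \oo.
  apply/cvgnyPge => A; exists A => // i /= Ai; apply: (leq_trans Ai).
  by rewrite (leq_trans (leqnSn i))// -{1}(expn1 i.+1) leq_pexp2l.
have meanN : (N i)%:R^-1 * \sum_(0 <= j < N i) g j.+1 (th j w) @[i --> \oo] --> l.
  have h : n%:R^-1 * \sum_(0 <= j < n) g j.+1 (th j w) @[n --> \oo] --> l.
    by rewrite -cvg_shiftS; move: mean; rewrite /arithmetic_mean /series.
  exact: (cvg_comp _ _ NK h).
rewrite -[X in _ --> X]add0r.
suff -> : (fun i => (i.+1 ^ p)%:R^-1 * F (i.+1 ^ p)%N) = (fun i =>
    (N i)%:R^-1 * S (N i) w + (N i)%:R^-1 * \sum_(0 <= j < N i) g j.+1 (th j w)).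
  exact: cvgD S0 meanN.
apply/funext => i; rewrite -mulrDr /S /F -big_split/=; congr (_ * _).
by apply: eq_bigr => j _; rewrite subrK.
Qed.

End recursive_averages.

(** * Derivatives relative to a set *)

Section derivative_within.
Context {R : realType}.
Implicit Types (A : set R) (f : R -> R) (x : R).

Lemma derivable_withinP A f x : derivable_within A f x ->
  forall e, 0 < e -> exists2 r, 0 < r & forall h, h != 0 -> `|h| < r ->
    A (h + x) -> `|h^-1 * (f (h + x) - f x) - derive_within A f x| < e.
Proof.
move=> df e e0; have /cvgrPdist_lt/(_ e e0) := df.
rewrite /within/= => /nbhs_ballP[r/= r0 hr]; exists r => // h h0 hr' Ah.
rewrite distrC; apply: hr => //.
by rewrite /ball/= sub0r normrN.
Qed.

Lemma derivable_within_bound A f x : A x -> derivable_within A f x ->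
  exists C r, [/\ 0 < C, 0 < r & forall y, `|y - x| < r -> A y ->
    `|f y - f x| <= C * `|y - x|].
Proof.
move=> Ax df; have [r r0 hr] := derivable_withinP df ltr01.
exists (`|derive_within A f x| + 1), r; split; [by rewrite ltr_wpDl| by []|].
move=> y yr Ay; have [->|yx] := eqVneq y x; first by rewrite !subrr normr0 mulr0.
have yx0 : y - x != 0 by rewrite subr_eq0.
have := hr _ yx0 yr; rewrite subrK => /(_ Ay) => h.
rewrite -ler_pdivrMr ?normr_gt0// -normf_div mulrC.
rewrite -lerBlDl; apply: le_trans (ltW h).
by rewrite (le_trans _ (lerB_dist _ _)).
Qed.

Lemma derivable_within_cvg A f x : A x -> derivable_within A f x ->
  f y @[y --> within A (nbhs x)] --> f x.
Proof.
move=> Ax df; have [C [r [C0 r0 h]]] := derivable_within_bound Ax df.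
apply/cvgrPdist_lt => e e0; rewrite near_withinE.
near=> y => Ay; rewrite distrC.
apply: le_lt_trans (h y _ Ay) _.
  by rewrite distrC; near: y; exact: nbhsx_ballx.
rewrite -ltr_pdivlMl// distrC; near: y; apply: nbhsx_ballx.
by rewrite mulr_gt0// invr_gt0.
Unshelve. all: by end_near. Qed.

Lemma derivable_within_continuous A f : (forall x, A x -> derivable_within A f x) ->
  {within A, continuous f}.
Proof.
by move=> df; apply/subspace_continuousP => x Ax; apply: derivable_within_cvg => //; exact: df.
Qed.

Lemma within_cvg_seq A f x : A x -> f y @[y --> within A (nbhs x)] --> f x ->
  forall u : nat -> R, (forall n, A (u n)) -> u n @[n --> \oo] --> x ->
    f (u n) @[n --> \oo] --> f x.
Proof.
move=> Ax fx u uA ux; apply/cvgrPdist_lt => e e0.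
have /cvgrPdist_lt/(_ e e0) := fx; rewrite near_withinE => hx.
have : \forall n \near \oo, A (u n) -> `|f x - f (u n)| < e := ux _ hx.
by apply: filterS => n; exact.
Qed.

(** By contradiction, choosing for each n a bad point within 1/(n+1) of x. Dominated convergence
    delivers limits along sequences; this turns them into limits within [A]. *)
Lemma seq_within_cvg A f x (l : R) :
  (forall u : nat -> R, (forall n, A (u n)) -> u n @[n --> \oo] --> x ->
    f (u n) @[n --> \oo] --> l) ->
  f y @[y --> within A (nbhs x)] --> l.
Proof.
move=> h; apply/cvgrPdist_lt => e e0; apply: contrapT => hn.
have /choice[u hu] : forall n : nat, exists y,
    [/\ `|x - y| < n.+1%:R^-1, A y & e <= `|l - f y|].
  move=> n; apply: contrapT => hy; apply: hn; rewrite near_withinE.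
  have n0 : (0 : R) < n.+1%:R^-1 by rewrite invr_gt0.
  have := @nbhsx_ballx _ _ x _ n0; apply: filterS => y; rewrite /ball/= => xy Ay.
  by rewrite ltNge; apply/negP => le; apply: hy; exists y.
have ux : u n @[n --> \oo] --> x.
  apply/cvgrPdist_lt => r r0; have [k hk] := ltr_add_invr r0.
  exists k => // n /= kn; have [xu _ _] := hu n; apply: lt_trans xu _.
  apply: le_lt_trans hk; rewrite add0r lef_pV2 ?posrE// ler_nat//.
have /cvgrPdist_lt/(_ e e0)[N _ hN] := h u (fun n => let: And3 _ a _ := hu n in a) ux.
by have [_ _] := hu N; rewrite leNgt hN//=.
Qed.

(* [x] must be a limit point of [A]: otherwise [derive_within] is a junk value. *)
Lemma seq_derive_within A f x (l : R) :
  (forall r, 0 < r -> exists h, [/\ h != 0, `|h| < r & A (h + x)]) ->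
  (forall h : nat -> R, (forall n, h n != 0 /\ A (h n + x)) -> h n @[n --> \oo] --> 0 ->
    (h n)^-1 * (f (h n + x) - f x) @[n --> \oo] --> l) ->
  derive_within A f x = l.
Proof.
move=> hx hl.
have PF : ProperFilter (within [set h | A (h + x)] 0^').
  apply: Build_ProperFilter_ex => B /nbhs_ballP[r/= r0 hB].
  have [h [h0 hr Ah]] := hx r r0; exists h; apply: hB => //.
  by rewrite /ball/= sub0r normrN.
apply: cvg_lim => //.
have := @seq_within_cvg [set h | h != 0 /\ A (h + x)]
  (fun h => h^-1 *: (f (h + x) - f x)) 0 l hl.
apply: cvg_trans => B; rewrite /nbhs/= /within/= => hB.
by apply: filterS hB => h hh h0 Ah; exact: hh.
Qed.

Lemma derive_within_seq A f x : derivable_within A f x ->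
  forall h : nat -> R, (forall n, h n != 0 /\ A (h n + x)) -> h n @[n --> \oo] --> 0 ->
    (h n)^-1 * (f (h n + x) - f x) @[n --> \oo] --> derive_within A f x.
Proof.
move=> df h hA h0; apply/cvgrPdist_lt => e e0.
have [r r0 hr] := derivable_withinP df e0.
have /cvgrPdist_lt/(_ r r0) := h0; apply: filterS => n /=.
by rewrite sub0r normrN distrC => hnr; have [? ?] := hA n; apply: hr.
Qed.

Lemma is_interval_interior A x y z : is_interval A -> A x -> A y ->
  x < z < y -> A° z.
Proof.
move=> Ai Ax Ay /andP[xz zy]; rewrite /interior.
have : \forall u \near z, u \in `]x, y[ by apply: near_in_itvoo; rewrite in_itv/= xz.
apply: filterS => u; rewrite in_itv/= => /andP[/ltW xu /ltW uy].
by apply: (Ai x y) => //; rewrite xu.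
Qed.

(** Mean value theorem on [x, y], whose open part is interior to [A], so that the relative
    derivative is the usual one there. Asking for the bound strictly between x and y only allows a
    constant valid on a part of [A]. *)
Lemma derive_within_lipschitz_sub A f C x y : is_interval A ->
  (forall z, A z -> derivable_within A f z) -> A x -> A y -> x < y ->
  (forall z, x < z < y -> `|derive_within A f z| <= C) ->
  `|f x - f y| <= C * `|x - y|.
Proof.
move=> Ai df Ax Ay xy dfC; have fc := derivable_within_continuous df.
have AI z : z \in `]x, y[ -> A° z.
  by rewrite in_itv/= => h; apply: is_interval_interior Ai Ax Ay h.
have dfz z : z \in `]x, y[ -> is_derive z 1 f (derive_within A f z).
  move=> zxy; have Az := AI z zxy; apply: DeriveDef.
    by rewrite -(derivable_within_interior f Az); apply: df; exact: interior_subset.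
  by rewrite (derive_within_interior f Az) derive1E.
have fcxy : {within `[x, y], continuous f}.
  apply: continuous_subspaceW fc => u /=; rewrite in_itv/= => xuy.
  by apply: (Ai x y).
have [c cxy fE] := MVT xy dfz fcxy.
by rewrite distrC fE normrM [`|x - y|]distrC ler_wpM2r// dfC.
Qed.

Lemma derive_within_lipschitz A f C : is_interval A ->
  (forall x, A x -> derivable_within A f x) ->
  (forall x, A x -> `|derive_within A f x| <= C) ->
  forall x y, A x -> A y -> `|f x - f y| <= C * `|x - y|.
Proof.
move=> Ai df dfC x y Ax Ay.
have dfC' u v : A u -> A v -> forall z, u < z < v -> `|derive_within A f z| <= C.
  move=> Au Av z /andP[uz zv]; apply: dfC.
  by apply: (Ai u v) => //; rewrite !ltW.
case: (ltgtP x y) => [xy|yx|->].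
- exact: (derive_within_lipschitz_sub Ai df Ax Ay xy (dfC' _ _ Ax Ay)).
- rewrite distrC [`|x - y|]distrC.
  exact: (derive_within_lipschitz_sub Ai df Ay Ax yx (dfC' _ _ Ay Ax)).
- by rewrite !subrr normr0 mulr0.
Qed.

End derivative_within.

(** * Transport of densities *)

Section measure_with_density.
Context d (T : measurableType d) (R : realType).
Variables (mu : {measure set T -> \bar R}) (p : T -> R).
Hypothesis mp : measurable_fun setT p.
Hypothesis p_ge0 : forall u, 0 <= p u.
Local Open Scope ereal_scope.

Definition density_measure of measurable_fun setT p & (forall u, (0 <= p u)%R) :=
  fun A : set T => \int[mu]_(u in A) (p u)%:E.

Local Notation dm := (density_measure mp p_ge0).

Let dm0 : dm set0 = 0. Proof. exact: integral_set0. Qed.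

Let dm_ge0 A : 0 <= dm A.
Proof. by apply: integral_ge0 => u _; rewrite lee_fin. Qed.

Let dm_additive : semi_sigma_additive dm.
Proof.
move=> F mF tF mUF; rewrite /density_measure ge0_integral_bigcup//=; last 2 first.
- by apply/measurable_EFinP; exact: measurable_funTS.
- by move=> u _; rewrite lee_fin.
by apply: is_cvg_ereal_nneg_natsum_cond => n _ _; apply: integral_ge0 => u _; rewrite lee_fin.
Qed.

HB.instance Definition _ := isMeasure.Build _ _ _ dm dm0 dm_ge0 dm_additive.

Definition density_measure_pack : {measure set T -> \bar R} := dm.

End measure_with_density.

Section density_integral.
Context {R : realType}.
Local Notation mu := (@lebesgue_measure R).
Local Open Scope ereal_scope.

(* [lebesgue_measure] lives on [measurableTypeR R], whose measurable sets are
   those of [R] under another display, hence the detour through [V']. *)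
Lemma integral_density d (T : measurableType d) (P : probability T R)
    (V : T -> R) (p k : R -> R) (C : R) :
  measurable_fun setT V -> measurable_fun setT p ->
  (forall A, measurable A -> P (V @^-1` A) = \int[mu]_(u in A) (p u)%:E) ->
  measurable_fun setT k -> (forall u, (`|k u| <= C)%R) ->
  \int[P]_w (k (V w))%:E = \int[mu]_u (k u * p u)%:E.
Proof.
move=> mV mp Vp mk kC.
pose V0 : T -> measurableTypeR R := V.
have mV' : measurable_fun setT V0 by exact: mV.
pose V' : {mfun T >-> measurableTypeR R} := mfun_Sub (mem_set mV').
have mkE : @measurable_fun _ _ (measurableTypeR R) (\bar R) setT (EFin \o k).
  exact/measurable_EFinP.
have mpE : @measurable_fun _ _ (measurableTypeR R) (\bar R) setT (EFin \o p).
  exact/measurable_EFinP.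
have ki : (distribution P V').-integrable setT (EFin \o k).
  exact: (@bounded_integrable _ _ _ (distribution P V') _ C).
have kVi : P.-integrable setT ((EFin \o k) \o V').
  apply: (@bounded_integrable _ _ _ P (k \o V) C).
    exact: measurableT_comp.
  by move=> w; exact: kC.
rewrite -(integral_distribution mkE kVi).
(* Domination yields a Radon-Nikodym derivative of the law of [V]; having the same integrals as [p]
   over measurable sets, it equals [p] almost everywhere. *)
have dom : distribution P V' `<< mu.
  apply/null_content_dominatesP => A mA A0; rewrite /distribution /pushforward Vp//.
  by apply: null_set_integral => //; exact: measurable_funTS.
rewrite -(Radon_Nikodym_change_of_variables dom measurableT ki).
apply: ae_eq_integral => //.
- by apply: emeasurable_funM => //; exact: (measurable_int mu (Radon_Nikodym_integrable dom)).
- by apply/measurable_EFinP; exact: measurable_funM.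
- rewrite [X in ae_eq _ _ _ X](_ : _ = fun u => (EFin \o k) u * (EFin \o p) u)//.
  apply: ae_eqe_mul2l; apply: integral_ae_eq => //.
    exact: Radon_Nikodym_integrable.
  by move=> A _ mA; rewrite -Radon_Nikodym_integral//; exact: Vp.
Qed.

End density_integral.

(** The endpoints are running minima and maxima over an enumeration of the rationals of [W], so they
    stay in [W], bounded or not; openness puts rationals of [W] on both sides of any u in [W]. *)
Lemma open_interval_exhaustion (R : realType) (W : set R) (w0 : R) : open W -> W w0 ->
  exists l r : nat -> R, [/\ forall n, W (l n) /\ W (r n),
    forall n, l n.+1 <= l n, forall n, r n <= r n.+1 &
    forall u, W u -> exists n, l n < u <= r n].
Proof.
move=> oW Ww0.
pose q n : R := if unpickle n is Some s then
  (if pselect (W (ratr s)) then ratr s else w0) else w0.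
have Wq n : W (q n).
  by rewrite /q; case: unpickle => // s; case: pselect.
pose l n := iteri n (fun i x => Num.min x (q i)) w0.
pose r n := iteri n (fun i x => Num.max x (q i)) w0.
have lS n : l n.+1 = Num.min (l n) (q n) by [].
have rS n : r n.+1 = Num.max (r n) (q n) by [].
have ldec n : l n.+1 <= l n by rewrite lS ge_min lexx.
have rinc n : r n <= r n.+1 by rewrite rS le_max lexx.
exists l, r; split => //.
  move=> n; elim: n => [//|n [IHl IHr]]; rewrite lS rS.
  by split; rewrite /Num.min /Num.max; case: ifP.
move=> u Wu; have /nbhs_ballP[e/= e0 hW] : nbhs u W by exact: open_nbhs_nbhs.
have qE (s : rat) : `|u - ratr s| < e -> q (pickle s) = ratr s.
  move=> us; rewrite /q pickleK; case: pselect => // h; exfalso; apply: h.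
  exact: hW.
have [|s1] := @rat_in_itvoo R (u - e) u; first by lra.
rewrite in_itv/= => /andP[s1l s1u].
have [|s2] := @rat_in_itvoo R u (u + e); first by lra.
rewrite in_itv/= => /andP[s2l s2u].
have q1 : q (pickle s1) = ratr s1 by apply: qE; rewrite ltr_norml; lra.
have q2 : q (pickle s2) = ratr s2 by apply: qE; rewrite ltr_norml; lra.
have /nonincreasing_seqP lni := ldec.
have /nondecreasing_seqP rnd := rinc.
exists (maxn (pickle s1) (pickle s2)).+1; apply/andP; split.
  apply: le_lt_trans s1u; rewrite -q1.
  apply: (@le_trans _ _ (l (pickle s1).+1)).
    by apply: lni; rewrite ltnS leq_maxl.
  by rewrite lS ge_min lexx orbT.
apply: le_trans (ltW s2l) _; rewrite -q2.
apply: (@le_trans _ _ (r (pickle s2).+1)).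
  by rewrite rS le_max lexx orbT.
by apply: rnd; rewrite ltnS leq_maxr.
Qed.

(** Substitution yields equality only on intervals with both endpoints in [W]. Any half-open
    interval is therefore cut by the exhausting ones, and nothing is lost in the limit since both
    measures vanish off [W]. *)
Lemma measure_unique_open_interval (R : realType)
    (m1 m2 : {measure set (measurableTypeR R) -> \bar R}) (W : set R) (w0 : R) :
  open W -> is_interval W -> W w0 -> (m1 setT < +oo)%E ->
  m1 (~` W) = 0%E -> m2 (~` W) = 0%E ->
  (forall c d, W c -> W d -> c < d -> m1 `]c, d]%classic = m2 `]c, d]%classic) ->
  forall A, measurable A -> m1 A = m2 A.
Proof.
move=> oW iW Ww0 m1fin m1W m2W m12.
have mW : @measurable _ (measurableTypeR R) W by exact: open_measurable.
have [l [r [lrW ldec rinc lrcov]]] := open_interval_exhaustion oW Ww0.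
pose E n := `]l n, r n]%classic : set R.
have mE n : @measurable _ (measurableTypeR R) (E n) by exact: measurable_itv.
have ndE : nondecreasing_seq E.
  apply/nondecreasing_seqP => n; apply/subsetPset => u; rewrite /E/= !in_itv/=.
  move=> /andP[lu ur]; rewrite (le_lt_trans _ lu)//=; exact: le_trans ur _.
have conv (m : {measure set (measurableTypeR R) -> \bar R}) A :
    m (~` W) = 0%E -> measurable A ->
    m (A `&` E n) @[n --> \oo] --> m A.
  move=> mW0 mA.
  have mAE n : @measurable _ (measurableTypeR R) (A `&` E n) by exact: measurableI.
  have mU : @measurable _ (measurableTypeR R) (\bigcup_n (A `&` E n)).
    exact: bigcupT_measurable.
  have -> : m A = m (\bigcup_n (A `&` E n)).
    apply/eqP; rewrite eq_le; apply/andP; split; last first.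
      by apply: le_measure; rewrite ?inE// => x [n _ []].
    apply: (@le_trans _ _ (m ((\bigcup_n (A `&` E n)) `|` ~` W))).
      apply: le_measure; rewrite ?inE//.
        by apply: measurableU => //; exact: measurableC.
      move=> x Ax; have [Wx|] := pselect (W x); last by right.
      by left; have [n xn] := lrcov x Wx; exists n => //; split; rewrite //= /E/= in_itv.
    apply: le_trans (measureU2 _ _ _) _ => //; first exact: measurableC.
    rewrite -[leRHS]adde0; apply: leeD2l; rewrite le_eqVlt; apply/orP; left.
    by apply/eqP; exact: mW0.
  apply: nondecreasing_cvg_mu => //.
  by move=> i j ij; apply/subsetPset; apply: setIS; apply/subsetPset; exact: ndE.
have m12oc c d n : m1 (`]c, d]%classic `&` E n) = m2 (`]c, d]%classic `&` E n).
  have -> : `]c, d]%classic `&` E n = `]Num.max c (l n), Num.min d (r n)]%classic.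
    rewrite /E; apply/seteqP; split => u /=; rewrite !in_itv/= gt_max le_min.
      by move=> [/andP[-> ->] /andP[-> ->]].
    by move=> /andP[/andP[-> ->] /andP[-> ->]].
  have [cd|dc] := ltP (Num.max c (l n)) (Num.min d (r n)); last first.
    by rewrite set_itv_ge ?measure0// bnd_simp -leNgt.
  have [Wl Wr] := lrW n.
  have lc : l n <= Num.max c (l n) by rewrite le_max lexx orbT.
  have dr : Num.min d (r n) <= r n by rewrite ge_min lexx orbT.
  apply: m12 => //.
    by apply: (iW _ _ Wl Wr); rewrite lc (le_trans (ltW cd)).
  by apply: (iW _ _ Wl Wr); rewrite dr andbT (le_trans lc)// ltW.
move=> A mA.
apply: (@measure_unique _ _ (measurableTypeR R) (@ocitv R)
  (fun n => `](- n%:R)%R, n%:R]%classic)) => //.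
- exact: ocitvI.
- by move=> n; exact: is_ocitv.
- apply/seteqP; split => // u _; exists (Num.bound `|u : R|) => //=.
  rewrite in_itv/=; have := archi_boundP (normr_ge0 (u : R)).
  by rewrite ltr_norml => /andP[-> /ltW ->].
- move=> _ [[c d] _ <-] /=.
  have mcd : measurable (`]c, d]%classic : set R) by exact: measurable_itv.
  have h1 := conv m1 _ m1W mcd; have h2 := conv m2 _ m2W mcd.
  apply: cvg_unique h1 _ => //.
  by rewrite (_ : (fun n => m1 _) = (fun n => m2 (`]c, d]%classic `&` E n)))//; apply/funext => n.
- move=> n; apply: le_lt_trans m1fin; apply: le_measure; rewrite ?inE//.
Qed.

Section transport_of_density.
Context d (T : measurableType d) (R : realType) (P : probability T R).
Variables (X V : T -> R) (f rho : R -> R) (U W : set R) (w0 : R).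
Local Notation mu := (@lebesgue_measure R).
Hypothesis mV : measurable_fun setT V.
Hypothesis mf : measurable_fun setT f.
Hypothesis f_ge0 : forall u, 0 <= f u.
Hypothesis Xf : forall A, measurable A ->
  P (X @^-1` A) = (\int[mu]_(u in A) (f u)%:E)%E.
Hypothesis U_itv : is_interval U.
Hypothesis f_cont : forall u, U u -> {for u, continuous f}.
Hypothesis W_open : open W.
Hypothesis W_itv : is_interval W.
Hypothesis W_w0 : W w0.
Hypothesis rhoU : forall u, W u -> U (rho u).
Hypothesis rho_incr : forall u v, W u -> W v -> u < v -> rho u < rho v.
Hypothesis rho_der : forall u, W u -> derivable rho u 1.
Hypothesis rho_der_cont : forall u, W u -> {for u, continuous (derive1 rho)}.
Hypothesis V_rho : forall w c d, W c -> W d ->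
  (c < V w <= d) = (rho c < X w <= rho d).
Hypothesis PVW : P (~` (V @^-1` W)) = 0%E.

(** The density of rho^-1(X), set to 0 off [W]. That rho(V) is X is recorded by [V_rho] through the
    events c < V <= d. *)
Definition transported_density : R -> R := (fun u => f (rho u) * derive1 rho u) \_ W.

Let mW : measurable W. Proof. exact: is_interval_measurable. Qed.

Lemma measurable_transported_density : measurable_fun setT transported_density.
Proof.
apply/(measurable_restrictT _ mW); apply: measurable_funM.
  apply: measurableT_comp => //; apply: open_continuous_measurable_fun => // u.
  by rewrite inE => Wu; apply: differentiable_continuous; exact/derivable1_diffP/rho_der.
by apply: open_continuous_measurable_fun => // u; rewrite inE; exact: rho_der_cont.
Qed.

Lemma transported_density_ge0 u : 0 <= transported_density u.
Proof.
rewrite /transported_density patchE; case: ifPn => // /set_mem Wu.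
have WE : W° = W by apply/interior_id.
rewrite mulr_ge0//; apply: (@incr_derive1_ge0 _ _ W).
- by move=> x; rewrite inE WE; exact: rho_der.
- by move=> x y; rewrite !inE; exact: rho_incr.
- by rewrite WE.
Qed.

(** For endpoints in [W], the event c < V <= e is rho c < X <= rho e, and substitution turns the
    integral of f into that of f(rho) rho'. Uniqueness extends this to all measurable sets. *)
Lemma density_transport A : measurable A ->
  P (V @^-1` A) = (\int[mu]_(u in A) (transported_density u)%:E)%E.
Proof.
move=> mA.
pose V0 : T -> measurableTypeR R := V.
have mV0 : measurable_fun setT V0 by exact: mV.
pose V' : {mfun T >-> measurableTypeR R} := mfun_Sub (mem_set mV0).
have mtd : @measurable_fun _ _ (measurableTypeR R) R setT transported_density.
  exact: measurable_transported_density.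
pose m2 := @density_measure_pack _ (measurableTypeR R) R mu transported_density
  mtd transported_density_ge0.
apply: (@measure_unique_open_interval R (distribution P V') m2 W w0) => //.
- by rewrite [X in (X < _)%E](@probability_setT _ _ R (distribution P V')) ltry.
- rewrite /m2 /density_measure_pack/= /density_measure.
  apply: integral0_eq => u Wu.
  by rewrite /transported_density patchE; case: ifPn => // /set_mem.
move=> c e Wc We ce.
have sub_ce u : c <= u <= e -> W u by move=> /(W_itv Wc We).
have der_ce u : c <= u <= e -> derivable rho u 1 by move=> /sub_ce /rho_der.
have cont_rho u : W u -> {for u, continuous rho}.
  by move=> Wu; apply: differentiable_continuous; exact/derivable1_diffP/rho_der.
transitivity (P (X @^-1` `]rho c, rho e]%classic)).
  rewrite /distribution /pushforward; congr (P _).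
  by apply/seteqP; split => w /=; rewrite !in_itv/= V_rho.
rewrite Xf//.
rewrite integral_itv_obnd_cbnd; last by apply: measurable_funTS; exact/measurable_EFinP.
rewrite (@integration_by_substitution_increasing R rho f c e (ltW ce)); last first.
- apply: continuous_in_subspaceT => u; rewrite inE/= in_itv/= => /andP[cu ue].
  by apply: f_cont; apply: (U_itv (rhoU Wc) (rhoU We)); rewrite cu.
- split.
  + by move=> u; rewrite in_itv/= => /andP[/ltW cu /ltW ue]; apply: der_ce; rewrite cu.
  + by apply: cvg_at_right_filter; exact: cont_rho.
  + by apply: cvg_at_left_filter; exact: cont_rho.
- by apply/cvg_ex; eexists; apply: cvg_at_left_filter; exact: rho_der_cont.
- by apply/cvg_ex; eexists; apply: cvg_at_right_filter; exact: rho_der_cont.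
- move=> u; rewrite in_itv/= => /andP[/ltW cu /ltW ue].
  by apply: rho_der_cont; apply: sub_ce; rewrite cu.
- move=> x y; rewrite !in_itv/= => xce yce; apply: rho_incr; exact: sub_ce.
rewrite /m2 /density_measure_pack/= /density_measure.
rewrite [RHS]integral_itv_obnd_cbnd; last first.
  by apply: measurable_funTS; apply/measurable_EFinP; exact: measurable_transported_density.
apply: eq_integral => u; rewrite inE/= in_itv/= => uce.
by rewrite /transported_density patchE mem_set//; exact: sub_ce.
Qed.

End transport_of_density.

(** * The maps phi_theta^-1 o phi_t *)

Section reparametrization.
Context {R : realType}.
Variables (Theta I1 I2 : set R) (theta : R) (phi : R -> R -> R).
Hypothesis I1_itv : is_interval I1.
Hypothesis Theta_theta : Theta theta.
Hypothesis phi_bij : forall t, Theta t -> set_bij I1 I2 (phi t).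
Hypothesis phi_incr : forall t, Theta t ->
  forall u v, I1 u -> I1 v -> u < v -> phi t u < phi t v.

Local Notation inv := (inv_phi I1 phi).

Lemma phi_in t y : Theta t -> I1 y -> I2 (phi t y).
Proof. by move=> /phi_bij [+ _ _] => h /h. Qed.

Lemma inv_phiK t y : Theta t -> I1 y -> inv t (phi t y) = y.
Proof.
move=> /phi_bij [_ inj _] I1y; apply: (pinvKV (fun=> 0) inj).
exact: mem_set.
Qed.

Lemma inv_phi_in t z : Theta t -> I2 z -> I1 (inv t z).
Proof.
by move=> Tt; have [_ _ surj] := phi_bij Tt; move=> /surj [y I1y <-]; rewrite inv_phiK.
Qed.

Lemma phiK t z : Theta t -> I2 z -> phi t (inv t z) = z.
Proof.
by move=> Tt; have [_ _ surj] := phi_bij Tt; move=> /surj [y I1y <-]; rewrite inv_phiK.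
Qed.

Lemma phi_lt t u v : Theta t -> I1 u -> I1 v -> (phi t u < phi t v) = (u < v).
Proof.
move=> Tt Iu Iv; apply/idP/idP; last exact: phi_incr.
case: (ltgtP u v) => // [vu|->]; last by rewrite ltxx.
by rewrite ltNge ltW// phi_incr.
Qed.

Lemma phi_le t u v : Theta t -> I1 u -> I1 v -> (phi t u <= phi t v) = (u <= v).
Proof. by move=> Tt Iu Iv; rewrite !leNgt phi_lt. Qed.

Lemma inv_phi_lt t z z' : Theta t -> I2 z -> I2 z' -> (inv t z < inv t z') = (z < z').
Proof.
move=> Tt Iz Iz'; rewrite -(phi_lt Tt) ?phiK//; exact: inv_phi_in.
Qed.

(** A composition of increasing maps: the preimage of a half-line is an interval. *)
Lemma measurable_inv_phi t : Theta t ->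
  measurable_fun I1 (fun u => inv t (phi theta u)).
Proof.
move=> Tt; apply: (measurability (@RGenCInfty.G R)) => [|/= _ [_] [r] -> <-].
  exact: RGenCInfty.measurableE.
apply: is_interval_measurable => u v /= [Iu] + [Iv _] z /andP[uz zv].
have Iz : I1 z by apply: (I1_itv Iu Iv); rewrite uz.
rewrite !in_itv/= !andbT => ru; split => //; apply: (le_trans ru).
by rewrite leNgt inv_phi_lt ?phi_lt -?leNgt//; exact: phi_in.
Qed.

(** This is psi_t. It recovers the noise from Z(t): psi_t(phi_t^-1(phi_theta(eps))) = eps, by
    [reparam_inv]. *)
Definition reparam t y := inv theta (phi t y).

Lemma reparam_in t y : Theta t -> I1 y -> I1 (reparam t y).
Proof. by move=> Tt Iy; apply: inv_phi_in => //; exact: phi_in. Qed.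

Lemma reparam_lt t u v : Theta t -> I1 u -> I1 v ->
  (reparam t u < reparam t v) = (u < v).
Proof. by move=> Tt Iu Iv; rewrite inv_phi_lt ?phi_lt//; exact: phi_in. Qed.

Lemma reparam_inv t y : Theta t -> I1 y -> reparam t (inv t (phi theta y)) = y.
Proof. by move=> Tt Iy; rewrite /reparam phiK ?inv_phiK//; exact: phi_in. Qed.

Hypothesis phi_C3 : forall t, Theta t -> Ck_on I1 3 (phi t).
Hypothesis inv_phi_C3 : Ck_on I2 3 (inv theta).

Let dphi t := derive_within I1 (phi t).
Let dinv := derive_within I2 (inv theta).

Let phi_der t y : Theta t -> I1 y -> derivable_within I1 (phi t) y.
Proof. by move=> /phi_C3 [+ _] => /(_ 0%N isT); exact. Qed.

Let dphi_der t y : Theta t -> I1 y -> derivable_within I1 (dphi t) y.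
Proof. by move=> /phi_C3 [+ _] => /(_ 1%N isT); exact. Qed.

Let inv_der z : I2 z -> derivable_within I2 (inv theta) z.
Proof. by case: inv_phi_C3 => + _ => /(_ 0%N isT); exact. Qed.

Let dinv_der z : I2 z -> derivable_within I2 dinv z.
Proof. by case: inv_phi_C3 => + _ => /(_ 1%N isT); exact. Qed.

(** Intermediate value theorem for [phi theta], continuous on [I1] and onto [I2]. *)
Lemma I2_itv : is_interval I2.
Proof.
move=> z z' Iz Iz' u /andP[zu uz'].
have [_ _ surj] := phi_bij Theta_theta.
have [y Iy yz] := surj _ Iz; have [y' Iy' yz'] := surj _ Iz'.
have yy' : y <= y'.
  by rewrite -(phi_le Theta_theta Iy Iy') yz yz' (le_trans zu).
have sub : `[y, y'] `<=` I1.
  by move=> v /=; rewrite in_itv/= => /(I1_itv Iy Iy').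
have cphi : {within `[y, y'], continuous (phi theta)}.
  apply: (continuous_subspaceW sub); apply: derivable_within_continuous => v.
  exact: phi_der.
have [|c cyy' <-] := IVT yy' cphi (v := u).
  by rewrite yz yz' min_l ?max_r ?zu ?uz'// (le_trans zu).
by apply: phi_in => //; apply: sub.
Qed.

Lemma phi_interior t y : Theta t -> I1° y -> I2° (phi t y).
Proof.
move=> Tt /[dup] Iy' /interior_subset Iy.
have /nbhs_ballP[e/= e0 he] := Iy'.
have e2 : 0 < e / 2 by rewrite divr_gt0.
have Im : I1 (y - e / 2) by apply: he; rewrite /ball/= opprB addrC subrK gtr0_norm//; lra.
have Ip : I1 (y + e / 2) by apply: he; rewrite /ball/= opprD addNKr normrN gtr0_norm//; lra.
apply: (is_interval_interior I2_itv (phi_in Tt Im) (phi_in Tt Ip)).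
by rewrite !phi_lt//; apply/andP; split; lra.
Qed.

Lemma inv_phi_interior t z : Theta t -> I2° z -> I1° (inv t z).
Proof.
move=> Tt /[dup] Iz' /interior_subset Iz.
have /nbhs_ballP[e/= e0 he] := Iz'.
have e2 : 0 < e / 2 by rewrite divr_gt0.
have Im : I2 (z - e / 2) by apply: he; rewrite /ball/= opprB addrC subrK gtr0_norm//; lra.
have Ip : I2 (z + e / 2) by apply: he; rewrite /ball/= opprD addNKr normrN gtr0_norm//; lra.
apply: (is_interval_interior I1_itv (inv_phi_in Tt Im) (inv_phi_in Tt Ip)).
by rewrite !inv_phi_lt//; apply/andP; split; lra.
Qed.

Lemma reparam_interior t y : Theta t -> I1° y -> I1° (reparam t y).
Proof. by move=> Tt Iy; apply: inv_phi_interior => //; exact: phi_interior. Qed.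

(** The chain rule derivative of psi_t, kept as a product of relative derivatives: its size and
    Lipschitz constant are read off the bounds on the first two derivatives of the factors. *)
Definition dreparam t y := dinv (phi t y) * dphi t y.

Lemma is_derive_reparam t y : Theta t -> I1° y ->
  is_derive y 1 (reparam t) (dreparam t y).
Proof.
move=> Tt Iy; have Iz := phi_interior Tt Iy.
have d1 : is_derive y 1 (phi t) (dphi t y).
  apply: DeriveDef.
    rewrite -(derivable_within_interior (phi t) Iy); apply: phi_der => //.
    exact: interior_subset.
  by rewrite /dphi (derive_within_interior (phi t) Iy) derive1E.
have d2 : is_derive (phi t y) 1 (inv theta) (dinv (phi t y)).
  apply: DeriveDef.
    rewrite -(derivable_within_interior (inv theta) Iz); apply: inv_der => //.
    exact: interior_subset.
  by rewrite /dinv (derive_within_interior (inv theta) Iz) derive1E.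
exact: is_derive1_comp.
Qed.

Hypothesis dinv_phi_bounded : forall k, (1 <= k <= 3)%N ->
  bounded_on I2 (deriven_within I2 k (inv theta)).
Hypothesis dphi_bounded : forall k, (1 <= k <= 3)%N ->
  exists C, forall t u, Theta t -> I1 u -> `|deriven_within I1 k (phi t) u| <= C.

Lemma dreparam_bounds : exists L, [/\ 0 < L,
  forall t y, Theta t -> I1 y -> `|dreparam t y| <= L,
  forall t y y', Theta t -> I1 y -> I1 y' ->
    `|dreparam t y - dreparam t y'| <= L * `|y - y'| &
  forall t y y', Theta t -> I1 y -> I1 y' ->
    `|reparam t y - reparam t y'| <= L * `|y - y'|].
Proof.
have [C1 hC1] := dphi_bounded (isT : (1 <= 1 <= 3)%N).
have [C2 hC2] := dphi_bounded (isT : (1 <= 2 <= 3)%N).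
have [D1 hD1] := dinv_phi_bounded (isT : (1 <= 1 <= 3)%N).
have [D2 hD2] := dinv_phi_bounded (isT : (1 <= 2 <= 3)%N).
pose c1 := `|C1|; pose c2 := `|C2|; pose d1 := `|D1|; pose d2 := `|D2|.
have hc1 t y : Theta t -> I1 y -> `|dphi t y| <= c1.
  by move=> Tt Iy; apply: le_trans (hC1 t y Tt Iy) (ler_norm _).
have hc2 t y : Theta t -> I1 y -> `|derive_within I1 (dphi t) y| <= c2.
  by move=> Tt Iy; apply: le_trans (hC2 t y Tt Iy) (ler_norm _).
have hd1 z : I2 z -> `|dinv z| <= d1.
  by move=> Iz; apply: le_trans (hD1 z Iz) (ler_norm _).
have hd2 z : I2 z -> `|derive_within I2 dinv z| <= d2.
  by move=> Iz; apply: le_trans (hD2 z Iz) (ler_norm _).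
have lphi t y y' : Theta t -> I1 y -> I1 y' -> `|phi t y - phi t y'| <= c1 * `|y - y'|.
  move=> Tt; apply: derive_within_lipschitz => // u Iu; [exact: phi_der|exact: hc1].
have ldphi t y y' : Theta t -> I1 y -> I1 y' -> `|dphi t y - dphi t y'| <= c2 * `|y - y'|.
  move=> Tt; apply: derive_within_lipschitz => // u Iu; [exact: dphi_der|exact: hc2].
have linv z z' : I2 z -> I2 z' -> `|inv theta z - inv theta z'| <= d1 * `|z - z'|.
  by apply: derive_within_lipschitz => //; exact: I2_itv.
have ldinv z z' : I2 z -> I2 z' -> `|dinv z - dinv z'| <= d2 * `|z - z'|.
  by apply: derive_within_lipschitz => //; exact: I2_itv.
have [c1p c2p d1p d2p] : [/\ 0 <= c1, 0 <= c2, 0 <= d1 & 0 <= d2].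
  by split; exact: normr_ge0.
(* d1 c1 bounds psi_t' and is a Lipschitz constant of psi_t; d2 c1^2 + d1 c2 is one for psi_t', by
   the product rule; the 1 makes L positive. None of these depends on t. *)
exists (d1 * c1 + (d2 * c1 * c1 + d1 * c2) + 1).
have p1 : 0 <= d1 * c1 by rewrite mulr_ge0.
have p2 : 0 <= d2 * c1 * c1 by rewrite !mulr_ge0.
have p3 : 0 <= d1 * c2 by rewrite mulr_ge0.
split.
- by lra.
- move=> t y Tt Iy; rewrite /dreparam normrM; apply: (@le_trans _ _ (d1 * c1)); last lra.
  by apply: ler_pM => //; [apply: hd1; exact: phi_in|exact: hc1].
- move=> t y y' Tt Iy Iy'.
  apply: (@le_trans _ _ ((d2 * c1 * c1 + d1 * c2) * `|y - y'|)); last first.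
    by apply: ler_wpM2r => //; lra.
  rewrite /dreparam.
  have -> : dinv (phi t y) * dphi t y - dinv (phi t y') * dphi t y' =
    (dinv (phi t y) - dinv (phi t y')) * dphi t y +
    dinv (phi t y') * (dphi t y - dphi t y') by ring.
  apply: le_trans (ler_normD _ _) _; rewrite [leRHS]mulrDl !normrM; apply: lerD.
    rewrite [leRHS]mulrAC; apply: ler_pM => //; last exact: hc1.
    apply: le_trans (ldinv _ _ (phi_in Tt Iy) (phi_in Tt Iy')) _.
    by rewrite -mulrA; apply: ler_wpM2l => //; exact: lphi.
  rewrite -mulrA; apply: ler_pM => //; [apply: hd1; exact: phi_in|exact: ldphi].
- move=> t y y' Tt Iy Iy'.
  apply: (@le_trans _ _ ((d1 * c1) * `|y - y'|)); last by apply: ler_wpM2r => //; lra.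
  apply: le_trans (linv _ _ (phi_in Tt Iy) (phi_in Tt Iy')) _.
  by rewrite -mulrA; apply: ler_wpM2l => //; exact: lphi.
Qed.

Hypothesis inv_phi_C1 : forall z, I2 z -> Ck_on Theta 1 (inv ^~ z).

Lemma inv_phi_cvg z (t : nat -> R) : I2 z -> (forall n, Theta (t n)) ->
  t n @[n --> \oo] --> theta -> inv (t n) z @[n --> \oo] --> inv theta z.
Proof.
move=> Iz Tt ttheta; have [/(_ 0%N isT) d _] := inv_phi_C1 Iz.
exact: (within_cvg_seq Theta_theta (derivable_within_cvg Theta_theta (d _ Theta_theta)) Tt).
Qed.

(** Regularity in t is assumed of phi_t^-1, not of phi_t. It is transferred by y =
    psi_t(phi_t^-1(phi_theta(y))): the distance from psi_t(y) to y is at most L times that from y to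
    phi_t^-1(phi_theta(y)), which tends to 0. *)
Lemma reparam_cvg y (t : nat -> R) : I1 y -> (forall n, Theta (t n)) ->
  t n @[n --> \oo] --> theta -> reparam (t n) y @[n --> \oo] --> y.
Proof.
move=> Iy Tt ttheta; have [L [L0 _ _ lip]] := dreparam_bounds.
have cv := inv_phi_cvg (phi_in Theta_theta Iy) Tt ttheta.
rewrite inv_phiK// in cv.
apply/cvgrPdist_lt => e e0.
have e'0 : 0 < e / L by rewrite divr_gt0.
have /cvgrPdist_lt/(_ _ e'0) := cv; apply: filterS => n hn.
rewrite -{1}(reparam_inv (Tt n) Iy).
apply: le_lt_trans (lip _ _ _ (Tt n) _ Iy) _.
  by apply: inv_phi_in => //; exact: phi_in.
by rewrite distrC -ltr_pdivlMl// mulrC.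
Qed.

(* The second derivatives being uniformly bounded, [reparam t -> id] pointwise
   forces [dreparam t -> 1] (Landau's interpolation argument). *)
Lemma dreparam_cvg y (t : nat -> R) : I1° y -> (forall n, Theta (t n)) ->
  t n @[n --> \oo] --> theta -> dreparam (t n) y @[n --> \oo] --> (1 : R).
Proof.
move=> Iy Tt ttheta; have [L [L0 _ dlip lip]] := dreparam_bounds.
have Iy1 := interior_subset Iy.
have /nbhs_ballP[r/= r0 hr] := Iy.
apply/cvgrPdist_lt => e e0.
(* The increment of the difference quotient: at most r/2 to stay interior, and so small that psi_t'
   varies by at most e/2 between y and the mean value point. *)
pose eta := Num.min (r / 2) (e / (2 * L)).
have eta0 : 0 < eta by rewrite lt_min !divr_gt0// mulr_gt0.
have etar : eta < r by rewrite gt_min; apply/orP; left; lra.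
have etaL : L * eta <= e / 2.
  rewrite -ler_pdivlMl// [leRHS](_ : _ = e / (2 * L)); first by rewrite ge_min lexx orbT.
  by field; rewrite gt_eqF.
have int u : y <= u <= y + eta -> I1° u.
  move=> /andP[yu ue]; rewrite /interior; apply/nbhs_ballP.
  exists (r - eta) => /=; first by rewrite subr_gt0.
  move=> v; rewrite /ball/= => uv; apply: hr; rewrite /ball/=.
  rewrite (_ : y - v = (y - u) + (u - v)); last by ring.
  apply: le_lt_trans (ler_normD _ _) _.
  have : `|y - u| <= eta by rewrite ler_norml; lra.
  lra.
have Iye : I1 (y + eta).
  by apply: interior_subset; apply: int; rewrite lexx lerDl ltW.
have c1 := reparam_cvg Iy1 Tt ttheta; have c2 := reparam_cvg Iye Tt ttheta.
have cq : (reparam (t n) (y + eta) - reparam (t n) y) / eta @[n --> \oo] --> (1 : R).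
  have -> : 1 = (y + eta - y) / eta by rewrite addrAC subrr add0r divff// gt_eqF.
  by apply: cvgM; [exact: cvgB|exact: cvg_cst].
have e20 : 0 < e / 2 by rewrite divr_gt0.
have /cvgrPdist_lt/(_ _ e20) := cq; apply: filterS => n hn.
have yye : y < y + eta by rewrite ltrDl.
have [c cin cE] : exists2 c, c \in `]y, (y + eta)[ &
    reparam (t n) (y + eta) - reparam (t n) y = dreparam (t n) c * (y + eta - y).
  apply: MVT => //.
    move=> u; rewrite in_itv/= => /andP[/ltW yu /ltW ue].
    by apply: is_derive_reparam => //; apply: int; rewrite yu.
  apply: continuous_in_subspaceT => u; rewrite inE/= in_itv/= => yue.
  apply: differentiable_continuous; apply/derivable1_diffP.
  have [//] : is_derive u 1 (reparam (t n)) (dreparam (t n) u).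
  by apply: is_derive_reparam => //; exact: int.
move: hn; rewrite cE addrAC subrr add0r mulfK ?gt_eqF// => hn.
move: cin; rewrite in_itv/= => /andP[yc ce].
rewrite (_ : 1 - dreparam (t n) y =
  (1 - dreparam (t n) c) + (dreparam (t n) c - dreparam (t n) y)); last by ring.
apply: le_lt_trans (ler_normD _ _) _.
have Ic : I1 c by apply: interior_subset; apply: int; rewrite !ltW.
have h1 := dlip _ _ _ (Tt n) Ic Iy1.
have h2 : L * `|c - y| <= L * eta.
  by apply: ler_wpM2l; [exact: ltW|rewrite ler_norml; lra].
lra.
Qed.

End reparametrization.

(** * Mean values of the kernel *)

(** Of three distinct points of [I] the middle one is interior, so at most two points of [I] are
    not. *)
Lemma interval_boundary_countable (R : realType) (I : set R) :
  is_interval I -> countable (I `\` I°).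
Proof.
move=> Ii.
have no3 u v w : (I `\` I°) u -> (I `\` I°) v -> (I `\` I°) w -> u < v -> v < w -> False.
  move=> [Iu _] [_ nIv] [Iw _] uv vw; apply: nIv.
  by apply: (is_interval_interior Ii Iu Iw); rewrite uv.
have [->|/set0P[p Sp]] := eqVneq (I `\` I°) set0; first exact: countable0.
have [[q Sq qp]|hq] := pselect (exists2 q, (I `\` I°) q & q != p); last first.
  apply: (@sub_countable _ _ _ [set p]); last exact: countable1.
  apply: subset_card_le => q Sq /=; apply/eqP; apply: contrapT => /negP qp.
  by apply: hq; exists q.
apply: (@sub_countable _ _ _ [set p; q]); last exact/finite_set_countable/finite_set2.
apply: subset_card_le => r Sr /=.
case: (ltgtP r p) => [rp|pr|->]; [|  |by left];
  case: (ltgtP r q) => [rq|qr|->]; try (by right); exfalso;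
  move: qp; case: (ltgtP q p) => // [qp|pq] _.
- exact: (no3 r q p).
- exact: (no3 r p q).
- exact: (no3 q r p).
- by move: (lt_trans (lt_trans rp pq) qr); rewrite ltxx.
- by move: (lt_trans (lt_trans qp pr) rq); rewrite ltxx.
- exact: (no3 p r q).
- exact: (no3 q p r).
- exact: (no3 p q r).
Qed.

Section kernel_mean.
Context d (T : measurableType d) (R : realType) (P : probability T R).
Variables (Theta I1 I2 : set R) (theta : R) (phi : R -> R -> R).
Variables (e : {RV P >-> R}) (f K : R -> R).
Local Notation mu := (@lebesgue_measure R).
Hypothesis I1_itv : is_interval I1.
Hypothesis Theta_theta : Theta theta.
Hypothesis e_I1 : forall w, I1 (e w).
Hypothesis phi_bij : forall t, Theta t -> set_bij I1 I2 (phi t).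
Hypothesis phi_incr : forall t, Theta t ->
  forall u v, I1 u -> I1 v -> u < v -> phi t u < phi t v.
Hypothesis inv_phi_C1 : forall x, I2 x -> Ck_on Theta 1 (inv_phi I1 phi ^~ x).
Hypothesis f_density : has_density e f.
Hypothesis f_bounded : bounded_on I1 f.
Hypothesis f_C2 : Ck_on I1 2 f.
Hypothesis phi_C3 : forall t, Theta t -> Ck_on I1 3 (phi t).
Hypothesis inv_phi_C3 : Ck_on I2 3 (inv_phi I1 phi theta).
Hypothesis dinv_phi_bounded : forall k, (1 <= k <= 3)%N ->
  bounded_on I2 (deriven_within I2 k (inv_phi I1 phi theta)).
Hypothesis dphi_bounded : forall k, (1 <= k <= 3)%N ->
  exists C, forall t u, Theta t -> I1 u -> `|deriven_within I1 k (phi t) u| <= C.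
Hypothesis K_ge0 : forall u, 0 <= K u.
Hypothesis K_int : mu.-integrable setT (EFin \o K).
Hypothesis K_bounded : bounded_on setT K.

Local Notation inv := (inv_phi I1 phi).
Local Notation reparam := (reparam I1 theta phi).
Local Notation dreparam := (dreparam I1 I2 theta phi).

Let mf : measurable_fun setT f. Proof. by case: f_density. Qed.
Let f_ge0 u : 0 <= f u. Proof. by case: f_density => _ + _. Qed.
Let f_law A : measurable A -> P (e @^-1` A) = (\int[mu]_(u in A) (f u)%:E)%E.
Proof. by case: f_density => _ _; exact. Qed.

Let f_cont u : I1° u -> {for u, continuous f}.
Proof.
move=> Iu; apply: differentiable_continuous; apply/derivable1_diffP.
rewrite -(derivable_within_interior f Iu); case: f_C2 => /(_ 0%N isT) h _.
by apply: h; exact: interior_subset.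
Qed.

(** A law with a density does not charge countable sets. All substitutions can thus take place on
    the interior, where relative derivatives are ordinary ones. *)
Lemma noise_boundary0 : P (e @^-1` (~` I1°)) = 0%E.
Proof.
have mI : measurable (I1 `\` I1°).
  apply: measurableD; first exact: is_interval_measurable.
  by apply: open_measurable; exact: open_interior.
have -> : e @^-1` (~` I1°) = e @^-1` (I1 `\` I1°).
  by apply/seteqP; split => w /=; [move=> ?; split|case].
rewrite f_law//; apply: null_set_integral => //.
  by apply: measurable_funTS; exact/measurable_EFinP.
exact/countable_lebesgue_measure0/interval_boundary_countable.
Qed.

Lemma support_interior : exists y0, I1° y0.
Proof.
apply: contrapT => /forallNP h; have := noise_boundary0.
have -> : e @^-1` (~` I1°) = setT by apply/seteqP; split => // w _; exact: h.
by rewrite probability_setT => /eqP; rewrite onee_eq0.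
Qed.

Lemma measurable_reparam_noise t : Theta t ->
  measurable_fun setT (fun w => inv t (phi theta (e w))).
Proof.
move=> Tt.
have mI : measurable I1 by exact: is_interval_measurable.
have mg := measurable_inv_phi I1_itv Theta_theta phi_bij phi_incr Tt.
rewrite (_ : (fun w => _) = ((fun u => inv t (phi theta u)) \_ I1) \o e).
  apply: measurableT_comp; last exact: measurable_funP.
  by apply/(measurable_restrictT _ mI).
by apply/funext => w /=; rewrite patchE mem_set.
Qed.

Section at_point.
Variable x : R.

(** The density of Z(t) at x + h u; h times it is the density of (Z(t) - x) / h. *)
Definition kernel_density t h u : R :=
  ((fun u => f (reparam t (x + h * u)) * dreparam t (x + h * u)) \_
    [set u | I1° (x + h * u)]) u.

Lemma kernel_density_le : exists2 C, 0 <= C &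
  forall t h u, Theta t -> `|kernel_density t h u| <= C.
Proof.
have [L [L0 Lb _ _]] := dreparam_bounds I1_itv Theta_theta phi_bij phi_incr phi_C3
  inv_phi_C3 dinv_phi_bounded dphi_bounded.
have [C fC] := f_bounded; exists (`|C| * L); first by rewrite mulr_ge0// ltW.
move=> t h u Tt; rewrite /kernel_density patchE; case: ifPn => [/set_mem /= Iu|_].
  have Iu' := interior_subset Iu.
  rewrite normrM ler_pM//; last exact: Lb.
  apply: le_trans (fC _ _) (ler_norm _).
  by apply: (reparam_in Theta_theta phi_bij).
by rewrite normr0 mulr_ge0// ltW.
Qed.

Let W h := [set u | I1° (x + h * u)].

Let W_open h : open (W h).
Proof.
rewrite (_ : W h = (fun u => x + h * u) @^-1` I1°)//; apply: open_comp.
  move=> u _; apply: (@continuousD _ _ _ (fun=> x) (fun u => h * u)).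
    exact: cvg_cst.
  exact: mulrl_continuous.
exact: open_interior.
Qed.

Let I1i_itv : is_interval I1°.
Proof.
move=> u v Iu Iv z /andP[]; rewrite le_eqVlt => /predU1P[<-//|uz].
rewrite le_eqVlt => /predU1P[->//|zv].
by apply: (is_interval_interior I1_itv (interior_subset Iu) (interior_subset Iv)); rewrite uz.
Qed.

Let is_derive_W t h u : Theta t -> W h u ->
  is_derive u 1 (fun v => reparam t (x + h * v)) (h * dreparam t (x + h * u)).
Proof.
move=> Tt Wu; rewrite mulrC.
have d1 : is_derive u 1 (fun v => x + h * v) h.
  have := is_deriveD (is_derive_cst x u 1) (is_deriveZ h (is_derive_id u 1)).
  by rewrite add0r /GRing.scale/= mulr1.
apply: (@is_derive1_comp _ (reparam t) (fun v => x + h * v)).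
exact: (is_derive_reparam I1_itv Theta_theta phi_bij phi_incr phi_C3 inv_phi_C3).
Qed.

(** The noise density is transported by u |-> psi_t(x + h u), which sends (Z(t) - x) / h to the
    noise. The estimator has x - Z(t) instead; symmetry of the kernel reconciles the two later. *)
Lemma kernel_mean t h : Theta t -> 0 < h ->
  (\int[P]_w (K ((inv t (phi theta (e w)) - x) / h))%:E =
   \int[mu]_u (K u * (h * kernel_density t h u))%:E)%E /\
  measurable_fun setT (kernel_density t h).
Proof.
move=> Tt h0.
pose V w := (inv t (phi theta (e w)) - x) / h.
pose rho u := reparam t (x + h * u).
have mV : measurable_fun setT V.
  by apply: measurable_funM => //; apply: measurable_funB => //; exact: measurable_reparam_noise.
have [y0 Iy0] := support_interior.
have hK z : x + h * ((z - x) / h) = z by field; rewrite gt_eqF.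
have Ww0 : W h ((y0 - x) / h) by rewrite /W/= hK.
have W_itv : is_interval (W h).
  move=> u v Wu Wv z /andP[uz zv]; apply: (I1i_itv Wu Wv).
  by rewrite !lerD2l !ler_pM2l// uz.
have rho_der u : W h u -> is_derive u 1 rho (h * dreparam t (x + h * u)).
  exact: is_derive_W.
have rho_derE u : W h u -> derive1 rho u = h * dreparam t (x + h * u).
  by move=> Wu; rewrite derive1E; have [_ ->] := rho_der u Wu.
(* The derivative of [rho] inherits from psi_t' the Lipschitz constant h L h. *)
have rho_c u : W h u -> {for u, continuous (derive1 rho)}.
  move=> Wu; have [L [L0 _ dlip _]] := dreparam_bounds I1_itv Theta_theta
    phi_bij phi_incr phi_C3 inv_phi_C3 dinv_phi_bounded dphi_bounded.
  have nW : nbhs u (W h) by apply: open_nbhs_nbhs; split => //; exact: W_open.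
  apply/cvgrPdist_lt => r r0.
  have nB : \forall v \near u, `|u - v| < (h * L * h)^-1 * r.
    by apply: nbhsx_ballx; rewrite mulr_gt0// invr_gt0 !mulr_gt0.
  near=> v.
  have Wv : W h v by near: v; exact: nW.
  rewrite (rho_derE _ Wu) (rho_derE _ Wv) -mulrBr normrM gtr0_norm//.
  have := dlip t _ _ Tt (interior_subset Wu) (interior_subset Wv).
  rewrite (_ : x + h * u - (x + h * v) = h * (u - v)); last by ring.
  rewrite normrM gtr0_norm// => hd.
  apply: (@le_lt_trans _ _ (h * (L * (h * `|u - v|)))); first by rewrite ler_pM2l.
  rewrite (_ : h * (L * (h * `|u - v|)) = (h * L * h) * `|u - v|); last by ring.
  by rewrite -ltr_pdivlMl ?mulr_gt0//; near: v; exact: nB.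
have mK : measurable_fun setT K.
  by apply/measurable_EFinP; exact: measurable_int K_int.
have [C KC] := K_bounded.
have tdE : transported_density f rho (W h) = fun u => h * kernel_density t h u.
  apply/funext => u; rewrite /transported_density /kernel_density !patchE.
  case: ifPn => [/set_mem Wu|_]; last by rewrite mulr0.
  by rewrite rho_derE// /rho mulrCA.
have rho_in u : W h u -> I1° (rho u).
  by move=> Wu; exact: (reparam_interior I1_itv Theta_theta phi_bij phi_incr phi_C3).
have rho_incr u v : W h u -> W h v -> u < v -> rho u < rho v.
  move=> Wu Wv uv; rewrite /rho (reparam_lt Theta_theta phi_bij phi_incr)//.
  - by rewrite ltrD2l ltr_pM2l.
  - exact: interior_subset.
  - exact: interior_subset.
have V_rho : forall w c v, W h c -> W h v -> (c < V w <= v) = (rho c < e w <= rho v).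
  have Yin w : I1 (inv t (phi theta (e w))).
    by apply: (inv_phi_in phi_bij Tt); apply: (phi_in phi_bij).
  have lt_noise w y : I1 y -> (y < inv t (phi theta (e w))) = (reparam t y < e w).
    move=> Iy; rewrite -(reparam_lt Theta_theta phi_bij phi_incr Tt Iy (Yin w)).
    by rewrite (reparam_inv Theta_theta phi_bij Tt).
  have noise_lt w y : I1 y -> (inv t (phi theta (e w)) < y) = (e w < reparam t y).
    move=> Iy; rewrite -(reparam_lt Theta_theta phi_bij phi_incr Tt (Yin w) Iy).
    by rewrite (reparam_inv Theta_theta phi_bij Tt).
  move=> w c v Wc Wv; rewrite /V /rho -(lt_noise w _ (interior_subset Wc)).
  rewrite ltr_pdivlMr// ler_pdivrMr// [X in _ = _ && X]leNgt.
  rewrite -(lt_noise w _ (interior_subset Wv)) -leNgt.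
  by congr (_ && _); [rewrite ltrBrDl mulrC|rewrite lerBlDl mulrC].
have PVW : P (~` (V @^-1` W h)) = 0%E.
  apply/eqP; rewrite eq_le measure_ge0 andbT -noise_boundary0.
  have mI : measurable (I1° : set R) by apply: open_measurable; exact: open_interior.
  apply: le_measure; rewrite ?inE.
  + apply: measurableC; rewrite -[X in measurable X]setTI; apply: mV => //.
    exact: open_measurable.
  + by rewrite -[X in measurable X]setTI; apply: measurable_funP => //; exact: measurableC.
  + move=> w /= nW nI; apply: nW; rewrite /W/= /V hK.
    apply: (inv_phi_interior I1_itv phi_bij phi_incr) => //.
    exact: (phi_interior I1_itv Theta_theta phi_bij phi_incr phi_C3).
have rho_derivable u : W h u -> derivable rho u 1 by move=> /rho_der[].
have law := density_transport mV mf f_ge0 f_law I1i_itv f_cont (@W_open h)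
  W_itv Ww0 rho_in rho_incr rho_derivable rho_c V_rho PVW.
have mtd := measurable_transported_density mf (@W_open h) W_itv rho_derivable rho_c.
split.
  rewrite (@integral_density R d T P V _ K C mV mtd law mK) ?tdE// => u.
  exact: KC.
rewrite (_ : kernel_density t h = fun u => h^-1 * transported_density f rho (W h) u).
  exact: measurable_funM.
by apply/funext => u; rewrite tdE mulKf// gt_eqF.
Unshelve. all: by end_near. Qed.

Let kernel_integrable t h : Theta t -> 0 < h ->
  mu.-integrable setT (EFin \o (fun u => K u * kernel_density t h u)).
Proof.
move=> Tt h0; have [_ md] := kernel_mean Tt h0.
have mK : measurable_fun setT K.
  by apply/measurable_EFinP; exact: measurable_int K_int.
have [D D0 hD] := kernel_density_le.
apply: (@le_integrable _ _ _ mu setT measurableT _ (fun u => (D * K u)%:E)).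
- by apply/measurable_EFinP; exact: measurable_funM.
- move=> u _ /=; rewrite lee_fin !normrM mulrC; apply: ler_wpM2r => //.
  by rewrite (ger0_norm D0); exact: hD.
- exact: (integrableZl measurableT D K_int).
Qed.

Lemma kernel_mean_scaled t h : Theta t -> 0 < h ->
  \int[P]_w (h^-1 * K ((inv t (phi theta (e w)) - x) / h)) =
  \int[mu]_u (K u * kernel_density t h u).
Proof.
move=> Tt h0; have [hE _] := kernel_mean Tt h0.
have [C KC] := K_bounded.
have mK : measurable_fun setT K.
  by apply/measurable_EFinP; exact: measurable_int K_int.
rewrite RintegralZl//; last first.
  apply: (@bounded_integrable _ _ _ P _ C).
    apply: measurableT_comp => //; apply: measurable_funM => //.
    by apply: measurable_funB => //; exact: measurable_reparam_noise.
  by move=> w; exact: KC.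
have Ki := kernel_integrable Tt h0.
have -> : \int[P]_w K ((inv t (phi theta (e w)) - x) / h) =
    \int[mu]_u (h * (K u * kernel_density t h u)).
  rewrite /Rintegral hE; congr fine; apply: eq_integral => u _.
  by rewrite mulrCA.
by rewrite RintegralZl// mulKf// gt_eqF.
Qed.

Lemma kernel_mean_bounded : exists D, forall t h, Theta t -> 0 < h ->
  \int[P]_w (h^-1 * K ((inv t (phi theta (e w)) - x) / h)) <= D.
Proof.
have [D D0 hD] := kernel_density_le.
exists (\int[mu]_u (D * `|K u|)) => t h Tt h0; rewrite kernel_mean_scaled//.
apply: le_Rintegral => //; first exact: kernel_integrable.
  exact: (integrableZl measurableT D (integrable_norm K_int)).
move=> u _; apply: le_trans (ler_norm _) _.
by rewrite normrM mulrC ler_wpM2r//; exact: hD.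
Qed.

(** If f(x) > 0, continuity makes f exceed f(x)/2 on both sides of x. One side lies off [I1], where
    the noise never falls, yet an interval there would have positive probability. *)
Lemma density_at_endpoint : I1 x -> ~ I1° x -> {for x, continuous f} -> f x = 0.
Proof.
move=> Ix nIx fx; apply/eqP; case: (eqVneq (f x) 0) => // fx_neq0; exfalso.
have fx0 : 0 < f x by rewrite lt_neqAle eq_sym fx_neq0 f_ge0.
have fx2 : 0 < f x / 2 by rewrite divr_gt0.
have /cvgrPdist_lt/(_ _ fx2)/nbhs_ballP[r/= r0 hr] := fx.
(* [c] is the left end of a gap of length r: c = x when no point of [I1] exceeds x, c = x - r when
   none is below x. *)
have no_gap c : x - r <= c -> c + r <= x + r ->
    (forall y, c < y < c + r -> ~ I1 y) -> False.
  move=> c1 c2 cI; pose J := `]c, (c + r)[%classic : set R.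
  have mJ : measurable J by exact: measurable_itv.
  have : P (e @^-1` J) = 0%E.
    rewrite (_ : e @^-1` J = set0) ?measure0//; apply/seteqP; split => // w.
    by rewrite /J/= in_itv/= => /cI; apply; exact: e_I1.
  rewrite f_law// => J0.
  have : (\int[mu]_(u in J) (f x / 2)%:E <= \int[mu]_(u in J) (f u)%:E)%E.
    apply: ge0_le_integral => //.
    - by move=> u _; rewrite lee_fin ltW.
    - by apply: measurable_funTS; exact/measurable_EFinP.
    - move=> u; rewrite /J/= in_itv/= => /andP[cu ucr]; rewrite lee_fin.
      have : `|f x - f u| < f x / 2.
        by apply: hr; rewrite /ball/= ltr_norml; apply/andP; split; lra.
      by rewrite ltr_norml => /andP[_]; lra.
  rewrite J0 integral_cst//= lebesgue_measure_itv/= lte_fin ltrDl r0 -EFinB.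
  by rewrite -EFinM lee_fin addrAC subrr add0r leNgt mulr_gt0.
have [[y1 Iy1 y1x]|ny1] := pselect (exists2 y, I1 y & y < x).
  have [[y2 Iy2 xy2]|ny2] := pselect (exists2 y, I1 y & x < y).
    by apply: nIx; apply: (is_interval_interior I1_itv Iy1 Iy2); rewrite y1x.
  by apply: (no_gap x); [lra|lra|move=> y /andP[xy _] Iy; apply: ny2; exists y].
apply: (no_gap (x - r)); [lra|lra|].
by move=> y /andP[_ yx] Iy; apply: ny1; exists y => //; move: yx; lra.
Qed.

Let f_within r : I1 x -> 0 < r -> exists2 s, 0 < s &
  forall z, I1 z -> `|z - x| < s -> `|f z - f x| < r.
Proof.
move=> Ix r0; have dfx : derivable_within I1 f x.
  by case: f_C2 => /(_ 0%N isT) h _; exact: h.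
have /cvgrPdist_lt/(_ _ r0) := derivable_within_cvg Ix dfx.
rewrite near_withinE => /nbhs_ballP[s/= s0 hs]; exists s => // z Iz zx.
by rewrite distrC; apply: hs => //; rewrite /ball/= distrC.
Qed.

(** With y = x + h u, the error splits into (f(psi_t(y)) - f(x)) psi_t'(y), small because psi_t(y)
    -> x, and f(x) (psi_t'(y) - 1). The latter is treated for x interior; at an endpoint f(x) = 0
    removes it. *)
Lemma kernel_density_cvg (t h : nat -> R) u : I1 x -> I1° x \/ {for x, continuous f} ->
  (forall n, Theta (t n)) -> t n @[n --> \oo] --> theta ->
  (forall n, 0 < h n) -> h n @[n --> \oo] --> (0 : R) ->
  kernel_density (t n) (h n) u @[n --> \oo] --> f x.
Proof.
move=> Ix xcase Tt ttheta h0 hcv.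
have [L [L0 Lb dlip lip]] := dreparam_bounds I1_itv Theta_theta phi_bij phi_incr phi_C3
  inv_phi_C3 dinv_phi_bounded dphi_bounded.
have ycv : h n * u @[n --> \oo] --> (0 : R).
  by rewrite -[X in _ --> X](mul0r u); apply: cvgM => //; exact: cvg_cst.
have rx := reparam_cvg I1_itv Theta_theta phi_bij phi_incr phi_C3
  inv_phi_C3 dinv_phi_bounded dphi_bounded inv_phi_C1 Ix Tt ttheta.
apply/cvgrPdist_lt => r r0.
have r1 : 0 < r / 2 / L by rewrite !divr_gt0.
have [s s0 hs] := f_within Ix r1.
have sL : 0 < s / 2 / L by rewrite !divr_gt0.
have s2 : 0 < s / 2 by rewrite divr_gt0.
have n1 : \forall n \near \oo, `|h n * u| < s / 2 / L.
  by have /cvgrPdist_lt/(_ _ sL) := ycv; apply: filterS => n; rewrite sub0r normrN.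
have n2 : \forall n \near \oo, `|reparam (t n) x - x| < s / 2.
  by have /cvgrPdist_lt/(_ _ s2) := rx; apply: filterS => n; rewrite distrC.
have first_term n : `|h n * u| < s / 2 / L -> `|reparam (t n) x - x| < s / 2 ->
    I1° (x + h n * u) ->
    `|(f (reparam (t n) (x + h n * u)) - f x) * dreparam (t n) (x + h n * u)| < r / 2.
  move=> hn1 hn2 /interior_subset Iy.
  have ry : `|reparam (t n) (x + h n * u) - x| < s.
    rewrite (_ : _ - x = (reparam (t n) (x + h n * u) - reparam (t n) x) +
      (reparam (t n) x - x)); last by ring.
    apply: le_lt_trans (ler_normD _ _) _.
    have := lip _ _ _ (Tt n) Iy Ix; rewrite [x + _ - x]addrAC subrr add0r => hl.
    have : L * `|h n * u| < s / 2 by rewrite -ltr_pdivlMl// [L^-1 * _]mulrC.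
    by move: hn2; lra.
  rewrite normrM.
  apply: (@le_lt_trans _ _ (`|f (reparam (t n) (x + h n * u)) - f x| * L)).
    by apply: ler_wpM2l => //; exact: Lb.
  by rewrite -ltr_pdivlMr//; apply: hs => //; exact: (reparam_in Theta_theta phi_bij).
have [Iix|nIx] := pselect (I1° x); last first.
  have fx0 : f x = 0 by case: xcase => // fx; exact: density_at_endpoint.
  near=> n; rewrite fx0 sub0r normrN /kernel_density patchE.
  have r20 : r / 2 < r by lra.
  case: ifPn => [/set_mem/= Iy|_]; last by rewrite normr0.
  have := @first_term n _ _ Iy; rewrite fx0 subr0 => ft.
  by apply: lt_trans r20; apply: ft; near: n.
have dx := dreparam_cvg I1_itv Theta_theta phi_bij phi_incr phi_C3
  inv_phi_C3 dinv_phi_bounded dphi_bounded inv_phi_C1 Iix Tt ttheta.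
(* Adding 1 permits dividing by [c] even when f(x) = 0. *)
pose c := f x + 1; have c0 : 0 < c by rewrite ltr_wpDl.
have r4 : 0 < r / 4 / c by rewrite !divr_gt0.
have r4L : 0 < r / 4 / c / L by rewrite !divr_gt0.
have n3 : \forall n \near \oo, `|dreparam (t n) x - 1| < r / 4 / c.
  by have /cvgrPdist_lt/(_ _ r4) := dx; apply: filterS => n; rewrite distrC.
have n4 : \forall n \near \oo, `|h n * u| < r / 4 / c / L.
  by have /cvgrPdist_lt/(_ _ r4L) := ycv; apply: filterS => n; rewrite sub0r normrN.
have n5 : \forall n \near \oo, I1° (x + h n * u).
  have ycv' : x + h n * u @[n --> \oo] --> x.
    by rewrite -[X in _ --> X]addr0; apply: cvgD => //; exact: cvg_cst.
  by apply: ycv'; apply: open_nbhs_nbhs; split => //; exact: open_interior.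
near=> n.
have Iy : I1° (x + h n * u) by near: n.
rewrite distrC /kernel_density patchE mem_set//.
have ft : `|(f (reparam (t n) (x + h n * u)) - f x) * dreparam (t n) (x + h n * u)| < r / 2.
  by apply: first_term => //; near: n.
have h3 : `|dreparam (t n) x - 1| < r / 4 / c by near: n.
have h4 : `|h n * u| < r / 4 / c / L by near: n.
rewrite (_ : _ - f x =
  (f (reparam (t n) (x + h n * u)) - f x) * dreparam (t n) (x + h n * u) +
  f x * ((dreparam (t n) (x + h n * u) - dreparam (t n) x) + (dreparam (t n) x - 1)));
  last by ring.
apply: le_lt_trans (ler_normD _ _) _; rewrite [X in _ + X]normrM (ger0_norm (f_ge0 x)).
set D := _ - dreparam (t n) x; set E := dreparam (t n) x - 1.
have hD : `|D| < r / 4 / c.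
  apply: le_lt_trans (dlip _ _ _ (Tt n) (interior_subset Iy) Ix) _.
  by rewrite [x + _ - x]addrAC subrr add0r -ltr_pdivlMl// [L^-1 * _]mulrC.
have hDE : `|D + E| <= r / 2 / c.
  apply: le_trans (ler_normD _ _) _; rewrite (_ : r / 2 / c = r / 4 / c + r / 4 / c).
    by apply: lerD; exact: ltW.
  by field; rewrite gt_eqF.
have : f x * `|D + E| <= r / 2.
  apply: (@le_trans _ _ (c * (r / 2 / c))).
    by apply: ler_pM => //; rewrite /c; lra.
  by rewrite mulrC divfK// gt_eqF.
by move: ft; lra.
Unshelve. all: by end_near. Qed.

Lemma kernel_mean_cvg (t h : nat -> R) : I1 x -> I1° x \/ {for x, continuous f} ->
  (\int[mu]_u (K u)%:E = 1)%E ->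
  (forall n, Theta (t n)) -> t n @[n --> \oo] --> theta ->
  (forall n, 0 < h n) -> h n @[n --> \oo] --> (0 : R) ->
  \int[P]_w ((h n)^-1 * K ((inv (t n) (phi theta (e w)) - x) / h n)) @[n --> \oo] --> f x.
Proof.
move=> Ix xcase K1 Tt ttheta h0 hcv.
have [D D0 hD] := kernel_density_le.
have mK : measurable_fun setT (EFin \o K) by exact: measurable_int K_int.
have mK' : measurable_fun setT K by exact/measurable_EFinP.
under eq_fun => n do rewrite kernel_mean_scaled//.
have DKi : mu.-integrable setT (fun u => (D * K u)%:E).
  exact: (integrableZl measurableT D K_int).
have [] := @dominated_convergence _ _ _ mu setT measurableT
  (fun n u => (K u * kernel_density (t n) (h n) u)%:E) (fun u => (K u * f x)%:E)
  (fun u => (D * K u)%:E).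
- move=> n; apply/measurable_EFinP; apply: measurable_funM => //.
  by have [] := kernel_mean (Tt n) (h0 n).
- by apply/measurable_EFinP; exact: measurable_funM.
- apply: aeW => u _; apply: cvg_EFin; first exact: nearW.
  by apply: cvgM; [exact: cvg_cst|exact: kernel_density_cvg].
- exact: DKi.
- apply: aeW => u n _; rewrite /= lee_fin normrM (ger0_norm (K_ge0 u)) mulrC.
  by apply: ler_wpM2r => //; exact: hD.
move=> _ _ h'.
have -> : f x = fine (\int[mu]_u (K u * f x)%:E)%E.
  under eq_integral do rewrite mulrC EFinM.
  by rewrite integralZl// K1 mule1.
apply: fine_cvg; rewrite fineK//.
under eq_integral do rewrite mulrC EFinM.
by rewrite integralZl// K1 mule1.
Unshelve. all: by end_near. Qed.

End at_point.
End kernel_mean.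

(** * Dominated convergence and Caratheodory functions *)

Lemma Rintegral_dominated_cvg d (T : measurableType d) (R : realType)
    (P : {measure set T -> \bar R}) (u : nat -> T -> R) (v g : T -> R) :
  (forall n, measurable_fun setT (u n)) ->
  (forall w, u n w @[n --> \oo] --> v w) ->
  P.-integrable setT (EFin \o g) -> (forall n w, `|u n w| <= g w) ->
  \int[P]_w u n w @[n --> \oo] --> \int[P]_w v w.
Proof.
move=> mu uv gi ug.
have mv : measurable_fun setT v.
  by apply: (@measurable_fun_cvg _ _ _ setT u v) => // w _; exact: uv.
have muE n : measurable_fun setT (EFin \o u n) by exact/measurable_EFinP.
have mvE : measurable_fun setT (EFin \o v) by exact/measurable_EFinP.
have [||vi _ h] := @dominated_convergence _ _ _ P setT measurableT
  (fun n => EFin \o u n) (EFin \o v) (EFin \o g) muE mvE _ gi _.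
- by apply: aeW => w _; apply: cvg_EFin; [exact: nearW|exact: uv].
- by apply: aeW => w n _; rewrite /= lee_fin.
by apply: fine_cvg; rewrite fineK//; exact: integrable_fin_num.
Qed.

Section caratheodory.
Context {R : realType}.

(** Rounding t down to the grid of mesh 1/(m+1) leaves countably many values, so a preimage is a
    countable union of rectangles. *)
Lemma measurable_floor_section (g : R -> R -> R) (m : nat) :
  (forall t, measurable_fun setT (g t)) ->
  measurable_fun [set: (R * R)%type]
    (fun z => g ((Num.floor (z.1 * m.+1%:R))%:~R / m.+1%:R) z.2).
Proof.
move=> mg _ Y mY; rewrite setTI.
have -> : (fun z : R * R => g ((Num.floor (z.1 * m.+1%:R))%:~R / m.+1%:R) z.2) @^-1` Y =
    \bigcup_(k : int) ([set t | Num.floor (t * m.+1%:R) = k] `*`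
      (g (k%:~R / m.+1%:R) @^-1` Y)).
  apply/seteqP; split => [[t e] /= h|[t e] [k _ [/= <- h]]]; last by [].
  by exists (Num.floor (t * m.+1%:R)).
apply: countable_bigcupT_measurable => // k; apply: measurableX.
  have -> : [set t : R | Num.floor (t * m.+1%:R) = k] =
      `[(k%:~R / m.+1%:R), ((k + 1)%:~R / m.+1%:R)[%classic.
    apply/seteqP; split => t /=; rewrite in_itv/= ler_pdivrMr// ltr_pdivlMr//.
      by move=> <-; exact: floor_itv.
    by move=> h; exact: floor_def.
  exact: measurable_itv.
by rewrite -[X in measurable X]setTI; exact: mg.
Qed.

(* A Caratheodory function is the pointwise limit of its discretisations in the
   continuous variable, and the latter are countably many sections. *)
Lemma measurable_caratheodory (g : R -> R -> R) :
  (forall e, continuous (fun t => g t e)) -> (forall t, measurable_fun setT (g t)) ->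
  measurable_fun [set: (R * R)%type] (fun z => g z.1 z.2).
Proof.
move=> cg mg.
apply: (@measurable_fun_cvg _ _ _ setT
  (fun m (z : R * R) => g ((Num.floor (z.1 * m.+1%:R))%:~R / m.+1%:R) z.2)).
  by move=> m; exact: measurable_floor_section.
move=> [t e] _ /=; apply: (cvg_comp _ (fun s => g s e)); last exact: cg.
apply/cvgrPdist_lt => r r0; have [k hk] := ltr_add_invr r0.
exists k => // m /= km.
have m0 : (0 : R) < m.+1%:R by [].
have /andP[h1 h2] : (Num.floor (t * m.+1%:R))%:~R <= t * m.+1%:R <
    (Num.floor (t * m.+1%:R) + 1)%:~R by exact: floor_itv.
rewrite add0r in hk.
have mk : (m.+1%:R : R)^-1 <= k.+1%:R^-1 by rewrite lef_pV2 ?posrE// ler_nat.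
apply: le_lt_trans hk; apply: le_trans mk.
rewrite -{1}[t](mulfK (lt0r_neq0 m0)) -mulrBl normrM [X in _ * X]gtr0_norm ?invr_gt0//.
rewrite ler_piMl// ?invr_ge0 ?ltW//.
by rewrite ger0_norm ?subr_ge0//; move: h2; rewrite intrD; lra.
Qed.

End caratheodory.

(** * The mean square and its gradient *)

Section gradient.
Context d (T : measurableType d) (R : realType) (P : probability T R).
Variables (Theta I1 I2 : set R) (theta a b : R) (phi : R -> R -> R).
Variables (e : {RV P >-> R}).
Hypothesis Theta_itv : is_interval Theta.
Hypothesis I1_itv : is_interval I1.
Hypothesis Theta_theta : Theta theta.
Hypothesis e_I1 : forall w, I1 (e w).
Hypothesis phi_bij : forall t, Theta t -> set_bij I1 I2 (phi t).
Hypothesis phi_incr : forall t, Theta t ->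
  forall u v, I1 u -> I1 v -> u < v -> phi t u < phi t v.
Hypothesis inv_phi_C1 : forall x, I2 x -> Ck_on Theta 1 (inv_phi I1 phi ^~ x).
Hypothesis dinv_phi_L4 : forall B : set R, compact B -> B `<=` Theta ->
  (\int[P]_w ereal_sup
     [set (`|dinv_phi Theta I1 phi t (phi theta (e w))| ^+ 4)%:E
        | t in B] < +oo)%E.
Hypothesis lt_ab : a < b.
Hypothesis ab_Theta : `[a, b] `<=` Theta.
Hypothesis theta_ab : a < theta < b.

Local Notation Y u := (fun t => inv_phi I1 phi t (phi theta u)).
Local Notation dY u := (fun t => dinv_phi Theta I1 phi t (phi theta u)).

Let phi_theta_in u : I1 u -> I2 (phi theta u).
Proof. exact: (phi_in phi_bij). Qed.

Lemma Y_derivable u t : I1 u -> Theta t -> derivable_within Theta (Y u) t.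
Proof. by move=> /phi_theta_in /inv_phi_C1 [/(_ 0%N isT) h _]; exact: h. Qed.

Lemma dY_cvg u t : I1 u -> Theta t -> dY u s @[s --> within Theta (nbhs t)] --> dY u t.
Proof.
move=> /phi_theta_in /inv_phi_C1 [_ c] Tt.
by have /subspace_continuousP := c; apply.
Qed.

Lemma Y_cvg u t : I1 u -> Theta t -> Y u s @[s --> within Theta (nbhs t)] --> Y u t.
Proof. by move=> Iu Tt; apply: derivable_within_cvg => //; exact: Y_derivable. Qed.

Lemma Y_theta u : I1 u -> Y u theta = u.
Proof. exact: (inv_phiK phi_bij). Qed.

Lemma measurable_Y t : Theta t -> measurable_fun I1 (fun u => Y u t).
Proof. exact: (measurable_inv_phi I1_itv Theta_theta phi_bij phi_incr). Qed.

(** Limit of difference quotients along increments shrinking from t' - t to 0, which stay within the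
    interval [Theta]; the second point t' provides them. *)
Lemma measurable_dY t t' : Theta t -> Theta t' -> t' != t ->
  measurable_fun I1 (fun u => dY u t).
Proof.
move=> Tt Tt' tt'; have mI : measurable I1 by exact: is_interval_measurable.
pose h n : R := (t' - t) / n.+1%:R.
have tt0 : t' - t != 0 by rewrite subr_eq0.
have Th n : Theta (h n + t).
  have : (n.+1%:R : R)^-1 <= 1 by rewrite invf_le1// ler1n.
  have : 0 <= (n.+1%:R : R)^-1 by rewrite invr_ge0.
  rewrite /h; move: (n.+1%:R^-1) => s s0 s1; have [tt|tt] := leP t t'.
    by apply: (Theta_itv Tt Tt'); apply/andP; split; nra.
  by apply: (Theta_itv Tt' Tt); apply/andP; split; nra.
apply: (@measurable_fun_cvg _ _ _ I1 (fun n u => (h n)^-1 * (Y u (h n + t) - Y u t))).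
  move=> n; apply: measurable_funM; first exact: measurable_cst.
  by apply: measurable_funB; exact: measurable_Y.
move=> u Iu; apply: (derive_within_seq (Y_derivable Iu Tt)).
  by move=> n; split; [rewrite mulf_neq0// invr_neq0|exact: Th].
rewrite -[X in _ --> X](mulr0 (t' - t)); apply: cvgM; first exact: cvg_cst.
exact: cvg_harmonic.
Qed.

Let measurable_noise (g : R -> R) : measurable_fun I1 g ->
  measurable_fun setT (fun w => g (e w)).
Proof.
move=> mg; have mI : measurable I1 by exact: is_interval_measurable.
rewrite (_ : (fun w => g (e w)) = (g \_ I1) \o e).
  apply: measurableT_comp; last exact: measurable_funP.
  by apply/(measurable_restrictT _ mI).
by apply/funext => w /=; rewrite patchE mem_set.
Qed.

(** The derivative at t sees all increments within [Theta], so [a', b'] must contain every point of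
    [Theta] near t. If a is the left end of [Theta], a' = a works; otherwise any point of [Theta]
    left of a does. The same holds at b. *)
Lemma surrounding_interval : exists a' b', [/\ a' <= a, b <= b',
  forall t, a' <= t <= b' -> Theta t &
  forall t, a <= t <= b -> exists2 r, 0 < r &
    forall s, Theta s -> `|s - t| < r -> a' <= s <= b'].
Proof.
have Ta : Theta a by apply: ab_Theta; rewrite /= in_itv/= lexx ltW.
have Tb : Theta b by apply: ab_Theta; rewrite /= in_itv/= lexx ltW.
have [a' [a'a Ta' ha']] : exists a', [/\ a' <= a, Theta a' &
    exists2 r, 0 < r & forall s, Theta s -> a - s < r -> a' <= s].
  have [[s Ts sa]|ns] := pselect (exists2 s, Theta s & s < a).
    exists s; split => //; first exact: ltW.
    by exists (a - s) => [|s' _]; [rewrite subr_gt0|lra].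
  exists a; split => //; exists 1 => // s Ts _.
  by rewrite leNgt; apply/negP => sa; apply: ns; exists s.
have [b' [bb' Tb' hb']] : exists b', [/\ b <= b', Theta b' &
    exists2 r, 0 < r & forall s, Theta s -> s - b < r -> s <= b'].
  have [[s Ts bs]|ns] := pselect (exists2 s, Theta s & b < s).
    exists s; split => //; first exact: ltW.
    by exists (s - b) => [|s' _]; [rewrite subr_gt0|lra].
  exists b; split => //; exists 1 => // s Ts _.
  by rewrite leNgt; apply/negP => sa; apply: ns; exists s.
exists a', b'; split => //.
  by move=> t h; apply: (Theta_itv Ta' Tb').
have [r1 r10 h1] := ha'; have [r2 r20 h2] := hb'.
move=> t /andP[at_ tb]; exists (Num.min r1 r2); first by rewrite lt_min r10.
move=> s Ts; rewrite lt_min !ltr_norml => /andP[/andP[? ?] /andP[? ?]].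
by rewrite h1 ?h2//; lra.
Qed.

(** [A] is the fourth root of the supremum of |dY|^4 over [a', b']. Continuity in t reduces the
    supremum to a dense sequence, hence measurability, and compactness makes it finite at every
    w. *)
Lemma gradient_envelope a' b' : a' < b' -> (forall t, a' <= t <= b' -> Theta t) ->
  exists A : T -> R, [/\ measurable_fun setT A,
    forall w, 0 <= A w,
    (\int[P]_w ((A w) ^+ 4)%:E < +oo)%E &
    forall w t, a' <= t <= b' -> `|dY (e w) t| <= A w].
Proof.
move=> ab' Tab'.
have Tab'' : `[a', b'] `<=` Theta by move=> t /=; rewrite in_itv/=; exact: Tab'.
pose v w t := (`|dY (e w) t| ^+ 4)%:E.
pose S w := ereal_sup [set v w t | t in `[a', b']%classic].
have Sint : (\int[P]_w S w < +oo)%E.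
  apply: dinv_phi_L4 => //; exact: segment_compact.
(* Rationals projected on [a', b']: the projection does not increase distances to points of the
   interval, so density survives. *)
pose q n : R := proj_itv a' b' (if unpickle n is Some s then ratr s else a').
have qab n : a' <= q n <= b' by apply: proj_itv_bounds; exact: ltW.
have dense t : a' <= t <= b' -> forall r, 0 < r -> exists n, `|q n - t| < r.
  move=> tab r r0.
  have [|s] := @rat_in_itvoo R (t - r) (t + r); first by lra.
  rewrite in_itv/= => hs; exists (pickle s); rewrite /q pickleK.
  have := proj_itv_contraction (ratr s) tab.
  rewrite -real_normK ?num_real// -[leRHS]real_normK ?num_real// ler_sqr ?nnegrE//.
  by move=> /le_lt_trans; apply; rewrite ltr_norml; lra.
have mdY t : a' <= t <= b' -> measurable_fun setT (fun w => dY (e w) t).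
  move=> tab; have Tt := Tab' t tab; apply: (@measurable_noise (fun u => dY u t)).
  have [->|tb] := eqVneq t b'.
    by apply: (@measurable_dY b' a'); rewrite ?lt_eqF//; apply: Tab'; rewrite lexx ltW.
  by apply: (@measurable_dY t b') => //; [apply: Tab'; rewrite lexx ltW|rewrite eq_sym].
have SE w : S w = esups (fun n => v w (q n)) 0%N.
  rewrite /esups/=; apply/eqP; rewrite eq_le; apply/andP; split; last first.
    apply: ge_ereal_sup => _ [n _ <-]; apply: ereal_sup_ubound.
    by exists (q n) => //=; rewrite in_itv/=.
  apply: ge_ereal_sup => _ [t /= tab <-].
  rewrite in_itv/= in tab.
  have /choice[k hk] : forall n : nat, exists m, `|q m - t| < n.+1%:R^-1.
    by move=> n; apply: dense => //; rewrite invr_gt0.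
  have qk : q (k n) @[n --> \oo] --> t.
    apply/cvgrPdist_lt => r r0; have [N hN] := ltr_add_invr r0; rewrite add0r in hN.
    exists N => // n /= Nn; rewrite distrC; apply: lt_trans (hk n) _.
    by apply: le_lt_trans hN; rewrite lef_pV2 ?posrE// ler_nat.
  have dq := within_cvg_seq (Tab' _ tab) (dY_cvg (e_I1 w) (Tab' _ tab))
    (fun n => Tab' _ (qab (k n))) qk.
  have vq : v w (q (k n)) @[n --> \oo] --> v w t.
    apply: cvg_EFin; first exact: nearW.
    have := cvg_comp _ _ (cvg_norm dq) (@exprn_continuous R 4 (`|dY (e w) t|)).
    exact.
  rewrite -(cvg_lim _ vq)//; apply: lime_le; first by apply/cvg_ex; eexists; exact: vq.
  by apply: nearW => n; apply: ereal_sup_ubound; exists (k n).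
have mS : measurable_fun setT S.
  rewrite (_ : S = fun w => esups (fun n => v w (q n)) 0%N); last by apply/funext => w; rewrite SE.
  apply: measurable_fun_esups => n; apply/measurable_EFinP; apply: measurable_funX.
  by apply: measurableT_comp => //; exact: mdY.
have v_le w t : a' <= t <= b' -> (v w t <= S w)%E.
  by move=> tab; apply: ereal_sup_ubound; exists t => //=; rewrite in_itv/=.
have S0 w : (0 <= S w)%E.
  apply: le_trans (v_le w a' _); last by rewrite lexx ltW.
  by rewrite lee_fin exprn_ge0.
have Sfin w : S w \is a fin_num.
  rewrite ge0_fin_numE//.
  have cdY : {within `[a', b'], continuous (fun t => `|dY (e w) t|)}.
    apply: (continuous_subspaceW Tab''); apply/subspace_continuousP => t Tt.
    by apply: cvg_norm; exact: dY_cvg.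
  have [c cab hc] := EVT_max (ltW ab') cdY.
  apply: le_lt_trans (ltry (`|dY (e w) c| ^+ 4)); apply: ge_ereal_sup => _ [t /= tab <-].
  by rewrite lee_fin lerXn2r ?nnegrE//; exact: hc.
pose A w := Num.sqrt (Num.sqrt (fine (S w))).
have A4 w : A w ^+ 4 = fine (S w).
  rewrite /A (_ : 4 = 2 * 2)%N// exprM !sqr_sqrtr ?sqrtr_ge0//.
  exact: fine_ge0.
exists A; split.
- apply: (@measurableT_comp _ _ _ _ _ _ (@Num.sqrt R)).
    exact: continuous_measurable_fun (@sqrt_continuous R).
  apply: (@measurableT_comp _ _ _ _ _ _ (@Num.sqrt R)).
    exact: continuous_measurable_fun (@sqrt_continuous R).
  exact: measurableT_comp.
- by move=> w; exact: sqrtr_ge0.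
- by rewrite (eq_integral S)// => w _; rewrite A4 fineK.
- move=> w t tab.
  have : `|dY (e w) t| ^+ 4 <= fine (S w) by rewrite -lee_fin fineK// v_le.
  move=> /ler_wsqrtr/ler_wsqrtr; rewrite (_ : 4 = 2 * 2)%N// exprM sqrtr_sqr.
  by rewrite ger0_norm ?exprn_ge0// sqrtr_sqr normr_id.
Qed.

Section mean_square_derivative.
Variables (a' b' : R) (A : T -> R).
Hypothesis a'_le : a' <= a.
Hypothesis b'_ge : b <= b'.
Hypothesis Theta_ab' : forall t, a' <= t <= b' -> Theta t.
Hypothesis nbhs_ab' : forall t, a <= t <= b -> exists2 r, 0 < r &
  forall s, Theta s -> `|s - t| < r -> a' <= s <= b'.
Hypothesis mA : measurable_fun setT A.
Hypothesis A_ge0 : forall w, 0 <= A w.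
Hypothesis A_L4 : (\int[P]_w ((A w) ^+ 4)%:E < +oo)%E.
Hypothesis dY_le : forall w t, a' <= t <= b' -> `|dY (e w) t| <= A w.

Let ab_ab' t : a <= t <= b -> a' <= t <= b'.
Proof. by move=> ?; move: a'_le b'_ge; lra. Qed.

Let theta_ab' : a' <= theta <= b'.
Proof. by move: a'_le b'_ge theta_ab; lra. Qed.

Let A2_integrable (c : R) : P.-integrable setT (EFin \o (fun w => c * A w ^+ 2)).
Proof.
have I4 : (\int[P]_w (A w ^+ 4)%:E)%E \is a fin_num.
  rewrite ge0_fin_numE// integral_ge0// => w _.
  by rewrite lee_fin exprn_ge0.
have [||+ _] := @square_integrable_integrable _ _ _ P (fun w => A w ^+ 2)
    (fine (\int[P]_w (A w ^+ 4)%:E)%E).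
- exact: measurable_funX.
- by rewrite fineK//; under eq_integral do rewrite -exprM.
by move=> /(integrableZl measurableT c).
Qed.

Let Y_lipschitz w s t : a' <= s <= b' -> a' <= t <= b' ->
  `|Y (e w) s - Y (e w) t| <= A w * `|s - t|.
Proof.
have lt s' t' : a' <= s' <= b' -> a' <= t' <= b' -> s' < t' ->
    `|Y (e w) s' - Y (e w) t'| <= A w * `|s' - t'|.
  move=> sab tab st.
  apply: (@derive_within_lipschitz_sub _ Theta (Y (e w))) => //; try exact: Theta_ab'.
  - by move=> z Tz; exact: Y_derivable.
  - by move=> z /andP[? ?]; apply: dY_le; lra.
move=> sab tab; case: (ltgtP s t) => [st|ts|->]; first exact: lt.
  by rewrite distrC [`|s - t|]distrC; exact: lt.
by rewrite !subrr !normr0 mulr0.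
Qed.

(** Y at theta is the noise itself, so this is the Lipschitz bound between t and theta. *)
Let Y_dist w t : a' <= t <= b' -> `|Y (e w) t - e w| <= (b' - a') * A w.
Proof.
move=> tab; rewrite -{2}(Y_theta (e_I1 w)).
apply: le_trans (Y_lipschitz w tab theta_ab') _; rewrite mulrC ler_wpM2r//.
by rewrite ler_norml; move: theta_ab'; lra.
Qed.

Let grad t w := - 2 * dY (e w) t * (e w - Y (e w) t).

(** Both factors are at most a multiple of [A]; the gradient is dominated by A^2 and its square by
    A^4, up to constants. *)
Let grad_le t w : a' <= t <= b' -> `|grad t w| <= 2 * (b' - a') * A w ^+ 2.
Proof.
move=> tab; rewrite /grad !normrM normrN distrC (@ger0_norm _ 2)//.
rewrite -!mulrA ler_pM2l// expr2 mulrCA.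
by rewrite ler_pM// ?dY_le// Y_dist.
Qed.

Let measurable_Yn t : a' <= t <= b' -> measurable_fun setT (fun w => Y (e w) t).
Proof. by move=> /Theta_ab'/measurable_Y; exact: measurable_noise. Qed.

Let measurable_grad t : a' <= t <= b' -> measurable_fun setT (grad t).
Proof.
move=> tab; have lt' : a' < b' by move: a'_le b'_ge lt_ab; lra.
have mdY : measurable_fun setT (fun w => dY (e w) t).
  have Tt := Theta_ab' tab; apply: (@measurable_noise (fun u => dY u t)).
  have [->|tb] := eqVneq t b'.
    by apply: (@measurable_dY b' a'); rewrite ?lt_eqF//; apply: Theta_ab'; rewrite lexx ltW.
  by apply: (@measurable_dY t b') => //; [apply: Theta_ab'; rewrite lexx ltW|rewrite eq_sym].
apply: measurable_funM; first by apply: measurable_funM => //; exact: measurable_cst.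
by apply: measurable_funB; [exact: measurable_funP|exact: measurable_Yn].
Qed.

Let grad_cvg w t (u : nat -> R) : a' <= t <= b' -> (forall n, a' <= u n <= b') ->
  u n @[n --> \oo] --> t -> grad (u n) w @[n --> \oo] --> grad t w.
Proof.
move=> tab uab ut; have Tu n := Theta_ab' (uab n); have Tt := Theta_ab' tab.
apply: cvgM; first apply: cvgM; first exact: cvg_cst.
  exact: (within_cvg_seq Tt (dY_cvg (e_I1 w) Tt) Tu ut).
apply: cvgB; first exact: cvg_cst.
exact: (within_cvg_seq Tt (Y_cvg (e_I1 w) Tt) Tu ut).
Qed.

Let measurable_sq t : a' <= t <= b' ->
  measurable_fun setT (fun w => `|Y (e w) t - e w| ^+ 2).
Proof.
move=> tab; apply: measurable_funX; apply: measurableT_comp => //.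
by apply: measurable_funB; [exact: measurable_Yn|exact: measurable_funP].
Qed.

Let sq_integrable t : a' <= t <= b' ->
  P.-integrable setT (EFin \o (fun w => `|Y (e w) t - e w| ^+ 2)).
Proof.
move=> tab; apply: le_integrable (A2_integrable ((b' - a') ^+ 2)) => //.
  by apply/measurable_EFinP; exact: measurable_sq.
move=> w _ /=; rewrite lee_fin -exprMn !normrX normr_id lerXn2r ?nnegrE//.
by apply: le_trans (Y_dist w tab) _; exact: ler_norm.
Qed.

Let mean_squareE t :
  mean_square I1 phi theta e t = \int[P]_w `|Y (e w) t - e w| ^+ 2.
Proof. by rewrite /mean_square unlock. Qed.

Let ab_limit_point t : a <= t <= b ->
  forall r, 0 < r -> exists h, [/\ h != 0, `|h| < r & Theta (h + t)].
Proof.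
move=> /andP[at_ tb] r r0; have [lt_tb|bt] := ltP t b.
  pose h := Num.min (r / 2) (b - t).
  have hr : h <= r / 2 by rewrite ge_min lexx.
  have hb : h <= b - t by rewrite ge_min lexx orbT.
  have h0 : 0 < h by rewrite lt_min; apply/andP; split; lra.
  exists h; split; [exact: lt0r_neq0|by rewrite gtr0_norm//; lra|].
  by apply: ab_Theta; rewrite /= in_itv/=; lra.
pose h := Num.min (r / 2) (b - a).
have hr : h <= r / 2 by rewrite ge_min lexx.
have hb : h <= b - a by rewrite ge_min lexx orbT.
have h0 : 0 < h by rewrite lt_min; apply/andP; split; move: lt_ab; lra.
exists (- h); split; first by rewrite oppr_eq0; exact: lt0r_neq0.
  by rewrite normrN gtr0_norm//; lra.
by apply: ab_Theta; rewrite /= in_itv/=; lra.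
Qed.

(** Differentiation under the integral, by dominated convergence along an arbitrary sequence of
    increments, with a multiple of A^2 as majorant. *)
Lemma derive_mean_square t : a <= t <= b ->
  derive_within Theta (mean_square I1 phi theta e) t = \int[P]_w grad t w.
Proof.
move=> tab; have tab' := ab_ab' tab; have Tt := Theta_ab' tab'.
apply: seq_derive_within; first exact: ab_limit_point.
move=> h hT h0; have [r r0 hr] := nbhs_ab' tab.
have /cvgrPdist_lt/(_ r r0)[N _ hN] := h0.
(* Finitely many increments may leave [a', b']; the first N are dropped. *)
rewrite -(cvg_shiftn N)/=.
suff main (k : nat -> R) : (forall n, k n != 0) -> (forall n, a' <= k n + t <= b') ->
    k n @[n --> \oo] --> 0 ->
    (k n)^-1 * (mean_square I1 phi theta e (k n + t) - mean_square I1 phi theta e t)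
      @[n --> \oo] --> \int[P]_w grad t w.
  apply: (main (fun n => h (n + N)%N)) => [n|n|]; first by have [] := hT (n + N)%N.
    apply: hr; first by have [] := hT (n + N)%N.
    by rewrite addrK -normrN -sub0r; apply: hN => /=; exact: leq_addl.
  by rewrite cvg_shiftn.
move=> k0 kab kcvg; have kT n := Theta_ab' (kab n).
have kt : k n + t @[n --> \oo] --> t.
  by rewrite -[X in _ --> X]add0r; apply: cvgD => //; exact: cvg_cst.
rewrite (_ : (fun n => _) = fun n => \int[P]_w ((k n)^-1 *
    (`|Y (e w) (k n + t) - e w| ^+ 2 - `|Y (e w) t - e w| ^+ 2))); last first.
  apply/funext => n; rewrite !mean_squareE.
  rewrite -(RintegralB measurableT (sq_integrable (kab n)) (sq_integrable tab')).
  rewrite RintegralZl//.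
  have := integrableB measurableT (sq_integrable (kab n)) (sq_integrable tab').
  exact.
(* Difference of squares: the first factor is a difference quotient of Y, at most [A] in size; the
   second is at most 2 (b' - a') A. *)
have qE n w : (k n)^-1 * (`|Y (e w) (k n + t) - e w| ^+ 2 - `|Y (e w) t - e w| ^+ 2)
    = ((k n)^-1 * (Y (e w) (k n + t) - Y (e w) t)) *
      ((Y (e w) (k n + t) - e w) + (Y (e w) t - e w)).
  rewrite !real_normK ?num_real//; ring.
apply: (@Rintegral_dominated_cvg _ _ _ P _ _ (fun w => 2 * (b' - a') * A w ^+ 2)).
- move=> n; apply: measurable_funM; first exact: measurable_cst.
  by apply: measurable_funB; exact: measurable_sq.
- move=> w; under eq_fun do rewrite qE.
  rewrite (_ : grad t w = dY (e w) t * ((Y (e w) t - e w) + (Y (e w) t - e w))); last first.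
    by rewrite /grad; ring.
  apply: cvgM.
    by apply: (derive_within_seq (Y_derivable (e_I1 w) Tt)).
  apply: cvgD; last exact: cvg_cst.
  apply: cvgB; last exact: cvg_cst.
  exact: (within_cvg_seq Tt (Y_cvg (e_I1 w) Tt) kT kt).
- exact: A2_integrable.
- move=> n w; rewrite qE normrM.
  rewrite (_ : 2 * _ * _ = A w * ((b' - a') * A w + (b' - a') * A w)); last by ring.
  rewrite ler_pM//.
    have := Y_lipschitz w (kab n) tab'; rewrite addrK => h1.
    by rewrite normrM normfV ler_pdivrMl ?normr_gt0// mulrC.
  by rewrite (le_trans (ler_normD _ _))// lerD// Y_dist.
Qed.

Let drift_continuous : {within `[a, b], continuous (fun t => \int[P]_w grad t w)}.
Proof.
apply/subspace_continuousP => t /=; rewrite in_itv/= => tab.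
apply: seq_within_cvg => u uab ut.
have uab' n : a' <= u n <= b' by apply: ab_ab'; have := uab n; rewrite /= in_itv.
apply: (@Rintegral_dominated_cvg _ _ _ P _ _ (fun w => 2 * (b' - a') * A w ^+ 2)).
- by move=> n; exact: measurable_grad.
- by move=> w; apply: grad_cvg => //; exact: ab_ab'.
- exact: A2_integrable.
- by move=> n w; exact: grad_le.
Qed.

Hypothesis M_incr : forall t, a <= t <= b -> t != theta ->
  0 < (t - theta) * derive_within Theta (mean_square I1 phi theta e) t.

Lemma mean_gradient_drift r : 0 < r -> exists2 eta, 0 < eta &
  forall t, a <= t <= b -> r <= (t - theta) ^+ 2 ->
    eta <= (t - theta) * \int[P]_w grad t w.
Proof.
move=> r0.
(* The added term is twice the positive part of r - (t - theta)^2: positive at theta, where the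
   drift vanishes, and 0 where the bound is wanted. So [D] is continuous and positive on [a, b], and
   its minimum is the required eta. *)
pose D t := (t - theta) * (\int[P]_w grad t w) + (r - (t - theta) ^+ 2 + `|r - (t - theta) ^+ 2|).
have cD : {within `[a, b], continuous D}.
  have cs : continuous (fun t : R => t - theta).
    by move=> t; apply: cvgB; [exact: cvg_id|exact: cvg_cst].
  have c1 : {within `[a, b], continuous (fun t : R => t - theta)}.
    exact: continuous_subspaceT.
  have cr : continuous (fun t : R => r - (t - theta) ^+ 2).
    move=> t; apply: cvgB; first exact: cvg_cst.
    by rewrite expr2; under eq_fun do rewrite expr2; apply: cvgM; exact: cs.
  have c2 : {within `[a, b],
      continuous (fun t : R => r - (t - theta) ^+ 2 + `|r - (t - theta) ^+ 2|)}.
    apply: continuous_subspaceT => t; apply: cvgD; first exact: cr.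
    by apply: cvg_norm; exact: cr.
  move=> t; apply: cvgD; last exact: c2.
  apply: cvgM; [exact: c1|exact: drift_continuous].
have [c cab hc] := EVT_min (ltW lt_ab) cD; rewrite in_itv/= in cab.
exists (D c).
  have [->|ct] := eqVneq c theta.
    by rewrite /D subrr mul0r add0r expr0n subr0 gtr0_norm// addr_gt0.
  rewrite /D ltr_wpDr// -?derive_mean_square// ?M_incr//.
  by have := ler_norm (- (r - (c - theta) ^+ 2)); rewrite normrN; lra.
move=> t tab rt; have := hc t; rewrite in_itv/= => /(_ tab).
by rewrite {2}/D (@ler0_norm _ (r - _)) ?subr_le0// subrr addr0.
Qed.

Lemma gradient_L2 : exists c, forall t, a <= t <= b ->
  (\int[P]_w (grad t w ^+ 2)%:E <= c%:E)%E.
Proof.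
pose c0 := (2 * (b' - a')) ^+ 2.
exists (c0 * fine (\int[P]_w (A w ^+ 4)%:E)%E) => t tab.
have I4 : (\int[P]_w (A w ^+ 4)%:E)%E \is a fin_num.
  rewrite ge0_fin_numE// integral_ge0// => w _.
  by rewrite lee_fin exprn_ge0.
rewrite EFinM fineK// -ge0_integralZl//; last 3 first.
- by apply/measurable_EFinP; exact: measurable_funX.
- by move=> w _; rewrite lee_fin exprn_ge0.
- by rewrite lee_fin sqr_ge0.
apply: ge0_le_integral => //.
- by move=> w _; rewrite lee_fin sqr_ge0.
- apply/measurable_EFinP; apply: measurable_funX; apply: measurable_grad; exact: ab_ab'.
- apply/measurable_EFinP; apply: measurable_funM => //; exact: measurable_funX.
- move=> w _; rewrite lee_fin -[grad t w ^+ 2]real_normK ?num_real//.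
  rewrite [4%N](_ : _ = 2 * 2)%N// exprM -exprMn ler_sqr ?nnegrE//.
    exact/grad_le/ab_ab'.
  by rewrite !mulr_ge0 ?sqr_ge0// subr_ge0; move: a'_le b'_ge; lra.
Qed.

End mean_square_derivative.

Hypothesis M_incr : forall t, a <= t <= b -> t != theta ->
  0 < (t - theta) * derive_within Theta (mean_square I1 phi theta e) t.

Lemma gradient_bounds :
  (exists c, forall t, a <= t <= b ->
    (\int[P]_w ((- 2 * dY (e w) t * (e w - Y (e w) t)) ^+ 2)%:E <= c%:E)%E) /\
  (forall r, 0 < r -> exists2 eta, 0 < eta & forall t, a <= t <= b ->
    r <= (t - theta) ^+ 2 ->
    eta <= (t - theta) * \int[P]_w (- 2 * dY (e w) t * (e w - Y (e w) t))).
Proof.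
have [a' [b' [a'a bb' Tab nab]]] := surrounding_interval.
have ab' : a' < b' by move: lt_ab; lra.
have [A [mA A0 A4 dYA]] := gradient_envelope ab' Tab.
split; first exact: (gradient_L2 a'a bb' Tab mA A0 A4 dYA).
exact: (mean_gradient_drift a'a bb' Tab nab mA A0 A4 dYA M_incr).
Qed.

Local Notation pr := (proj_itv a b).

Let pr_Theta t : Theta (pr t).
Proof.
by apply: ab_Theta; rewrite /= in_itv/=; apply: proj_itv_bounds; exact: ltW.
Qed.

Lemma continuous_proj_itv : continuous pr.
Proof.
rewrite (_ : pr = fun x => Num.max a (Num.min b x)); last first.
  by apply/funext => x; apply: proj_itv_maxmin; exact: ltW.
move=> x; apply: (@continuous_max _ _ (cst a)); first exact: cvg_cst.
by apply: (@continuous_min _ _ (cst b) id); [exact: cvg_cst|exact: cvg_id].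
Qed.

(** Composing with the projection turns continuity relative to [Theta] into continuity on the whole
    line, as the Caratheodory criterion demands. *)
Let pr_cvg (g : R -> R) t : g s @[s --> within Theta (nbhs (pr t))] --> g (pr t) ->
  g (pr s) @[s --> t] --> g (pr t).
Proof.
apply: (@cvg_comp _ _ _ pr g) => B.
rewrite /nbhs/= /within/= => hB; have := @continuous_proj_itv t _ hB.
apply: (@filterS _ (nbhs t) _ (pr @^-1` (fun y => Theta y -> B y))) => s.
by apply; exact: pr_Theta.
Qed.

(* Projecting onto [a, b] and extending by 0 off I1 makes these functions
   Caratheodory functions on the whole plane. *)
Definition inv_field t u := ((fun u => Y u (pr t)) \_ I1) u.

Definition gradient_field t u :=
  ((fun u => - 2 * dY u (pr t) * (u - Y u (pr t))) \_ I1) u.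

Lemma measurable_inv_field :
  measurable_fun [set: (R * R)%type] (fun z => inv_field z.1 z.2).
Proof.
have mI : measurable I1 by exact: is_interval_measurable.
apply: measurable_caratheodory => [u t|t]; last first.
  by apply/(measurable_restrictT _ mI); exact: measurable_Y.
have [Iu|nIu] := pselect (I1 u); last first.
  rewrite (_ : inv_field^~ u = cst 0); first exact: cvg_cst.
  by apply/funext => s; rewrite /inv_field patchE memNset.
rewrite (_ : inv_field^~ u = fun t => Y u (pr t)); last first.
  by apply/funext => s; rewrite /inv_field patchE mem_set.
by apply: (@pr_cvg (Y u)); exact: Y_cvg.
Qed.

Lemma measurable_gradient_field :
  measurable_fun [set: (R * R)%type] (fun z => gradient_field z.1 z.2).
Proof.
have mI : measurable I1 by exact: is_interval_measurable.
have Ta : Theta a by apply: ab_Theta; rewrite /= in_itv/= lexx ltW.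
have Tb : Theta b by apply: ab_Theta; rewrite /= in_itv/= lexx ltW.
apply: measurable_caratheodory => [u t|t]; last first.
  apply/(measurable_restrictT _ mI); apply: measurable_funM.
    apply: measurable_funM; first exact: measurable_cst.
    have [->|ta] := eqVneq (pr t) a; last by apply: (@measurable_dY _ a) => //; rewrite eq_sym.
    by apply: (@measurable_dY a b) => //; rewrite gt_eqF.
  by apply: measurable_funB; [exact: measurable_id|exact: measurable_Y].
have [Iu|nIu] := pselect (I1 u); last first.
  rewrite (_ : gradient_field^~ u = cst 0); first exact: cvg_cst.
  by apply/funext => s; rewrite /gradient_field patchE memNset.
rewrite (_ : gradient_field^~ u = fun t => - 2 * dY u (pr t) * (u - Y u (pr t)));
  last by apply/funext => s; rewrite /gradient_field patchE mem_set.
apply: cvgM; first apply: cvgM; first exact: cvg_cst.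
  by apply: (@pr_cvg (dY u)); exact: dY_cvg.
by apply: cvgB; [exact: cvg_cst|apply: (@pr_cvg (Y u)); exact: Y_cvg].
Qed.

Lemma inv_fieldE t u : a <= t <= b -> I1 u -> inv_field t u = Y u t.
Proof. by move=> tab Iu; rewrite /inv_field patchE mem_set// proj_itv_id. Qed.

Lemma gradient_fieldE t u : a <= t <= b -> I1 u ->
  gradient_field t u = - 2 * dY u t * (u - Y u t).
Proof. by move=> tab Iu; rewrite /gradient_field patchE mem_set// proj_itv_id. Qed.

End gradient.

(** * Almost sure convergence *)

(** The iterates stay in [a, b] and the noise in [I1], so the projection and the extension by 0
    inside [gradient_field] are never felt. *)
Lemma theta_hat_robbins_monro (R : realType) (Theta I1 : set R) (phi : R -> R -> R)
    (theta a b theta0 : R) (gamma e : nat -> R) (n : nat) :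
  a <= theta <= b -> a <= theta0 <= b -> (forall n, I1 (e n)) ->
  theta_hat Theta I1 phi theta a b theta0 gamma e n =
  robbins_monro a b theta0 gamma (gradient_field Theta I1 theta a b phi) e n.
Proof.
move=> theta_ab theta0_ab eI; elim: n => //= n ->.
by rewrite gradient_fieldE//; exact: (robbins_monro_bounds _ _ theta_ab).
Qed.

(** * The summands of the estimator *)

Section kernel_step.
Context d (T : measurableType d) (R : realType) (P : probability T R).
Variables (Theta I1 I2 : set R) (theta a b alpha x : R) (phi : R -> R -> R).
Variables (e : {RV P >-> R}) (f K : R -> R).
Hypothesis I1_itv : is_interval I1.
Hypothesis Theta_theta : Theta theta.
Hypothesis e_I1 : forall w, I1 (e w).
Hypothesis phi_bij : forall t, Theta t -> set_bij I1 I2 (phi t).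
Hypothesis phi_incr : forall t, Theta t ->
  forall u v, I1 u -> I1 v -> u < v -> phi t u < phi t v.
Hypothesis inv_phi_C1 : forall x, I2 x -> Ck_on Theta 1 (inv_phi I1 phi ^~ x).
Hypothesis lt_ab : a < b.
Hypothesis ab_Theta : `[a, b] `<=` Theta.
Hypothesis f_density : has_density e f.
Hypothesis f_bounded : bounded_on I1 f.
Hypothesis f_C2 : Ck_on I1 2 f.
Hypothesis phi_C3 : forall t, Theta t -> Ck_on I1 3 (phi t).
Hypothesis inv_phi_C3 : Ck_on I2 3 (inv_phi I1 phi theta).
Hypothesis dinv_phi_bounded : forall k, (1 <= k <= 3)%N ->
  bounded_on I2 (deriven_within I2 k (inv_phi I1 phi theta)).
Hypothesis dphi_bounded : forall k, (1 <= k <= 3)%N ->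
  exists C, forall t u, Theta t -> I1 u -> `|deriven_within I1 k (phi t) u| <= C.
Hypothesis K_ge0 : forall u, 0 <= K u.
Hypothesis K_sym : forall u, K (- u) = K u.
Hypothesis K_int : lebesgue_measure.-integrable setT (EFin \o K).
Hypothesis K_bounded : bounded_on setT K.
Hypothesis K_int1 : (\int[lebesgue_measure]_u (K u)%:E = 1)%E.
Hypothesis alpha_01 : 0 < alpha < 1.

Local Notation bw := (bandwidth alpha).

Lemma bandwidth_gt0 n : (0 < n)%N -> (0 : R) < bw n.
Proof. by move=> n0; rewrite /bandwidth powR_gt0// ltr0n. Qed.

Lemma bandwidth_cvg0 : bw n @[n --> \oo] --> (0 : R).
Proof.
have al0 : 0 < alpha by case/andP: alpha_01.
apply/cvgrPdist_lt => r r0; have r1 : 0 < r^-1 by rewrite invr_gt0.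
(* Beyond this index n > r^(-1/alpha), that is n^(-alpha) < r. *)
exists (Num.trunc (r^-1 `^ alpha^-1)).+1 => // n /= nr.
have {nr} nr : r^-1 `^ alpha^-1 < n%:R.
  by apply: lt_le_trans (truncnS_gt _) _; rewrite ler_nat.
have n0 : 0 < n%:R :> R by apply: le_lt_trans nr; exact: powR_ge0.
rewrite sub0r normrN ger0_norm ?powR_ge0// /bandwidth powRN.
rewrite -[ltRHS]invrK ltf_pV2 ?posrE ?powR_gt0//.
rewrite -[ltLHS](powRr1 (ltW r1)) -[X in _ `^ X](mulVf (lt0r_neq0 al0)) powRrM.
by apply: gt0_ltr_powR; rewrite ?nnegrE ?powR_ge0// ltW.
Qed.

Definition kernel_step n t u := (bw n)^-1 * K ((x - inv_field I1 theta a b phi t u) / bw n).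

Let measurable_K : measurable_fun setT K.
Proof. by have /integrableP[/measurable_EFinP] := K_int. Qed.

Lemma measurable_kernel_step n :
  measurable_fun [set: (R * R)%type] (fun z => kernel_step n z.1 z.2).
Proof.
apply: measurable_funM; first exact: measurable_cst.
apply: measurableT_comp => //; apply: measurable_funM; last exact: measurable_cst.
apply: measurable_funB; first exact: measurable_cst.
exact: (measurable_inv_field I1_itv Theta_theta phi_bij phi_incr inv_phi_C1 lt_ab ab_Theta).
Qed.

Lemma kernel_step_ge0 n t u : 0 <= kernel_step n t u.
Proof. by rewrite mulr_ge0// invr_ge0 powR_ge0. Qed.

Lemma kernel_step_mean n t : a <= t <= b ->
  \int[P]_w kernel_step n t (e w) =
  \int[P]_w ((bw n)^-1 * K ((inv_phi I1 phi t (phi theta (e w)) - x) / bw n)).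
Proof.
move=> tab; apply: eq_Rintegral => w _; rewrite /kernel_step inv_fieldE//.
(* Symmetry of the kernel exchanges x - Z(t) and Z(t) - x. *)
by rewrite -K_sym -mulNr opprB.
Qed.

Let kernel_step_section n t : measurable_fun setT (fun w => kernel_step n t (e w)).
Proof.
rewrite (_ : (fun w => _) =
  (fun z : R * R => kernel_step n z.1 z.2) \o (fun w => (t, e w)))//.
apply: measurableT_comp; first exact: measurable_kernel_step.
by apply: measurable_fun_pair; [exact: measurable_cst|exact: measurable_funP].
Qed.

Lemma kernel_step_le (C : R) n t u : (forall v, K v <= C) ->
  kernel_step n t u <= (bw n)^-1 * C.
Proof. by move=> KC; rewrite ler_wpM2l// invr_ge0 powR_ge0. Qed.

(** One factor K/h is at most C'/h = C' n^alpha, and the mean of the other is at most D uniformly in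
    n and t; the second moment is thus of order 1/h. *)
Lemma kernel_step_L2 : exists c, forall n t,
  (0 < n)%N -> a <= t <= b ->
  (\int[P]_w (kernel_step n t (e w) ^+ 2)%:E <= (c * n%:R `^ alpha)%:E)%E.
Proof.
have [C' hC'] := K_bounded.
have KC u : K u <= C' by apply: le_trans (hC' u I); exact: ler_norm.
have C0 : 0 <= C' by exact: le_trans (KC 0).
have [D hD] := kernel_mean_bounded I1_itv Theta_theta e_I1 phi_bij phi_incr f_density
  f_bounded f_C2 phi_C3 inv_phi_C3 dinv_phi_bounded dphi_bounded K_int K_bounded x.
exists (C' * D) => n t n0 tab; pose ks w := kernel_step n t (e w).
have bE : (bw n)^-1 = n%:R `^ alpha by rewrite /bandwidth powRN invrK.
have b0 : 0 <= (bw n)^-1 * C' by rewrite mulr_ge0// invr_ge0 powR_ge0.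
have ksi : P.-integrable setT (EFin \o ks).
  apply: (@bounded_integrable _ _ _ P _ ((bw n)^-1 * C')) => //.
    exact: kernel_step_section.
  by move=> w; rewrite ger0_norm ?kernel_step_ge0// kernel_step_le.
apply: (@le_trans _ _ (\int[P]_w (((bw n)^-1 * C') * ks w)%:E)%E).
  apply: ge0_le_integral => //.
  - by move=> w _; rewrite lee_fin sqr_ge0.
  - by apply/measurable_EFinP; apply: measurable_funX; exact: kernel_step_section.
  - apply/measurable_EFinP; apply: measurable_funM => //; exact: kernel_step_section.
  - move=> w _; rewrite lee_fin expr2 ler_wpM2r// ?kernel_step_ge0//.
    exact: kernel_step_le.
under eq_integral do rewrite EFinM.
rewrite integralZl// -EFin_Rintegral// -EFinM lee_fin bE -mulrA mulrC.
rewrite ler_wpM2r ?powR_ge0// ler_wpM2l//.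
rewrite /ks kernel_step_mean// hD//; last exact: bandwidth_gt0.
by apply: ab_Theta; rewrite /= in_itv.
Qed.

(** The shift is that of the estimator: summand n+1 is evaluated at iterate n, which is determined
    before eps_{n+1}. *)
Lemma kernel_step_mean_cvg (t : nat -> R) : I1 x -> I1° x \/ {for x, continuous f} ->
  (forall n, a <= t n <= b) -> t n @[n --> \oo] --> theta ->
  \int[P]_w kernel_step n.+1 (t n) (e w) @[n --> \oo] --> f x.
Proof.
move=> Ix xf tab tt; under eq_fun do rewrite kernel_step_mean//.
apply: (kernel_mean_cvg (I2 := I2) (Theta := Theta)) => //.
- by move=> n; apply: ab_Theta; rewrite /= in_itv/=.
- by move=> n; exact: bandwidth_gt0.
- by rewrite (cvg_shiftS bw); exact: bandwidth_cvg0.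
Qed.

End kernel_step.

Theorem theorem4p1 (R : realType)
  (d : measure_display) (T : measurableType d) (P : probability T R)
  (Theta I1 I2 : set R) (theta : R) (phi : R -> R -> R)
  (eps : nat -> {RV P >-> R})
  (a b theta0 : R) (gamma : nat -> R) (K : R -> R) (alpha : R) (f : R -> R)
  (* the model *)
  (Theta_itv : is_interval Theta) (I1_itv : is_interval I1)
  (Theta_theta : Theta theta)
  (eps_indep : mutually_independent eps)
  (eps_id : identically_distributed eps)
  (eps_I1 : forall n w, I1 (eps n w))
  (* (i) *)
  (phi_bij : forall t, Theta t -> set_bij I1 I2 (phi t))
  (phi_incr : forall t, Theta t ->
     forall u v, I1 u -> I1 v -> u < v -> phi t u < phi t v)
  (* (ii) *)
  (inv_phi_C1 : forall x, I2 x -> Ck_on Theta 1 (inv_phi I1 phi ^~ x))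
  (* (iii) *)
  (inv_phi_L2 : forall t, Theta t ->
     ('E_P[fun w => (`|inv_phi I1 phi t (phi theta (eps 0%N w))| ^+ 2)%R]
        < +oo)%E)
  (* (iv) *)
  (dinv_phi_L4 : forall B : set R, compact B -> B `<=` Theta ->
     (\int[P]_w ereal_sup
        [set (`|dinv_phi Theta I1 phi t (phi theta (eps 0%N w))| ^+ 4)%:E
           | t in B] < +oo)%E)
  (* (v) *)
  (lt_ab : a < b) (ab_Theta : `[a, b] `<=` Theta) (theta_ab : a < theta < b)
  (M_incr : forall t, a <= t <= b -> t != theta ->
     0 < (t - theta) *
         derive_within Theta (mean_square I1 phi theta (eps 0%N)) t)
  (f_density : has_density (eps 0%N) f)
  (* (vi) *)
  (f_bounded : bounded_on I1 f) (f_C2 : Ck_on I1 2 f)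
  (df_bounded : forall k, (1 <= k <= 2)%N ->
     bounded_on I1 (deriven_within I1 k f))
  (* (vii) *)
  (phi_C3 : forall t, Theta t -> Ck_on I1 3 (phi t))
  (* (viii) *)
  (inv_phi_C3 : Ck_on I2 3 (inv_phi I1 phi theta))
  (dinv_phi_bounded : forall k, (1 <= k <= 3)%N ->
     bounded_on I2 (deriven_within I2 k (inv_phi I1 phi theta)))
  (* (ix) *)
  (dphi_bounded : forall k, (1 <= k <= 3)%N ->
     exists C, forall t u, Theta t -> I1 u ->
       `|deriven_within I1 k (phi t) u| <= C)
  (* the step sizes and the starting point *)
  (gamma_gt0 : forall n, (1 <= n)%N -> 0 < gamma n)
  (gamma_decr : forall n, (1 <= n)%N -> gamma n.+1 <= gamma n)
  (gamma_sum : (\sum_(1 <= n <oo) (gamma n)%:E = +oo)%E)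
  (gamma_sum2 : (\sum_(1 <= n <oo) (gamma n ^+ 2)%:E < +oo)%E)
  (theta0_ab : a <= theta0 <= b)
  (* the kernel and the bandwidth *)
  (K_ge0 : forall u, 0 <= K u) (K_sym : forall u, K (- u) = K u)
  (K_int : lebesgue_measure.-integrable setT (EFin \o K))
  (K_bounded : bounded_on setT K)
  (K_int1 : (\int[lebesgue_measure]_u (K u)%:E = 1)%E)
  (K_pinfty : `|u| * K u @[u --> +oo] --> 0)
  (K_ninfty : `|u| * K u @[u --> -oo] --> 0)
  (K_moment2 : (\int[lebesgue_measure]_u (u ^+ 2 * K u)%:E < +oo)%E)
  (alpha_01 : 0 < alpha < 1) :
  (* the second condition on x only concerns the endpoints of I1: there it asks
     that the density f, as a function on R, have no jump *)
  forall x, I1 x -> I1° x \/ {for x, continuous f} ->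
    {ae P, forall w,
      f_hat Theta I1 phi theta a b theta0 gamma K alpha (eps ^~ w) n x
        @[n --> \oo] --> f x}.
Proof.
move=> x Ix xf.
have theta_ab' : a <= theta <= b by case/andP: theta_ab => /ltW -> /ltW ->.
pose H := gradient_field Theta I1 theta a b phi.
have mH : measurable_fun [set: (R * R)%type] (fun z => H z.1 z.2).
  exact: (measurable_gradient_field Theta_itv I1_itv Theta_theta phi_bij phi_incr
    inv_phi_C1 lt_ab ab_Theta).
have HE t w : a <= t <= b -> H t (eps 0%N w) = - 2 *
    dinv_phi Theta I1 phi t (phi theta (eps 0%N w)) *
    (eps 0%N w - inv_phi I1 phi t (phi theta (eps 0%N w))).
  by move=> tab; exact: gradient_fieldE.
have [[c L2] drift] := gradient_bounds Theta_itv I1_itv Theta_theta (eps_I1 0%N)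
  phi_bij phi_incr inv_phi_C1 dinv_phi_L4 lt_ab ab_Theta theta_ab M_incr.
pose th n w := robbins_monro a b theta0 gamma H (fun k => eps k w) n.
have th_ab n w : a <= th n w <= b by exact: (robbins_monro_bounds _ _ theta_ab').
have th_cvg : {ae P, forall w, th n w @[n --> \oo] --> theta}.
  apply: (robbins_monro_cvg eps_indep eps_id theta_ab' theta0_ab gamma_gt0 gamma_sum
    gamma_sum2 mH (c := c)) => [t tab|r r0].
    by under eq_integral do rewrite HE//; exact: L2.
  have [eta eta0 h] := drift r r0; exists eta => // t tab rt.
  by under eq_Rintegral do rewrite HE//; exact: h.
pose k n := kernel_step I1 theta a b alpha x phi K n.
have [c' k_L2] := @kernel_step_L2 _ _ _ P Theta I1 I2 theta a b alpha x phi (eps 0%N) f K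
  I1_itv Theta_theta (eps_I1 0%N) phi_bij phi_incr inv_phi_C1 lt_ab ab_Theta f_density
  f_bounded f_C2 phi_C3 inv_phi_C3 dinv_phi_bounded dphi_bounded K_ge0 K_sym K_int K_bounded.
have [C KC] : exists C, forall u, K u <= C.
  have [C hC] := K_bounded; exists C => u; apply: le_trans (hC u I); exact: ler_norm.
have : {ae P, forall w,
    n%:R^-1 * \sum_(1 <= i < n.+1) k i (th i.-1 w) (eps i w) @[n --> \oo] --> f x}.
  apply: (recursive_lln eps_indep eps_id (B := fun n => (bandwidth alpha n)^-1 * C) alpha_01 _
    th_ab _ _ _ k_L2).
  - by move=> n; exact: (robbins_monro_past _ _ theta_ab' mH).
  - move=> n; exact: (measurable_kernel_step _ _ I1_itv Theta_theta phi_bij phi_incr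
      inv_phi_C1 lt_ab ab_Theta K_int).
  - by move=> n t u; exact: (kernel_step_ge0 _ _ _ _ _ _ _ K_ge0).
  - by move=> n t u; exact: (kernel_step_le _ _ _ _ _ _ _ _ _ _ KC).
  (* The convergence of means is deterministic in the sequence t_n; it is applied to the iterates
     along almost every path. *)
  - apply: filterS th_cvg => w tw.
    by apply: (kernel_step_mean_cvg (Theta := Theta) (I2 := I2)).
apply: filterS => w; rewrite (_ : (fun n => _) = fun n =>
  f_hat Theta I1 phi theta a b theta0 gamma K alpha (eps ^~ w) n x)//.
apply/funext => n; rewrite /f_hat; congr (_ * _); apply: eq_bigr => i _.
rewrite theta_hat_robbins_monro// /k /kernel_step inv_fieldE//.
Qed.
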